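(* Let $\phi$ be an admissible action density and $\gamma\in\mathcal M^+_{\rm loc}(\mathbb R^d)$. For every $\sigma\in\mathcal M^+_{\rm loc}(\mathbb R^d)$, the space $\mathcal M_{\phi,\gamma}[\sigma]$ endowed with the distance $\mathcal W_{\phi,\gamma}$ is a complete metric space.
   Context: Notation: $\mathcal M^+_{\rm loc}(\mathbb R^d)$ is the set of nonnegative Radon measures on $\mathbb R^d$ and $\mathcal M_{\rm loc}(\mathbb R^d;\mathbb R^d)$ the set of $\mathbb R^d$-valued Radon measures, both endowed with the weak$^*$ topology induced by duality with compactly supported continuous functions; $|\boldsymbol\nu|$ is the total variation measure of $\boldsymbol\nu$; $B_R$ is the open ball of radius $R$ centered at $0$; $p\in(1,\infty)$ and $q=p/(p-1)$. An admissible action density is a function $\phi:(0,\infty)\times\mathbb R^d\to[0,\infty)$ which is convex, satisfies $\phi(\rho,\lambda w)=|\lambda|^p\phi(\rho,w)$ for all $\rho>0,\lambda\in\mathbb R,w\in\mathbb R^d$, and for which there is $\rho_0>0$ with $\phi(\rho_0,w)>0$ for all $w\ne0$. It is extended to $\rho=0$ by $\phi(0,w):=\lim_{\rho\downarrow0}\phi(\rho,w)\in[0,\infty]$ (the map $\rho\mapsto\phi(\rho,w)$ is nonincreasing), and its recession function is $\phi^\infty(\rho,w):=\lim_{\lambda\to+\infty}\lambda^{-1}\phi(\lambda\rho,\lambda w)\in[0,\infty]$ for $\rho\ge0$. Action functional: given $\gamma\in\mathcal M^+_{\rm loc}(\mathbb R^d)$, $\mu\in\mathcal M^+_{\rm loc}(\mathbb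 R^d)$, $\boldsymbol\nu\in\mathcal M_{\rm loc}(\mathbb R^d;\mathbb R^d)$ with $\mathrm{supp}\,\mu,\mathrm{supp}\,\boldsymbol\nu\subset\mathrm{supp}\,\gamma$, write the Lebesgue decompositions $\mu=\rho\gamma+\mu^\perp$, $\boldsymbol\nu=w\gamma+\boldsymbol\nu^\perp$, pick any $\sigma\in\mathcal M^+_{\rm loc}(\mathbb R^d)$ with $\mu^\perp=\rho^\perp\sigma$, $\boldsymbol\nu^\perp=w^\perp\sigma$, and set $\Phi(\mu,\boldsymbol\nu|\gamma):=\int\phi(\rho,w)\,d\gamma+\int\phi^\infty(\rho^\perp,w^\perp)\,d\sigma$ (independent of $\sigma$); set $\Phi(\mu,\boldsymbol\nu|\gamma)=+\infty$ if the support condition fails. Continuity equation: for $T>0$, $\mathrm{CE}(0,T)$ is the set of pairs $(\mu,\boldsymbol\nu)$ where $(\mu_t)_{t\in[0,T]}$ is a weakly$^*$ continuous curve in $\mathcal M^+_{\rm loc}(\mathbb R^d)$, $(\boldsymbol\nu_t)_{t\in(0,T)}$ is a Borel family in $\mathcal M_{\rm loc}(\mathbb R^d;\mathbb R^d)$ with $\int_0^T|\boldsymbol\nu_t|(B_R)\,dt<\infty$ for all $R>0$, and $\int_0^T\!\int\partial_t\zeta\,d\mu_t\,dt+\int_0^T\!\int\nabla_x\zeta\cdot d\boldsymbol\nu_t\,dt=0$ for all $\zeta\in C^1_c(\mathbb R^d\times(0,T))$; $\mathrm{CE}(0,T;\sigma\to\eta)$ is the subset with $\mu_0=\sigma$,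 $\mu_T=\eta$. Weighted Wasserstein distance: $\mathcal W_{\phi,\gamma}(\mu_0,\mu_1):=\big(\inf\{\int_0^1\Phi(\mu_t,\boldsymbol\nu_t|\gamma)\,dt:(\mu,\boldsymbol\nu)\in\mathrm{CE}(0,1;\mu_0\to\mu_1)\}\big)^{1/p}\in[0,\infty]$, and $\mathcal M_{\phi,\gamma}[\sigma]:=\{\mu\in\mathcal M^+_{\rm loc}(\mathbb R^d):\mathcal W_{\phi,\gamma}(\mu,\sigma)<\infty\}$. *)

(* Defs.v *)
From HB Require Import structures.
From mathcomp Require Import all_boot all_order all_algebra.
From mathcomp Require Import all_classical all_reals all_analysis.
Set Implicit Arguments. Unset Strict Implicit. Unset Printing Implicit Defensive.
Import Order.TTheory GRing.Theory Num.Theory.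
Import numFieldNormedType.Exports.
Local Open Scope classical_set_scope.
Local Open Scope ring_scope.

Section WeightedWasserstein.
Variables (R : realType) (d : nat).

Definition Rd := 'rV[R]_d.
Definition RdB := g_sigma_algebraType (@open Rd).

Definition Meas := {measure set RdB -> \bar R}.

Definition enorm (v : Rd) : R := Num.sqrt (\sum_(i < d) (v ord0 i) ^+ 2).
Definition Eball_at (x : Rd) (r : R) : set RdB := [set y : Rd | enorm (y - x) < r].
Definition Eball (r : R) : set RdB := Eball_at 0 r.
Definition bnd (A : set RdB) := exists r : R, A `<=` Eball r.

(* nonnegative Radon measure on R^d = locally finite Borel measure *)
Definition radon (mu : Meas) := forall r : R, (mu (Eball r) < +oo)%E.

(* R^d-valued Radon measure: each component is a signed Radon measure,
   given as the difference of two nonnegative Radon measures *)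
Record vmeasure := VMeasure { vpos : 'I_d -> Meas ; vneg : 'I_d -> Meas }.
Definition vradon (nu : vmeasure) := forall i, radon (vpos nu i) /\ radon (vneg nu i).
(* value of the i-th component on a bounded Borel set *)
Definition vmeas (nu : vmeasure) (A : set RdB) (i : 'I_d) : R :=
  fine (vpos nu i A) - fine (vneg nu i A).
Definition vint (nu : vmeasure) (i : 'I_d) (f : Rd -> R) : R :=
  fine (\int[vpos nu i]_x (f x)%:E)%E - fine (\int[vneg nu i]_x (f x)%:E)%E.
(* total variation measure |nu| (Euclidean), on (bounded) Borel sets *)
Definition tv (nu : vmeasure) (A : set RdB) : \bar R :=
  ereal_sup [set S | exists F : nat -> set RdB,
    [/\ (forall k, measurable (F k)), trivIset setT F, \bigcup_k F k = A &
        S = (\sum_(0 <= k <oo) (enorm (\row_i vmeas nu (F k) i))%:E)%E]].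

Definition supp (mu : Meas) : set Rd :=
  [set x | forall r : R, 0 < r -> (0 < mu (Eball_at x r))%E].
Definition vsupp (nu : vmeasure) : set Rd :=
  [set x | forall r : R, 0 < r -> (0 < tv nu (Eball_at x r))%E].

Definition meq (mu eta : Meas) := forall A, measurable A -> mu A = eta A.
Definition singular (s g : Meas) :=
  exists N : set RdB, [/\ measurable N, g N = 0%E & s (~` N) = 0%E].

Definition admissible (p : R) (phi : R -> Rd -> R) :=
  [/\ (forall r w, 0 < r -> 0 <= phi r w),
      (forall r1 r2 w1 w2 (t : R), 0 < r1 -> 0 < r2 -> 0 <= t <= 1 ->
         phi (t * r1 + (1 - t) * r2) (t *: w1 + (1 - t) *: w2)
           <= t * phi r1 w1 + (1 - t) * phi r2 w2),
      (forall r (l : R) w, 0 < r -> phi r (l *: w) = powR `|l| p * phi r w) &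
      exists r0, 0 < r0 /\ forall w, w != 0 -> 0 < phi r0 w].

Definition phi_ext (phi : R -> Rd -> R) (r : R) (w : Rd) : \bar R :=
  if 0 < r then (phi r w)%:E else lim ((fun s => (phi s w)%:E) @ 0^'+).
Definition phi_inf (phi : R -> Rd -> R) (r : R) (w : Rd) : \bar R :=
  lim ((fun l : R => ((l^-1)%:E * phi_ext phi (l * r) (l *: w))%E) @ +oo).

(* The candidate values of Phi(mu, nu | gamma) obtained from Lebesgue
   decompositions mu = rho gamma + rhos s, nu = w gamma + ws s, s _|_ gamma *)
Definition Phi_repr (phi : R -> Rd -> R) (g mu : Meas) (nu : vmeasure) (v : \bar R) :=
  exists (rho : RdB -> R) (w : RdB -> Rd) (s : Meas) (rhos : RdB -> R) (ws : RdB -> Rd),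
  [/\ [/\ measurable_fun setT rho, measurable_fun setT rhos,
          (forall i, measurable_fun setT (fun x => w x ord0 i) /\
                     measurable_fun setT (fun x => ws x ord0 i)) &
          (forall x, 0 <= rho x /\ 0 <= rhos x)],
      (radon s /\ singular s g),
      (forall A, measurable A -> bnd A ->
         mu A = (\int[g]_(x in A) (rho x)%:E + \int[s]_(x in A) (rhos x)%:E)%E),
      (forall A i, measurable A -> bnd A ->
         [/\ (\int[g]_(x in A) `|w x ord0 i|%:E < +oo)%E,
             (\int[s]_(x in A) `|ws x ord0 i|%:E < +oo)%E &
             vmeas nu A i = fine (\int[g]_(x in A) (w x ord0 i)%:E)%E
                            + fine (\int[s]_(x in A) (ws x ord0 i)%:E)%E]) &
      v = (\int[g]_x phi_ext phi (rho x) (w x) + \int[s]_x phi_inf phi (rhos x) (ws x))%E].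

(* action functional; +oo if the support condition fails *)
Definition Phi (phi : R -> Rd -> R) (g mu : Meas) (nu : vmeasure) : \bar R :=
  ereal_inf [set v | [/\ supp mu `<=` supp g, vsupp nu `<=` supp g & Phi_repr phi g mu nu v]].

Definition Cc (f : Rd -> R) :=
  continuous f /\ compact (closure [set x | f x != 0]).

Definition evec (i : 'I_d) : Rd := delta_mx ord0 i.
Definition dxi (z : Rd -> R -> R) (i : 'I_d) (x : Rd) (t : R) : R :=
  derive1 (fun s : R => z (x + s *: evec i) t) 0.
Definition dtm (z : Rd -> R -> R) (x : Rd) (t : R) : R :=
  derive1 (fun s : R => z x (t + s)) 0.

Definition C1c (T : R) (z : Rd -> R -> R) :=
  [/\ continuous (fun q : Rd * R => z q.1 q.2),
      ((forall x t i, derivable (fun s : R => z (x + s *: evec i) t) 0 1) /\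
       (forall x t, derivable (fun s : R => z x (t + s)) 0 1)),
      ((forall i, continuous (fun q : Rd * R => dxi z i q.1 q.2)) /\
       continuous (fun q : Rd * R => dtm z q.1 q.2)),
      compact (closure [set q : Rd * R | z q.1 q.2 != 0]) &
      closure [set q : Rd * R | z q.1 q.2 != 0] `<=` [set q | 0 < q.2 < T]].

Definition CE (T : R) (mu : R -> Meas) (nu : R -> vmeasure) :=
  [/\ ((forall t, 0 <= t <= T -> radon (mu t)) /\
       (forall t, 0 < t < T -> vradon (nu t))),
      (forall f, Cc f -> {within `[0, T], continuous
                            (fun t => fine (\int[mu t]_x (f x)%:E)%E)}),
      (forall f i, Cc f -> measurable_fun `]0, T[ (fun t => vint (nu t) i f)),
      (forall r : R, 0 < r ->
         (\int[lebesgue_measure]_(t in `]0%R, T%R[) tv (nu t) (Eball r) < +oo)%E) &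
      (forall z, C1c T z ->
         (\int[lebesgue_measure]_(t in `]0%R, T%R[)
              (fine (\int[mu t]_x (dtm z x t)%:E)%E)%:E
          + \int[lebesgue_measure]_(t in `]0%R, T%R[)
              (\sum_(i < d) vint (nu t) i (fun x => dxi z i x t))%:E = 0)%E)].

Definition Wdist (p : R) (phi : R -> Rd -> R) (g m0 m1 : Meas) : \bar R :=
  poweR (ereal_inf [set v | exists (mu : R -> Meas) (nu : R -> vmeasure),
     [/\ CE 1 mu nu, meq (mu 0) m0, meq (mu 1) m1 &
         v = (\int[lebesgue_measure]_(t in `]0%R, 1%R[) Phi phi g (mu t) (nu t))%E]]) p^-1.

Definition Mspace (p : R) (phi : R -> Rd -> R) (g sigma : Meas) : set Meas :=
  [set mu | radon mu /\ (Wdist p phi g mu sigma < +oo)%E].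

End WeightedWasserstein.

(* Main.v *)
(* The action controls the flux: a Young inequality for the density gives, for a cutoff z and
   k >= p, |sum_i int g_i dnu_i| <= M Phi(mu, nu | gamma) + e (int z^k dgamma + int z^k dmu)
   as soon as |g| <= C z^(k-1). Along a curve of finite action, taking for g the gradient of z^k
   bounds the growth of the mass int z^k dmu_t; then a small action moves int f dmu_t by little,
   uniformly over curves of bounded initial mass. Hence W = 0 forces equality, and a W-Cauchy
   sequence converges weakly* to a measure (Riesz-Markov).

   Everything else comes from countable concatenation: if W(v_k, v_(k+1)) < e_k, sum_k e_k = S and
   v_k converges weakly* to m, then running through the k-th curve in time e_k / S gives one curve
   from v_0 to m, continuous at the end time by the previous estimate, whence W(v_0, m) <= S.
   For a, b, c, c, c, ... this is the triangle inequality; for a fast subsequence of a Cauchy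
   sequence it is completeness; and W(c, c) = 0 follows from c, mu_(t_1), c, mu_(t_2), ...
   where mu is a curve of finite action issued from c and t_j decreases to 0.

   Curves are concatenated in integrated form, int g dmu_t - int g dmu_0 = int_0^t (flux of grad g),
   with tests g independent of time. This form follows from the weak one by time ramps, and gives
   it back by freezing time-dependent tests on a fine grid of times. *)

(* The infimum that defines the distance is never shown to be attained: no compactness of curves and
   no semicontinuity of the action enters. Compactness is replaced by the estimate that a small
   action moves little, uniformly over curves of bounded initial mass, and minimal curves by curves
   of action strictly below e^p, with margins that are summable along a chain.

   The constant curve is not the way to W(c, c) = 0: its action involves the support condition and a
   Lebesgue decomposition at c itself, while an action integrated over time gives no information at
   a single time. Going back and forth between c and nearby measures on a curve issued from c uses
   only what a finite action provides.

   Homogeneity of degree p > 1 in the flux acts twice: a short arc stretched to unit time becomes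
   cheap, and curves run through in times proportional to their lengths have costs that add up like
   lengths. *)
Require Import Defs.
From HB Require Import structures.
From mathcomp Require Import all_boot all_order all_algebra.
From mathcomp Require Import all_classical all_reals all_analysis.
From mathcomp Require Import measurable_realfun ring lra.
Import Order.TTheory GRing.Theory Num.Theory.
Import numFieldNormedType.Exports.
Local Open Scope classical_set_scope.
Local Open Scope ring_scope.
Set Implicit Arguments.
Unset Strict Implicit.
Unset Printing Implicit Defensive.

(** * Lower integrals *)

(* The action of a curve at time [t], and the total variation of its flux, are not known to be
   measurable in [t]. The integral of a nonnegative function that is not measurable is its lower
   integral, which is additive only when one of the two terms is measurable. *)
Section LowerIntegral.
Context d (T : measurableType d) (R : realType) (mu : {measure set T -> \bar R}).
Local Open Scope ereal_scope.
Import HBNNSimple.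

Lemma le_lower_integral (D : set T) (f g : T -> \bar R) :
  (forall x, D x -> 0 <= f x) -> (forall x, D x -> f x <= g x) ->
  \int[mu]_(x in D) f x <= \int[mu]_(x in D) g x.
Proof.
move=> f0 fg; have g0 x : D x -> 0 <= g x.
  by move=> Dx; exact: le_trans (f0 _ Dx) (fg _ Dx).
rewrite !ge0_integralE//; apply: le_ereal_sup => _ [h /= hf <-].
exists h => //= x; apply: le_trans (hf x) _; rewrite /patch.
by case: ifPn => // /[!inE] Dx; exact: fg.
Qed.

(** A lower integral is a supremum over simple functions below [f], so an upper bound has only to be
    checked on finite measurable minorants [h]. Every later comparison is reduced in this way to
    measurable integrands. *)
Lemma lower_integral_le (D : set T) (f : T -> \bar R) (X : \bar R) :
  measurable D -> (forall x, D x -> 0 <= f x) ->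
  (forall h : T -> R, measurable_fun setT h -> (forall x, (0 <= h x)%R) ->
     (forall x, D x -> (h x)%:E <= f x) ->
     \int[mu]_(x in D) (h x)%:E <= X) ->
  \int[mu]_(x in D) f x <= X.
Proof.
move=> mD f0 H; rewrite ge0_integralE//; apply: ge_ereal_sup => _ [h /= hf <-].
have hD' x : D x -> (h x)%:E <= f x.
  by move=> Dx; have := hf x; rewrite /patch mem_set.
have := H h (@measurable_funPT _ _ _ _ h) (fun x => fun_ge0 _) hD'.
rewrite integral_nnsfun//.
have hD x : (h \_ D) x = h x.
  rewrite /patch; case: ifPn => // xD; apply/esym/le_anti.
  rewrite fun_ge0 andbT -lee_fin; apply: le_trans (hf x) _.
  by rewrite /patch (negbTE xD).
by rewrite (_ : sintegral mu (h \_ D) = sintegral mu h)//; congr sintegral; exact/funext.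
Qed.

(** If [h] is a measurable minorant of [f + g], the positive part of [h - g] is a minorant of [f];
    it is measurable because [g] is. *)
Lemma lower_integralD_le (D : set T) (f g : T -> \bar R) : measurable D ->
  (forall x, D x -> 0 <= f x) -> (forall x, D x -> 0 <= g x) -> measurable_fun D g ->
  \int[mu]_(x in D) (f x + g x) <= \int[mu]_(x in D) f x + \int[mu]_(x in D) g x.
Proof.
move=> mD f0 g0 mg; apply: lower_integral_le => // [x Dx|h mh h0 hfg].
  by rewrite adde_ge0// ?f0 ?g0.
pose k x := maxe ((h x)%:E - g x) 0.
have mk : measurable_fun D k.
  apply: measurable_maxe => //; apply: emeasurable_funB => //.
  by apply/measurable_EFinP; exact: measurable_funTS.
have k0 x : D x -> 0 <= k x by move=> _; rewrite /k le_max lexx orbT.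
apply: (@le_trans _ _ (\int[mu]_(x in D) (k x + g x))).
  apply: le_lower_integral => x Dx; first by rewrite lee_fin.
  rewrite /k; have := g0 _ Dx; case: (g x) => [r| |]//= _; last first.
    by rewrite addey ?leey// -ltNye (@lt_le_trans _ _ 0)// le_max lexx orbT.
  by rewrite -leeBlDr// le_max lexx.
rewrite ge0_integralD// leeD2r// le_lower_integral// => x Dx.
rewrite /k ge_max f0// andbT; have := hfg _ Dx; have := g0 _ Dx.
case: (g x) => [r| |]// _ hle; first by rewrite leeBlDr.
by rewrite addeNy leNye.
Qed.

(** One inequality for all positive factors suffices: applied to [k^-1] it gives the reverse one. *)
Lemma lower_integralZl (D : set T) (f : T -> \bar R) (k : R) :
  measurable D -> (0 < k)%R -> (forall x, D x -> 0 <= f x) ->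
  \int[mu]_(x in D) (k%:E * f x) = k%:E * \int[mu]_(x in D) f x.
Proof.
have le (f' : T -> \bar R) (c : R) : measurable D -> (0 < c)%R -> (forall x, D x -> 0 <= f' x) ->
  \int[mu]_(x in D) (c%:E * f' x) <= c%:E * \int[mu]_(x in D) f' x.
  move=> mD c0 f0; apply: lower_integral_le => // [x Dx|h mh h0 hf].
    by rewrite mule_ge0// ?f0// lee_fin ltW.
  have -> : \int[mu]_(x in D) (h x)%:E = c%:E * \int[mu]_(x in D) (c^-1 * h x)%:E.
    rewrite -ge0_integralZl_EFin//=; last 3 first.
    - by move=> x Dx; rewrite lee_fin mulr_ge0// invr_ge0 ltW.
    - by apply/measurable_EFinP; apply: measurable_funM => //; exact: measurable_funTS.
    - exact: ltW.
    by apply: eq_integral => x _; rewrite -EFinM mulrA divff ?mul1r// gt_eqF.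
  rewrite lee_pmul2l// le_lower_integral// => x Dx.
    by rewrite lee_fin mulr_ge0// invr_ge0 ltW.
  move: (hf _ Dx) => hfx; by rewrite EFinM lee_pdivrMl.
move=> mD k0 f0; apply/le_anti; rewrite le//=.
have k1 : (0 < k^-1)%R by rewrite invr_gt0.
have := le (fun x => k%:E * f x) (k^-1)%R mD k1.
have -> : (fun x => (k^-1)%:E * (k%:E * f x)) = f.
  by apply/funext => x; rewrite muleA -EFinM mulVf ?mul1e// gt_eqF.
have kf0 x : D x -> 0 <= k%:E * f x.
  by move=> Dx; rewrite mule_ge0// ?f0// lee_fin ltW.
move=> /(_ kf0).
by rewrite lee_pdivlMl.
Qed.

(** The union may miss a null set: in a concatenation the pieces are open time intervals and the
    junction times are left out. *)
Lemma lower_integral_bigcup_le (D : set T) (F : nat -> set T) (f : T -> \bar R) :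
  measurable D -> (forall k, measurable (F k)) -> trivIset setT F ->
  (forall k, F k `<=` D) -> mu (D `\` \bigcup_k F k) = 0 ->
  (forall x, D x -> 0 <= f x) ->
  \int[mu]_(x in D) f x <= \sum_(k <oo) \int[mu]_(x in F k) f x.
Proof.
move=> mD mF tF FD nD f0; apply: lower_integral_le => // h mh h0 hf.
have mU : measurable (\bigcup_k F k) by exact: bigcupT_measurable.
have mhE E : measurable_fun E (fun x => (h x)%:E).
  by apply/measurable_EFinP; exact: measurable_funTS.
have -> : \int[mu]_(x in D) (h x)%:E = \int[mu]_(x in \bigcup_k F k) (h x)%:E.
  have UD : \bigcup_k F k `<=` D by move=> x [k _]; exact: FD.
  rewrite (ge0_negligible_integral _ _ _ _ nD)//; last 2 first.
  - exact: measurableD.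
  - by move=> x _; rewrite lee_fin.
  by rewrite setDD setIidr.
rewrite ge0_integral_bigcup//; last by move=> x _; rewrite lee_fin.
apply: lee_nneseries => k _ //; first by move=> _; apply: integral_ge0 => x _; rewrite lee_fin.
by apply: le_lower_integral => x Fx; rewrite ?lee_fin//; apply: hf; exact: FD Fx.
Qed.
End LowerIntegral.

(** * Affine changes of the time variable *)

Section AffineChange.
Context (R : realType).
Notation mu := (@lebesgue_measure R).
Local Open Scope ereal_scope.

Let aff (a b : R) (t : R) : R := (a + b * t)%R.

Lemma measurable_affine (a b : R) :
  measurable_fun setT (fun t : R => a + b * t : R)%R.
Proof. by apply: measurable_funD => //; apply: measurable_funM. Qed.

(** The right-hand side is a measure in [A], and Lebesgue measure is determined by its values on the
    intervals []x, y]]. For [b < 0] the preimage is closed at the other end, which does not affect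
    its length. *)
Lemma lebesgue_measure_affine (a b : R) (A : set R) : b != 0%R -> measurable A ->
  mu A = `|b|%:E * mu ((fun t : R => a + b * t)%R @^-1` A).
Proof.
move=> b0 mA.
pose th : measurableTypeR R -> measurableTypeR R := aff a b.
have mth : measurable_fun setT th by exact: measurable_affine.
pose nb : {nonneg R} := NngNum (normr_ge0 b).
apply: (lebesgue_measure_unique (mu := mscale nb (pushforward mu th))) => // X [[x y] _ <-].
change (mu `]x, y]%classic = `|b|%:E * mu (th @^-1` `]x, y]%classic)).
have [yx|xy] := leP y x.
  by rewrite (_ : `]x, y]%classic = set0) ?preimage_set0 ?measure0 ?mule0// set_itv_ge// -leNgt bnd_simp.
have b0' : (0 < `|b|)%R by rewrite normr_gt0.
rewrite lebesgue_measure_itv/= lte_fin xy -EFinB.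
have [bp|bn|b00] := ltgtP b 0%R; last by rewrite b00 eqxx in b0.
- have -> : th @^-1` `]x, y]%classic = `[((y - a) / b)%R, ((x - a) / b)%R[%classic.
    apply/seteqP; split => t /=; rewrite !in_itv/= /th /aff ler_ndivrMr// ltr_ndivlMr//; lra.
  rewrite lebesgue_measure_itv/= lte_fin ltr_nM2r ?invr_lt0// ltrD2r xy -EFinB -EFinM ltr0_norm//.
  by congr EFin; field.
- have -> : th @^-1` `]x, y]%classic = `]((x - a) / b)%R, ((y - a) / b)%R]%classic.
    apply/seteqP; split => t /=; rewrite !in_itv/= /th /aff ltr_pdivrMr// ler_pdivlMr//; lra.
  rewrite lebesgue_measure_itv/= lte_fin ltr_pM2r ?invr_gt0// ltrD2r xy -EFinB -EFinM gtr0_norm//.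
  by congr EFin; field.
Qed.

Lemma ge0_integral_affine (a b : R) (D : set R) (f : R -> \bar R) :
  b != 0%R -> measurable D -> measurable_fun D f -> (forall x, D x -> 0 <= f x) ->
  \int[mu]_(x in D) f x =
  `|b|%:E * \int[mu]_(t in (fun t : R => a + b * t)%R @^-1` D) f (a + b * t)%R.
Proof.
move=> b0 mD mf f0.
pose th : measurableTypeR R -> measurableTypeR R := aff a b.
have mth : measurable_fun setT th by exact: measurable_affine.
pose nb : {nonneg R} := NngNum (normr_ge0 b).
rewrite (@eq_measure_integral _ _ _ _ (mscale nb (pushforward mu th))); last first.
  by move=> A mA _; rewrite /= /mscale/= /pushforward -lebesgue_measure_affine.
rewrite ge0_integral_mscale// ge0_integral_pushforward//.
by move=> x /[!inE]; exact: f0.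
Qed.

Lemma integrable_affine (a b : R) (D : set R) (f : R -> \bar R) :
  b != 0%R -> measurable D -> mu.-integrable D f ->
  mu.-integrable ((fun t : R => a + b * t)%R @^-1` D) (fun t => f (a + b * t)%R).
Proof.
move=> b0 mD /integrableP[mf fi].
have mth : measurable_fun setT (aff a b) by exact: measurable_affine.
have mpD : measurable ((fun t : R => a + b * t)%R @^-1` D).
  by rewrite -[X in measurable X]setTI; exact: mth.
apply/integrableP; split.
  apply: (measurable_comp (F := D)) => //; first by move=> _ [t Dt <-].
  exact: measurable_funTS.
move: fi; rewrite (ge0_integral_affine a b0 mD)//; last exact: measurableT_comp.
move: (\int[mu]_(x in _) `|_|); case=> [r| |] //.
  by move=> _; rewrite ltry.
by rewrite gt0_muley ?lte_fin ?normr_gt0// ltxx.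
Qed.

Lemma integral_affine (a b : R) (D : set R) (f : R -> \bar R) :
  b != 0%R -> measurable D -> measurable_fun D f ->
  \int[mu]_(x in D) f x =
  `|b|%:E * \int[mu]_(t in (fun t : R => a + b * t)%R @^-1` D) f (a + b * t)%R.
Proof.
move=> b0 mD mf; rewrite integralE [in RHS]integralE.
rewrite (ge0_integral_affine a b0 mD)//; last exact: measurable_funepos.
rewrite [X in _ - X](ge0_integral_affine a b0 mD)//; last exact: measurable_funeneg.
have : (0 < `|b|)%R by rewrite normr_gt0.
move: `|b|%R => c c0; have c0' : 0 < c%:E by rewrite lte_fin.
have muleB (x y : \bar R) : c%:E * x - c%:E * y = c%:E * (x - y).
  case: x y => [x| |] [y| |]; rewrite ?gt0_muley ?gt0_muleNy//= ?gt0_muley ?gt0_muleNy//=.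
  by rewrite -EFinM -!EFinD -EFinM mulrBr.
by rewrite muleB; congr (_ * (_ - _)); apply: eq_integral => t _; rewrite ?funeposE ?funenegE.
Qed.

Lemma lower_integral_affine_le (a b : R) (D : set R) (f : R -> \bar R) :
  b != 0%R -> measurable D -> (forall x, D x -> 0 <= f x) ->
  `|b|%:E * \int[mu]_(t in (fun t : R => a + b * t)%R @^-1` D) f (a + b * t)%R
    <= \int[mu]_(x in D) f x.
Proof.
move=> b0 mD f0.
have b0' : (0 < `|b|)%R by rewrite normr_gt0.
have mth : measurable_fun setT (aff a b) by exact: measurable_affine.
have mpD : measurable ((fun t : R => a + b * t)%R @^-1` D).
  by rewrite -[X in measurable X]setTI; exact: mth.
rewrite -lower_integralZl//; last by move=> t; exact: f0.
apply: lower_integral_le => // [t Dt|h mh h0 hf].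
  by rewrite mule_ge0// f0.
(* The minorant [h] of [|b| f(a + b t)] is carried back by the inverse map; the division by [|b|]
   turns it into a minorant of [f]. *)
pose g (x : R) : R := (`|b|^-1 * h ((- a / b) + b^-1 * x))%R.
have mg : measurable_fun setT g.
  apply: measurable_funM => //; apply: (measurableT_comp mh).
  exact: measurable_affine.
have thK t : (- a / b + b^-1 * (a + b * t) = t)%R by field.
apply: (@le_trans _ _ (\int[mu]_(x in D) (g x)%:E)).
  rewrite (ge0_integral_affine a b0 mD); last 2 first.
  - by apply/measurable_EFinP; exact: measurable_funTS.
  - by move=> x _; rewrite lee_fin mulr_ge0.
  rewrite -ge0_integralZl_EFin//=; last 2 first.
  - by move=> x _; rewrite lee_fin mulr_ge0.
  - apply/measurable_EFinP; apply: measurable_funTS.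
    by apply: (measurableT_comp mg); exact: measurable_affine.
  rewrite le_eqVlt; apply/orP; left; apply/eqP.
  apply: eq_integral => t _; rewrite /g thK -EFinM mulrA divff ?mul1r//.
  by rewrite gt_eqF.
apply: le_lower_integral => x Dx; first by rewrite lee_fin mulr_ge0.
have thK' : (a + b * (- a / b + b^-1 * x) = x)%R by field.
have := hf (- a / b + b^-1 * x)%R; rewrite /= thK' => /(_ Dx) hle.
by rewrite /g EFinM lee_pdivrMl.
Qed.
End AffineChange.

(** * Action densities *)

Lemma coord_le_norm (R : realType) (n : nat) (w : 'rV[R]_n) i : `|w ord0 i| <= `|w|.
Proof.
rewrite [leRHS]/Num.norm/= mx_normrE.
exact: (le_bigmax _ (fun ij => `|w ij.1 ij.2|) (ord0, i)).
Qed.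

Section ActionDensity.
Context (R : realType) (d : nat) (p : R) (phi : R -> Rd R d -> R).
Hypotheses (p1 : 1 < p) (adm : admissible p phi).

Let p_gt0 : 0 < p. Proof. exact: lt_trans ltr01 p1. Qed.
Let phi_ge0 r w : 0 < r -> 0 <= phi r w. Proof. by case: adm => + _ _ _; apply. Qed.
Let phi_convex r1 r2 w1 w2 (t : R) : 0 < r1 -> 0 < r2 -> 0 <= t <= 1 ->
  phi (t * r1 + (1 - t) * r2) (t *: w1 + (1 - t) *: w2)
    <= t * phi r1 w1 + (1 - t) * phi r2 w2.
Proof. by case: adm => _ + _ _; apply. Qed.
Let phiZ r (l : R) w : 0 < r -> phi r (l *: w) = powR `|l| p * phi r w.
Proof. by case: adm => _ _ + _; apply. Qed.

Lemma density0 r : 0 < r -> phi r 0 = 0.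
Proof. by move=> r0; rewrite -(scale0r 0) phiZ// normr0 powR0 ?mul0r// gt_eqF. Qed.

Lemma density_convex0 r1 r2 w (t : R) : 0 < r1 -> 0 < r2 -> 0 <= t <= 1 ->
  phi (t * r1 + (1 - t) * r2) (t *: w) <= t * phi r1 w.
Proof.
move=> r10 r20 t01; have := phi_convex w 0 r10 r20 t01.
by rewrite scaler0 addr0 density0// mulr0 addr0.
Qed.

(** For [c < 1] and [t = c^(1/p)] the point [(r2, t w)] lies on the segment from [(r1, w)] to some
    [(s, 0)], where [phi] vanishes. Convexity and homogeneity give
    [c phi r2 w <= t phi r1 w <= phi r1 w]; then [c] tends to 1. *)
Lemma density_nonincreasing r1 r2 w : 0 < r1 -> r1 <= r2 -> phi r2 w <= phi r1 w.
Proof.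
move=> r10; rewrite le_eqVlt => /predU1P[->//|r12].
have r20 : 0 < r2 by exact: lt_trans r12.
rewrite -lee_fin; apply/lee_mul01Pr; first by rewrite lee_fin phi_ge0.
move=> c /andP[c0 c1]; rewrite -EFinM lee_fin.
pose t := powR c p^-1.
have t0 : 0 < t by rewrite powR_gt0.
have t1 : t < 1.
  rewrite (_ : 1 = powR 1 p^-1); last by rewrite powR1.
  rewrite gt0_ltr_powR ?invr_gt0//; rewrite ?inE ?nnegrE//; exact: ltW.
have tp : powR t p = c by rewrite /t -powRrM mulVf ?powRr1 ?gt_eqF// ltW.
have t'0 : 0 < 1 - t by rewrite subr_gt0.
have s0 : 0 < (r2 - t * r1) / (1 - t).
  rewrite divr_gt0// subr_gt0 (le_lt_trans _ r12)// ler_piMl// ltW//.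
have t01 : 0 <= t <= 1 by rewrite !ltW.
have := density_convex0 w r10 s0 t01.
have -> : t * r1 + (1 - t) * ((r2 - t * r1) / (1 - t)) = r2.
  by field; rewrite gt_eqF.
rewrite phiZ// gtr0_norm// tp => /le_trans; apply.
by rewrite ler_piMl ?phi_ge0// ltW.
Qed.

(** This would be convexity towards [(0, 0)], which lies outside the domain. The segment ends
    instead at a point of small positive density and zero flux, and starts at [(r', w)] with [r']
    slightly below [r]; convexity between [r / 2] and [r] gives [phi r' w <= phi r w + e]. *)
Lemma density_scale_le l r w : 0 < l <= 1 -> 0 < r -> phi (l * r) (l *: w) <= l * phi r w.
Proof.
move=> /andP[l0]; rewrite le_eqVlt => /predU1P[->|l1] r0.
  by rewrite scale1r !mul1r.
apply/ler_addgt0Pr => e e0.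
pose B := phi r w; pose C := phi (r / 2) w.
have r20 : 0 < r / 2 by rewrite divr_gt0.
have C0 : 0 <= C by exact: phi_ge0.
have B0 : 0 <= B by exact: phi_ge0.
pose s := e / (e + C + 1).
have D0 : 0 < e + C + 1 by lra.
have s0 : 0 < s by rewrite divr_gt0.
have s1 : s < 1 by rewrite ltr_pdivrMr// mul1r; lra.
have s01 : 0 <= 1 - s <= 1 by lra.
have := phi_convex w w r0 r20 s01.
rewrite -scalerDl (_ : 1 - s + (1 - (1 - s)) = 1) ?scale1r; last by ring.
rewrite -/B -/C (_ : 1 - (1 - s) = s); last by ring.
set r' := _ + _ => h.
have r'0 : 0 < r' by rewrite addr_gt0// mulr_gt0// subr_gt0.
have l'0 : 0 < 1 - l by rewrite subr_gt0.
have eps0 : 0 < l * r * s / (2 * (1 - l)).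
  by rewrite !(divr_gt0, mulr_gt0).
have l01 : 0 <= l <= 1 by rewrite !ltW.
have := density_convex0 w r'0 eps0 l01.
have -> : l * r' + (1 - l) * (l * r * s / (2 * (1 - l))) = l * r.
  by rewrite /r'; field; rewrite gt_eqF.
move=> /le_trans; apply; rewrite -/B.
have sC : s * C <= e.
  by rewrite /s mulrAC ler_pdivrMr// ler_pM2l//; lra.
have -> : l * B + e = l * (B + e / l) by field; rewrite gt_eqF.
rewrite ler_pM2l// (le_trans h)// lerD//.
  by rewrite ler_piMl//; lra.
by rewrite (le_trans sC)// ler_pdivlMr// ler_piMr// ltW.
Qed.

Lemma phi_ext_pos r w : 0 < r -> phi_ext phi r w = (phi r w)%:E.
Proof. by rewrite /phi_ext => ->. Qed.

Lemma phi_ext_cvg0 w :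
  ((phi s w)%:E @[s --> 0^'+]) --> ereal_sup [set (phi s w)%:E | s in `]0, +oo[%classic].
Proof.
apply: (@nonincreasing_at_right_cvge _ (fun s => (phi s w)%:E) 0 +oo%O) => //.
move=> s t; rewrite !in_itv/= !andbT => s0 t0 st.
by rewrite lee_fin density_nonincreasing.
Qed.

Lemma phi_ext0 r w : r <= 0 ->
  phi_ext phi r w = ereal_sup [set (phi s w)%:E | s in `]0, +oo[%classic].
Proof.
by move=> r0; rewrite /phi_ext ltNge r0/=; apply/cvg_lim => //; exact: phi_ext_cvg0.
Qed.

Lemma le_phi_ext r w s : 0 < s -> r <= s -> ((phi s w)%:E <= phi_ext phi r w)%E.
Proof.
move=> s0 rs; have [r0|r0] := leP r 0.
  by rewrite phi_ext0//; apply: ereal_sup_ubound; exists s => //=; rewrite in_itv/= s0.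
by rewrite phi_ext_pos// lee_fin density_nonincreasing.
Qed.

Lemma phi_ext_ge0 r w : (0 <= phi_ext phi r w)%E.
Proof.
have [r0|r0] := leP r 0.
  by apply: le_trans (le_phi_ext w ltr01 (le_trans r0 ler01)); rewrite lee_fin phi_ge0.
by rewrite phi_ext_pos// lee_fin phi_ge0.
Qed.

Lemma phi_extZ r (l : R) w : l != 0 ->
  (phi_ext phi r (l *: w) = (powR `|l| p)%:E * phi_ext phi r w)%E.
Proof.
move=> l0; have [r0|r0] := leP r 0; last by rewrite !phi_ext_pos// phiZ.
rewrite !phi_ext0//.
have c1 := @phi_ext_cvg0 (l *: w).
have c2 : (((powR `|l| p)%:E * (phi s w)%:E)%E @[s --> 0^'+]) -->
   ((powR `|l| p)%:E * ereal_sup [set (phi s w)%:E | s in `]0%R, +oo[%classic])%E.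
  by apply: cvgeZl => //; exact: phi_ext_cvg0.
have c3 : (phi s (l *: w))%:E @[s --> 0^'+] -->
   ((powR `|l| p)%:E * ereal_sup [set (phi s w)%:E | s in `]0%R, +oo[%classic])%E.
  apply: cvg_trans c2; apply: near_eq_cvg.
  near=> s; rewrite phiZ//; near: s; exact: nbhs_right_gt.
exact: (@cvg_unique _ (@ereal_hausdorff R) _ _ _ _ c1 c3).
Unshelve. all: by end_near. Qed.

Lemma phi_ext_scale_le l r w : 0 < l <= 1 -> 0 <= r ->
  (phi_ext phi (l * r) (l *: w) <= l%:E * phi_ext phi r w)%E.
Proof.
move=> /[dup] l01 /andP[l0 l1]; rewrite le_eqVlt => /predU1P[<-|r0]; last first.
  by rewrite !phi_ext_pos// ?mulr_gt0// lee_fin density_scale_le.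
rewrite mulr0 phi_extZ ?gt_eqF// lee_wpmul2r ?phi_ext_ge0//.
by rewrite lee_fin gtr0_norm// ge1r_powR ?l0// ltW.
Qed.

Let G r w (l : R) := (l^-1%:E * phi_ext phi (l * r) (l *: w))%E.

Let G_ge0 r w l : 0 < l -> (0 <= G r w l)%E.
Proof. by move=> l0; rewrite mule_ge0 ?phi_ext_ge0// lee_fin invr_ge0 ltW. Qed.

Let G_homo r w l m : 0 <= r -> 0 < l -> l <= m -> (G r w l <= G r w m)%E.
Proof.
move=> r0 l0 lm; have m0 : 0 < m by exact: lt_le_trans lm.
have lm01 : 0 < l / m <= 1 by rewrite divr_gt0//= ler_pdivrMr// mul1r.
have mr0 : 0 <= m * r by rewrite mulr_ge0// ltW.
have := phi_ext_scale_le (m *: w) lm01 mr0.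
rewrite mulrA scalerA divfK ?gt_eqF// => h.
rewrite /G lee_pdivrMl//; apply: le_trans h _.
by rewrite muleA -EFinM.
Qed.

(** The quotients [G] increase with [l] only for [l > 0]. [H] extends them by 0 to a function that
    is monotone on the whole line and has the same limit at infinity. *)
Lemma phi_inf_cvg r w : 0 <= r ->
  ((l^-1%:E * phi_ext phi (l * r) (l *: w))%E @[l --> +oo]) --> phi_inf phi r w.
Proof.
move=> r0; rewrite /phi_inf.
pose H l := if (0 < l)%R then G r w l else 0%E.
have HG : {near +oo, H =1 G r w}.
  near=> l; rewrite /H ifT//; near: l; exact: nbhs_pinfty_gt.
have cH : cvg (H l @[l --> +oo]).
  apply: nondecreasing_is_cvge => l m lm; rewrite /H.
  have [l0|l0] := ltP 0 l; first by rewrite (lt_le_trans l0 lm) G_homo.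
  by case: ifPn => // m0; exact: G_ge0.
apply/cvg_ex; exists (lim (H l @[l --> +oo])).
apply: cvg_trans cH; apply: near_eq_cvg; exact: HG.
Unshelve. all: by end_near. Qed.

Lemma le_phi_inf r w l : 0 <= r -> 0 < l ->
  (l^-1%:E * phi_ext phi (l * r) (l *: w) <= phi_inf phi r w)%E.
Proof.
move=> r0 l0; apply: lime_ge; first by apply/cvg_ex; exists (phi_inf phi r w); exact: phi_inf_cvg.
near=> m; apply: G_homo => //; near: m; apply: nbhs_pinfty_ge; exact: num_real.
Unshelve. all: by end_near. Qed.

Lemma phi_inf_ge0 r w : 0 <= r -> (0 <= phi_inf phi r w)%E.
Proof. by move=> r0; apply: le_trans (le_phi_inf w r0 ltr01); exact: G_ge0. Qed.

Lemma phi_infZ r (l : R) w : 0 <= r -> l != 0 ->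
  (phi_inf phi r (l *: w) = (powR `|l| p)%:E * phi_inf phi r w)%E.
Proof.
move=> r0 l0; apply: (@cvg_unique _ (@ereal_hausdorff R) _ _ _ _ (@phi_inf_cvg r (l *: w) r0)) => //.
have : (((powR `|l| p)%:E * (m^-1%:E * phi_ext phi (m * r) (m *: w)))%E @[m --> +oo])
   --> ((powR `|l| p)%:E * phi_inf phi r w)%E.
  by apply: cvgeZl => //; exact: phi_inf_cvg.
apply: cvg_trans; apply: near_eq_cvg; apply: nearW => m.
by rewrite (scalerA m) (mulrC m l) -scalerA (phi_extZ _ (m *: w) l0) muleCA.
Qed.

(** By homogeneity it is enough to bound [phi r0] below on the unit sphere. Compactness asks there
    for a local bound only: [fD] and [fC] give [f v >= f w / (2 c2)] for [v] close to [w]. *)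
Lemma density_lower_bound r0 : 0 < r0 -> (forall w, w != 0 -> 0 < phi r0 w) ->
  exists2 c, 0 < c & forall w, c * powR `|w| p <= phi r0 w.
Proof.
move=> r00 pos; pose f := phi r0.
have f0 w : 0 <= f w by exact: phi_ge0.
pose c2 := powR 2 p / 2.
have c20 : 0 < c2 by rewrite divr_gt0// powR_gt0.
(* Convexity at the midpoint of [2 u] and [2 v]; homogeneity turns the dilation into the factor
   [2^p]. *)
have fD u v : f (u + v) <= c2 * (f u + f v).
  have h01 : 0 <= (2^-1 : R) <= 1 by lra.
  have := phi_convex (2 *: u) (2 *: v) r00 r00 h01.
  have e12 : 1 - 2^-1 = 2^-1 :> R by field.
  rewrite e12 !scalerA mulVf// !scale1r -mulrDl (_ : 2^-1 + 2^-1 = 1 :> R); last by field.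
  rewrite mul1r !phiZ// gtr0_norm// => /le_trans; apply.
  by rewrite /c2 /f le_eqVlt; apply/orP; left; apply/eqP; field.
have [C C0 fC] : exists2 C, 0 < C & forall w, f w <= C * powR `|w| p.
  suff [C C0 H] : exists2 C, 0 < C & forall w : Rd R d,
      f (\sum_(i <- index_enum 'I_d) w ord0 i *: evec R i) <= C * powR `|w| p.
    by exists C => // w; rewrite {1}(row_sum_delta w); exact: H.
  elim: (index_enum 'I_d) => [|a s [C C0 IH]].
    exists 1 => // w; rewrite big_nil /f density0// mulr_ge0// powR_ge0.
  exists (c2 * (f (evec R a) + C)) => [|w]; first by rewrite mulr_gt0// ltr_wpDl.
  rewrite big_cons; apply: (le_trans (fD _ _)).
  rewrite -[leRHS]mulrA (ler_pM2l c20) mulrDl lerD//.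
  rewrite {1}/f phiZ// mulrC ler_wpM2l//.
  apply: ge0_ler_powR; rewrite ?nnegrE ?normr_ge0//; first exact: ltW.
  exact: coord_le_norm.
have S_cpt : compact [set w : Rd R d | `|w| = 1].
  apply: bounded_closed_compact.
    by exists 1; split => // x x1 w /= ->; exact: ltW.
  apply: (@closed_comp _ _ (fun w : Rd R d => `|w|) [set 1]) => [w _|]; first exact: norm_continuous.
  exact: closed_eq.
have : near_covering [set w : Rd R d | `|w| = 1] by exact/compact_near_coveringP.
move=> ncov; have nc : \forall c \near 0^'+, [set w : Rd R d | `|w| = 1] `<=` (fun w => c <= f w).
  apply: (ncov R (0^'+) (fun c w => c <= f w)) => w /= w1.
  have w0 : w != 0 by rewrite -normr_eq0 w1 oner_eq0.
  have fw0 : 0 < f w by exact: pos.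
  (* The bound 1 gives [|w - v|^p <= |w - v|], and the other one then gives
     [f (w - v) <= f w / (2 c2)] through [fC]. *)
  have e0 : 0 < Num.min 1 (f w / (2 * c2 * C)).
    by rewrite lt_min ltr01 divr_gt0// !mulr_gt0.
  have e1 : 0 < f w / (2 * c2) by rewrite divr_gt0// mulr_gt0.
  near=> v c => /=.
  have cle : c <= f w / (2 * c2).
    near: c; apply: nbhs_right_le; exact: e1.
  apply: (le_trans cle); rewrite ler_pdivrMr ?mulr_gt0//.
  have vw : `|w - v| < Num.min 1 (f w / (2 * c2 * C)).
    by near: v; exact: cvgr_dist_lt.
  have h1 := fD v (w - v); rewrite subrKC in h1.
  have h2 : f (w - v) <= f w / (2 * c2).
    apply: (le_trans (fC _)).
    have [->|wv0] := eqVneq (w - v) 0.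
      by rewrite normr0 powR0 ?gt_eqF// mulr0 ltW.
    have : powR `|w - v| p <= `|w - v|.
      apply: ge1r_powR; last exact: ltW.
      rewrite normr_gt0 wv0/=; apply: ltW; apply: lt_le_trans vw _.
      by rewrite ge_min lexx.
    move=> /(ler_wpM2l (ltW C0))/le_trans; apply.
    rewrite mulrC -ler_pdivlMr// ltW// (lt_le_trans vw)// ge_min; apply/orP; right.
    rewrite le_eqVlt; apply/orP; left; apply/eqP; field.
    by rewrite !gt_eqF.
  move: h2; rewrite ler_pdivlMr ?mulr_gt0// => h2.
  have : c2 * (f v + f (w - v)) = c2 * f v + c2 * f (w - v) by ring.
  by nra.
have : \forall c \near 0^'+, 0 < c /\ [set w : Rd R d | `|w| = 1] `<=` (fun w => c <= f w).
  by near=> c; split; near: c => //; exact: nbhs_right_gt.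
move=> /filter_ex[c [c0 cf]].
exists c => // w; have [->|w0] := eqVneq w 0.
  by rewrite normr0 powR0 ?gt_eqF// mulr0 phi_ge0.
have nw0 : 0 < `|w| by rewrite normr_gt0.
have -> : w = `|w| *: (`|w|^-1 *: w) by rewrite scalerA divff ?scale1r// gt_eqF.
rewrite phiZ// normr_id [_ * phi _ _]mulrC {1}scalerA divff ?scale1r ?gt_eqF//.
rewrite ler_wpM2r ?powR_ge0//; apply: cf => /=.
by rewrite normrZ normfV normr_id mulVf// gt_eqF.
Unshelve. all: by end_near. Qed.

(** The lower bound at [r0] spreads to every [r]: shrinking [(r, w)] by [l = 1 / (2 (1 + r / r0))]
    towards [(r0 / 2, 0)] leads to a density at most [r0], whence [phi r w >= c |w|^p l^(p-1)]. In
    Young's inequality the two factors are weighted by [L = l^(1/q)], so that [1 / l], which is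
    affine in [r], falls on the term in [b]. *)
Lemma density_young (k : nat) (e : R) : p <= k%:R -> 0 < e ->
  exists2 M, 0 < M & forall r w b, 0 < r -> 0 <= b <= 2 ->
    `|w| * b ^+ k.-1 <= M * phi r w + e * b ^+ k * (1 + r).
Proof.
move=> pk e0; have [_ _ _ [r0 [r00 pos]]] := adm.
have [c c0 lb] := density_lower_bound r00 pos.
have k1 : (1 < k)%N by rewrite -(@ltr_nat R); exact: lt_le_trans pk.
have p'0 : 0 < p - 1 by rewrite subr_gt0.
pose q := p / (p - 1).
have q0 : 0 < q by rewrite divr_gt0.
have q1 : 1 <= q by rewrite /q ler_pdivlMr//; lra.
have pq1 : p^-1 + q^-1 = 1 by rewrite /q; field; rewrite !gt_eqF.
have lower r w : 0 < r ->
    c * powR `|w| p * powR ((2 * (1 + r / r0))^-1) (p - 1) <= phi r w.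
  move=> rp; set K := 1 + r / r0.
  have K1 : 1 < K by rewrite /K ltrDl divr_gt0.
  set l := (2 * K)^-1.
  have l0 : 0 < l by rewrite invr_gt0; lra.
  have l1 : l <= 1 by rewrite invf_le1; lra.
  have r20 : 0 < r0 / 2 by lra.
  have l01 : 0 <= l <= 1 by rewrite ltW.
  have h1 := density_convex0 w rp r20 l01.
  have h2 : l * r + (1 - l) * (r0 / 2) <= r0.
    have : l * r <= r0 / 2.
      rewrite /l mulrC ler_pdivrMr; last by lra.
      rewrite (_ : r0 / 2 * (2 * K) = r0 + r); first by lra.
      by rewrite /K; field; rewrite gt_eqF.
    by nra.
  have h3 : 0 < l * r + (1 - l) * (r0 / 2) by rewrite ltr_pwDl ?mulr_gt0// mulr_ge0//; lra.
  have := le_trans (density_nonincreasing (l *: w) h3 h2) h1.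
  rewrite phiZ// gtr0_norm// -(mulr_powRB1 (ltW l0) p_gt0) -mulrA ler_pM2l//.
  apply: le_trans; rewrite mulrC ler_wpM2l ?powR_ge0//.
(* [(k - 1) q = k + s]: the surplus power of [b <= 2] costs a factor [2^s], and [s >= 0] is the
   condition [p <= k]. *)
pose s := (k%:R - p) / (p - 1).
have s0 : 0 <= s by rewrite divr_ge0// ?subr_ge0// ltW.
(* Chosen so that [2^s * 2 * (1 + r / r0) <= D * (1 + r)]; with [de^q = e / D] the coefficient of
   the last term becomes [e]. *)
pose D := powR 2 s * 2 * (1 + r0^-1).
have D0 : 0 < D by rewrite !mulr_gt0// ?powR_gt0// addr_gt0 ?invr_gt0.
pose de := powR (e / D) q^-1.
have eD0 : 0 < e / D by rewrite divr_gt0.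
have de0 : 0 < de by rewrite powR_gt0.
have deq : powR de q = e / D by rewrite /de -powRrM mulVf ?powRr1 ?gt_eqF// ltW.
exists (powR de^-1 p / c) => [|r w b rp /andP[b0 b2]].
  by rewrite divr_gt0// powR_gt0// invr_gt0.
pose K := 1 + r / r0; have K1 : 1 < K by rewrite /K ltrDl divr_gt0.
pose l := (2 * K)^-1; have l0 : 0 < l by rewrite invr_gt0; lra.
pose L := powR l q^-1; have L0 : 0 < L by rewrite powR_gt0.
have Lq : powR L q = l by rewrite /L -powRrM mulVf ?powRr1 ?gt_eqF// ltW.
have Lp : powR L p = powR l (p - 1).
  by rewrite /L -powRrM (_ : q^-1 * p = p - 1)// /q; field; rewrite !gt_eqF.
have x0 : 0 <= de^-1 * `|w| * L by rewrite !mulr_ge0// ?invr_ge0 ltW.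
have y0 : 0 <= de * b ^+ k.-1 / L by rewrite !mulr_ge0// ?exprn_ge0 ?invr_ge0// ltW.
have := conjugate_powR x0 y0 p_gt0 q0 pq1.
have -> : de^-1 * `|w| * L * (de * b ^+ k.-1 / L) = `|w| * b ^+ k.-1.
  by field; rewrite !gt_eqF.
move=> /le_trans; apply; apply: lerD.
  apply: (@le_trans _ _ (powR (de^-1 * `|w| * L) p)).
    by rewrite ler_piMr ?powR_ge0// invf_le1// ltW.
  rewrite !powRM ?mulr_ge0 ?invr_ge0 ?normr_ge0 ?(ltW de0) ?(ltW L0)// Lp.
  rewrite -!mulrA ler_wpM2l ?powR_ge0// ler_pdivlMl// mulrA; exact: lower.
apply: (@le_trans _ _ (powR (de * b ^+ k.-1 / L) q)).
  by rewrite ler_piMr ?powR_ge0// invf_le1.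
rewrite !powRM ?mulr_ge0 ?invr_ge0 ?exprn_ge0 ?(ltW de0) ?(ltW L0)// deq.
have -> : powR L^-1 q = 2 * K.
  by rewrite -powR_inv1 ?(ltW L0)// -powRrM mulrC powRrM Lq powR_inv1 ?(ltW l0)// /l invrK.
have bq : powR (b ^+ k.-1) q <= b ^+ k * powR 2 s.
  have [->|bn0] := eqVneq b 0.
    have k10 : (0 < k.-1)%N by rewrite -subn1 subn_gt0.
    rewrite !expr0n (gtn_eqF k10) (gtn_eqF (ltnW k1)) mul0r powR0//.
    by rewrite gt_eqF.
  rewrite -!powR_mulrn// -powRrM.
  have -> : k.-1%:R * q = k%:R + s.
    have -> : k.-1%:R = k%:R - 1 :> R by rewrite -subn1 natrB// ltnW.
    by rewrite /q /s; field; rewrite gt_eqF.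
  rewrite powRD ?bn0 ?implybT// ler_wpM2l ?powR_ge0//.
  by rewrite ge0_ler_powR ?nnegrE.
apply: (@le_trans _ _ (e / D * (b ^+ k * powR 2 s) * (2 * K))).
  have K0 : 0 <= K := ltW (lt_trans ltr01 K1).
  by rewrite ler_wpM2r ?mulr_ge0// ler_wpM2l// ltW.
have -> : e / D * (b ^+ k * powR 2 s) * (2 * K) = e * b ^+ k * (K / (1 + r0^-1)).
  by rewrite /D; field; rewrite !gt_eqF ?powR_gt0// addr_gt0.
rewrite ler_wpM2l ?mulr_ge0 ?exprn_ge0 ?(ltW e0)//.
rewrite ler_pdivrMr ?addr_gt0 ?invr_gt0// /K mulrDl !mulrDr !mul1r !mulr1.
by rewrite -addrA lerD2l addrA lerDr addr_ge0 ?invr_ge0// ltW.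
Qed.

Lemma phi_ext_young (k : nat) (e : R) : p <= k%:R -> 0 < e ->
  exists2 M, 0 < M & forall r w b, 0 <= r -> 0 <= b <= 2 ->
    ((`|w| * b ^+ k.-1)%:E <= M%:E * phi_ext phi r w + (e * b ^+ k * (1 + r))%:E)%E.
Proof.
move=> pk e0; have [M M0 H] := density_young pk e0; exists M => // r w b.
rewrite le_eqVlt => /predU1P[<-|r0] b02; last first.
  by rewrite phi_ext_pos// -EFinM -EFinD lee_fin H.
have [b0 _] := andP b02.
(* At [r = 0] the bound is taken at the density [s / D], where [phi] is at most [phi_ext phi 0 w]
   and the surplus [e b^k s / D] is at most [s]. *)
apply/lee_addgt0Pr => s s0.
pose D := e * b ^+ k + 1.
have eb0 : 0 <= e * b ^+ k by rewrite mulr_ge0 ?exprn_ge0// ltW.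
have D0 : 0 < D by rewrite /D; lra.
have sD0 : 0 < s / D by rewrite divr_gt0.
apply: (@le_trans _ _ (M * phi (s / D) w + e * b ^+ k * (1 + s / D))%:E).
  by rewrite lee_fin H.
rewrite EFinD -[leRHS]addeA; apply: leeD.
  by rewrite EFinM lee_wpmul2l ?lee_fin ?(ltW M0)//; exact: le_phi_ext (ltW sD0).
rewrite -EFinD lee_fin mulrDr !mulr1 addr0 mulr1 lerD2l mulrCA.
by rewrite ler_piMr ?(ltW s0)// ler_pdivrMr// mul1r /D lerDl.
Qed.

(** The bound for [phi_ext] at [(l r, l w)] is divided by [l]: the constant in [1 + l r] then
    contributes [e b^k / l], which is negligible for large [l]. A term free of [r] would have to be
    integrated against a singular measure of uncontrolled mass. *)
Lemma phi_inf_young (k : nat) (e : R) : p <= k%:R -> 0 < e ->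
  exists2 M, 0 < M & forall r w b, 0 <= r -> 0 <= b <= 2 ->
    ((`|w| * b ^+ k.-1)%:E <= M%:E * phi_inf phi r w + (e * b ^+ k * r)%:E)%E.
Proof.
move=> pk e0; have [M M0 H] := phi_ext_young pk e0; exists M => // r w b r0 b02.
have [b0 _] := andP b02.
apply/lee_addgt0Pr => s s0.
pose D := e * b ^+ k + 1.
have eb0 : 0 <= e * b ^+ k by rewrite mulr_ge0 ?exprn_ge0// ltW.
have D0 : 0 < D by rewrite /D; lra.
pose l := D / s; have l0 : 0 < l by rewrite divr_gt0.
have lr0 : 0 <= l * r by rewrite mulr_ge0// ltW.
have := H _ (l *: w) b lr0 b02.
rewrite normrZ gtr0_norm// -mulrA EFinM -lee_pdivlMl// => /le_trans; apply.
rewrite muleDr// ?ge0_adde_def ?inE ?mule_ge0 ?phi_ext_ge0 ?lee_fin ?mulr_ge0 ?addr_ge0 ?exprn_ge0 ?(ltW M0) ?(ltW e0)//.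
rewrite muleCA -addeA leeD//.
  by rewrite lee_wpmul2l ?lee_fin ?(ltW M0)//; exact: le_phi_inf.
rewrite -EFinM -EFinD lee_fin.
have -> : l^-1 * (e * b ^+ k * (1 + l * r)) = e * b ^+ k * r + e * b ^+ k / l.
  by field; rewrite gt_eqF.
rewrite lerD2l /l invf_div mulrA ler_pdivrMr// mulrC ler_pM2l// /D lerDl//.
Qed.
End ActionDensity.

(** * Test functions and balls in R^d *)

Section ContinuityCombinators.
Context (R : realType) (T : topologicalType).
Implicit Types f g : T -> R.

Lemma continuous_const (c : R) : continuous (fun _ : T => c).
Proof. exact: cst_continuous. Qed.

Lemma continuous_add f g : continuous f -> continuous g -> continuous (fun x => f x + g x).
Proof. by move=> cf cg x; apply: continuousD; [exact: cf|exact: cg]. Qed.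

Lemma continuous_mul f g : continuous f -> continuous g -> continuous (fun x => f x * g x).
Proof. by move=> cf cg x; apply: continuousM; [exact: cf|exact: cg]. Qed.

Lemma continuous_sub f g : continuous f -> continuous g -> continuous (fun x => f x - g x).
Proof. by move=> cf cg x; apply: continuousB; [exact: cf|exact: cg]. Qed.

Lemma continuous_compose (S : topologicalType) (h : R -> S) f :
  continuous h -> continuous f -> continuous (fun x => h (f x)).
Proof. by move=> ch cf x; apply: (@continuous_comp _ _ _ f h); [exact: cf|exact: ch]. Qed.

End ContinuityCombinators.

Lemma continuous_sum (R : realType) (T : topologicalType) (I : Type) (s : seq I)
    (P : pred I) (F : I -> T -> R) :
  (forall i, continuous (F i)) -> continuous (fun x => \sum_(i <- s | P i) F i x).
Proof.
move=> cF; elim: s => [|a s IH].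
  by under eq_fun do rewrite big_nil; move=> x; exact: cvg_cst.
under eq_fun do rewrite big_cons; case: (P a) => // x.
by apply: continuousD; [exact: cF|exact: IH].
Qed.

Section EuclideanSpace.
Context (R : realType) (d : nat).
Implicit Types (f g : Rd R d -> R) (mu : Meas R d) (x : Rd R d).

Lemma open_measurable_RdB (A : set (Rd R d)) : open A -> measurable (A : set (RdB R d)).
Proof. by move=> oA; exact: sub_sigma_algebra. Qed.

Lemma continuous_measurable_RdB f :
  continuous f -> measurable_fun setT (f : RdB R d -> R).
Proof.
move=> /continuousP cf; apply: (measurability _ (RGenOpens.measurableE R)).
move=> _ [_ [a [b ->] <-]]; rewrite setTI; apply: open_measurable_RdB.
exact/cf/interval_open.
Qed.

Definition sqn x : R := \sum_(i < d) (x ord0 i) ^+ 2.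

Lemma sqn_ge0 x : 0 <= sqn x.
Proof. by apply: sumr_ge0 => i _; exact: sqr_ge0. Qed.

Lemma enormE x : enorm x = Num.sqrt (sqn x). Proof. by []. Qed.

Lemma continuous_coord (i : 'I_d) : continuous (fun x : Rd R d => x ord0 i).
Proof. exact: coord_continuous. Qed.

Lemma continuous_sqn : continuous sqn.
Proof.
apply: continuous_sum => i x.
rewrite (_ : (fun x : Rd R d => x ord0 i ^+ 2) = (fun x => x ord0 i * x ord0 i)).
  by apply: continuousM; exact: continuous_coord.
by apply/funext => y; rewrite expr2.
Qed.

Lemma continuous_enorm : continuous (@enorm R d).
Proof.
move=> x; apply: (@continuous_comp _ _ _ sqn (@Num.sqrt R)).
  exact: continuous_sqn.
exact: sqrt_continuous.
Qed.

Lemma enorm_ge0 x : 0 <= enorm x. Proof. exact: sqrtr_ge0. Qed.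

Lemma sqr_enorm x : enorm x ^+ 2 = sqn x. Proof. by rewrite sqr_sqrtr// sqn_ge0. Qed.

Lemma coord_le_enorm x i : `|x ord0 i| <= enorm x.
Proof.
rewrite -ler_sqr ?nnegrE ?enorm_ge0// sqr_enorm real_normK ?num_real//.
rewrite /sqn (bigD1 i)//= lerDl; apply: sumr_ge0 => j _; exact: sqr_ge0.
Qed.

Lemma norm_le_enorm x : `|x| <= enorm x.
Proof.
rewrite [leLHS]/Num.norm/= mx_normrE; apply/bigmax_leP; split; first exact: enorm_ge0.
by move=> [i j] _ /=; rewrite (ord1 i); exact: coord_le_enorm.
Qed.

Lemma enorm_le_sum x : enorm x <= \sum_(i < d) `|x ord0 i|.
Proof.
rewrite -ler_sqr ?nnegrE ?enorm_ge0 ?sumr_ge0// sqr_enorm /sqn.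
apply: (proj2 (A := 0 <= \sum_(i < d) `|x ord0 i|)).
elim/big_ind2 : _ => [|a a' b b' [a0 ab] [b0 ab']|i _].
- by rewrite expr0n.
- split; first by rewrite addr_ge0.
  by rewrite sqrrD (le_trans (lerD ab ab'))// -addrA lerD2l lerDr mulrn_wge0// mulr_ge0.
- by rewrite real_normK// num_real.
Qed.

Lemma open_Eball_at x r : open (Eball_at x r).
Proof.
rewrite (_ : Eball_at x r = (fun y => enorm (y - x)) @^-1` [set t | t < r]) //.
have ce : continuous (fun y : Rd R d => enorm (y - x)).
  move=> y; apply: (@continuous_comp _ _ _ (fun y : Rd R d => y - x : Rd R d) (@enorm R d)).
    by apply: continuousB; [exact: cvg_id|exact: cst_continuous].
  exact: continuous_enorm.
by apply: open_comp; [move=> y _; exact: ce|exact: open_lt].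
Qed.

Lemma EballE r : Eball r = [set x : Rd R d | enorm x < r].
Proof. by apply/seteqP; split => x; rewrite /Eball /Eball_at/= subr0. Qed.

Lemma measurable_Eball_at x r : measurable (Eball_at x r : set (RdB R d)).
Proof. by apply: open_measurable_RdB; exact: open_Eball_at. Qed.

Lemma measurable_Eball r : measurable (Eball r : set (RdB R d)).
Proof. exact: measurable_Eball_at. Qed.

Lemma bnd_Eball r : bnd (@Eball R d r). Proof. by exists r. Qed.

Lemma bnd_sub (A B : set (RdB R d)) : A `<=` B -> bnd B -> bnd A.
Proof. by move=> AB [r Br]; exists r; exact: subset_trans Br. Qed.

Lemma compact_enorm_le r : compact [set x : Rd R d | enorm x <= r].
Proof.
apply: bounded_closed_compact.
  exists r; split; first exact: num_real.
  by move=> s rs x /= xr; rewrite (le_trans (norm_le_enorm x))// (le_trans xr)// ltW.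
rewrite (_ : [set _ | _] = (@enorm R d) @^-1` [set t | t <= r])//.
apply: closed_comp; last exact: closed_le.
by move=> x _; exact: continuous_enorm.
Qed.

(** Compact support with an explicit radius, which a whole family can share, as dominated
    convergence requires; [Cc] hides the radius. *)
Definition vanish (r : R) f := forall x, r <= enorm x -> f x = 0.

Lemma vanish_le r s f : r <= s -> vanish r f -> vanish s f.
Proof. by move=> rs fr x sx; apply: fr; exact: le_trans sx. Qed.

Lemma vanish_Cc r f : continuous f -> vanish r f -> Cc f.
Proof.
move=> cf fr; split => //.
apply: (@subclosed_compact _ _ [set x | enorm x <= r]).
- exact: closed_closure.
- exact: compact_enorm_le.
- have : closed [set x : Rd R d | enorm x <= r].
    rewrite (_ : [set _ | _] = (@enorm R d) @^-1` [set t | t <= r])//.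
    apply: closed_comp; last exact: closed_le.
    by move=> x _; exact: continuous_enorm.
  move=> /closure_id ->; apply: closure_subset => x /= fx0.
  by rewrite leNgt; apply: contra fx0 => /ltW/fr ->.
Qed.

Lemma Cc_continuous f : Cc f -> continuous f. Proof. by case. Qed.

Lemma compact_enorm_bounded (K : set (Rd R d)) : compact K ->
  exists2 r, 0 < r & forall x, K x -> enorm x < r.
Proof.
move=> cK.
have /compact_bounded[M [_ HM]] : compact ((@enorm R d) @` K).
  apply: continuous_compact => //; apply: continuous_subspaceT.
  exact: continuous_enorm.
have M0 : 0 <= Num.max M 0 by rewrite le_max lexx orbT.
exists (Num.max M 0 + 1 + 1) => [|x Kx]; first by rewrite ltr_wpDl// addr_ge0.
have /= := HM (Num.max M 0 + 1).
have h : M < Num.max M 0 + 1 by rewrite ltr_pwDr// le_max lexx.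
move=> /(_ h (enorm x)) /(_ (ex_intro2 _ _ _ Kx erefl)).
rewrite ger0_norm ?enorm_ge0// => /le_lt_trans; apply; by rewrite ltrDl.
Qed.

Lemma Cc_vanish f : Cc f -> exists2 r, 0 < r & vanish r f.
Proof.
move=> [_ /compact_enorm_bounded[r r0 Hr]]; exists r => // x rx.
apply/eqP; apply: contraT => fx; have := Hr x.
have : closure [set x | f x != 0] x by exact: subset_closure.
by move=> h /(_ h); rewrite ltNge rx.
Qed.

Lemma Cc_bounded f : Cc f -> exists2 M, 0 < M & forall x, `|f x| <= M.
Proof.
move=> /[dup] [[cf _]] /Cc_vanish[r r0 fr].
have /compact_bounded[M [_ HM]] : compact (f @` [set x | enorm x <= r]).
  apply: continuous_compact; last exact: compact_enorm_le.
  exact: continuous_subspaceT.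
exists (Num.max M 0 + 1) => [|x]; first by rewrite ltr_wpDl// le_max lexx orbT.
have [xr|rx] := leP (enorm x) r.
  apply: HM => /=; first by rewrite ltr_pwDr// le_max lexx.
  by exists x.
by rewrite fr ?normr0 ?(ltW rx)// addr_ge0// le_max lexx orbT.
Qed.

Lemma CcD f g : Cc f -> Cc g -> Cc (fun x => f x + g x).
Proof.
move=> /[dup] [[cf _]] /Cc_vanish[r _ fr] /[dup] [[cg _]] /Cc_vanish[s _ gs].
apply: (@vanish_Cc (Num.max r s)) => [x|x].
  by apply: continuousD; [exact: cf|exact: cg].
by rewrite ge_max => /andP[rx sx]; rewrite fr// gs// addr0.
Qed.

Lemma CcMl f g : continuous f -> Cc g -> Cc (fun x => f x * g x).
Proof.
move=> cf /[dup] [[cg _]] /Cc_vanish[s _ gs].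
apply: (@vanish_Cc s) => [x|x sx]; last by rewrite gs// mulr0.
by apply: continuousM; [exact: cf|exact: cg].
Qed.

Lemma CcZ (c : R) f : Cc f -> Cc (fun x => c * f x).
Proof. by move=> cf; apply: CcMl => //; exact: cst_continuous. Qed.

Lemma CcB f g : Cc f -> Cc g -> Cc (fun x => f x - g x).
Proof.
move=> cf cg; have := CcD cf (CcZ (-1) cg).
by congr Cc; apply/funext => x; rewrite mulN1r.
Qed.

Lemma Cc0 : Cc (fun _ : Rd R d => 0 : R).
Proof. by apply: (@vanish_Cc 0) => //; exact: cst_continuous. Qed.

Lemma Cc_sum (I : Type) (s : seq I) (P : pred I) (F : I -> Rd R d -> R) :
  (forall i, Cc (F i)) -> Cc (fun x => \sum_(i <- s | P i) F i x).
Proof.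
move=> cF; elim: s => [|a s IH].
  by under eq_fun do rewrite big_nil; exact: Cc0.
under eq_fun do rewrite big_cons; case: (P a) => //.
exact: CcD.
Qed.

Lemma Cc_measurable f : Cc f -> measurable_fun setT (f : RdB R d -> R).
Proof. by move=> [cf _]; exact: continuous_measurable_RdB. Qed.

Lemma vanish_integrable mu r M f : radon mu ->
  measurable_fun setT (f : RdB R d -> R) -> vanish r f -> (forall x, `|f x| <= M) ->
  mu.-integrable setT (fun x => (f x)%:E).
Proof.
move=> rmu mf fr fM.
have mB : measurable (Eball r : set (RdB R d)) by exact: measurable_Eball.
apply/integrableP; split; first exact/measurable_EFinP.
apply: (@le_lt_trans _ _ (\int[mu]_x (M * \1_(Eball r) x)%:E)%E).
  apply: ge0_le_integral => //.
  - by apply/measurable_EFinP; exact: measurableT_comp.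
  - by apply/measurable_EFinP; apply: measurable_funM => //; exact: measurable_indic.
  - move=> x _; rewrite lee_fin indicE; have [xB|xB] := boolP (x \in _); first by rewrite mulr1.
    rewrite mulr0 fr ?normr0// leNgt; apply: contra xB => xr.
    by rewrite inE EballE.
have M0 : 0 <= M := le_trans (normr_ge0 _) (fM 0).
under eq_integral do rewrite EFinM.
rewrite ge0_integralZl_EFin//; last by apply/measurable_EFinP; exact: measurable_indic.
by rewrite integral_indic// setIT lte_mul_pinfty ?lee_fin.
Qed.

Lemma Cc_integrable mu f : radon mu -> Cc f ->
  mu.-integrable setT (fun x : RdB R d => (f x)%:E).
Proof.
move=> rmu cf; have [r r0 fr] := Cc_vanish cf; have [M M0 fM] := Cc_bounded cf.
by apply: (vanish_integrable rmu _ fr fM); exact: Cc_measurable.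
Qed.
End EuclideanSpace.

(** * Positive functionals on test functions *)

Lemma max0_decomposition (R : realType) (x : R) : x = Num.max x 0 - Num.max (- x) 0.
Proof. by rewrite /Num.max; do 2 case: ltP => ?; lra. Qed.

Section DistanceToComplement.
Context (R : realType) (V : normedModType R) (U : set V).
Hypotheses (oU : open U) (nU : exists y, ~ U y).

Let S (x : V) : set R := [set `|x - y| | y in ~` U].
Let dst (x : V) : R := inf (S x).

Let S_ne x : S x !=set0.
Proof. by have [y Uy] := nU; exists `|x - y|; exists y. Qed.

Let S_lb x : has_lbound (S x).
Proof. by exists 0 => _ [y _ <-]. Qed.

Let dst_ge0 x : 0 <= dst x.
Proof. by apply: lb_le_inf => // _ [y _ <-]. Qed.

Let dst_lip x y : dst x <= dst y + `|x - y|.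
Proof.
rewrite -lerBlDr; apply: lb_le_inf => // _ [z Uz <-]; rewrite lerBlDr.
apply: (@le_trans _ _ `|x - z|); first by apply: ge_inf => //; exists z.
by rewrite [leRHS]addrC (_ : x - z = x - y + (y - z)) ?ler_normD// addrA subrK.
Qed.

(** Multiples of [D] truncated at 1 increase to the indicator of [U]. This serves for the
    Caratheodory measurability of open sets and for the uniqueness of Radon measures. *)
Lemma exists_distance_to_complement : exists D : V -> R,
  [/\ continuous D, (forall x, 0 <= D x), (forall x, ~ U x -> D x = 0) &
      (forall x, U x -> 0 < D x)].
Proof.
exists dst; split => //.
- move=> x; apply/cvgrPdist_lt => e e0; near=> y.
  have : `|x - y| < e by near: y; exact: cvgr_dist_lt.
  apply: le_lt_trans; rewrite ler_norml; apply/andP; split.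
    by rewrite lerBrDr addrC lerBlDr distrC; exact: dst_lip.
  by rewrite lerBlDr addrC; exact: dst_lip.
- move=> x Ux; apply/le_anti; rewrite dst_ge0 andbT.
  by apply: ge_inf => //; exists x => //; rewrite subrr normr0.
- move=> x Ux; have /nbhs_ballP[e /= e0 eU] := open_nbhs_nbhs (conj oU Ux).
  apply: (lt_le_trans e0); apply: lb_le_inf => // _ [y Uy <-].
  rewrite leNgt; apply/negP => xy; apply: Uy; apply: eU.
  by rewrite -ball_normE.
Unshelve. all: by end_near. Qed.
End DistanceToComplement.

Section Bump.
Context (R : realType) (d : nat).

Definition bump (r : R) (x : Rd R d) : R := Num.max 0 (r ^+ 2 + 1 - sqn x).

Lemma bump_ge0 r x : 0 <= bump r x. Proof. by rewrite le_max lexx. Qed.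

Lemma bump_ge1 r x : enorm x <= r -> 1 <= bump r x.
Proof.
move=> xr; have r0 : 0 <= r := le_trans (enorm_ge0 x) xr.
rewrite le_max; apply/orP; right; rewrite -sqr_enorm lerBrDr addrC lerD2r.
by rewrite ler_pXn2r// nnegrE enorm_ge0.
Qed.

Lemma bump_Cc r : Cc (bump r).
Proof.
apply: (@vanish_Cc _ _ (r ^+ 2 + 1)).
  move=> x; apply: (@continuous_max _ _ (fun=> 0) (fun x => r ^+ 2 + 1 - sqn x)); first exact: cst_continuous.
  by apply: continuousB; [exact: cst_continuous|exact: continuous_sqn].
move=> x rx; rewrite /bump max_l// subr_le0 -sqr_enorm.
have r1 : 1 <= r ^+ 2 + 1 by rewrite lerDr sqr_ge0.
by rewrite (le_trans rx)// expr2 ler_peMl ?enorm_ge0// (le_trans r1).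
Qed.
End Bump.

Section RieszMarkov.
Context (R : realType) (d : nat) (L : (Rd R d -> R) -> R).
Hypotheses (LD : forall f g, Cc f -> Cc g -> L (fun x => f x + g x) = L f + L g)
  (LZ : forall (c : R) f, Cc f -> L (fun x => c * f x) = c * L f)
  (L_ge0 : forall f, Cc f -> (forall x, 0 <= f x) -> 0 <= L f).
Implicit Types (f : Rd R d -> R) (g : nat -> Rd R d -> R) (A : set (Rd R d)).

Let LB f h : Cc f -> Cc h -> L (fun x => f x - h x) = L f - L h.
Proof.
move=> cf ch; have := LD cf (CcZ (-1) ch); rewrite LZ// mulN1r => <-.
by congr L; apply/funext => x; rewrite mulN1r.
Qed.

Let le_L f h : Cc f -> Cc h -> (forall x, f x <= h x) -> L f <= L h.
Proof.
move=> cf ch fh; rewrite -subr_ge0 -LB//; apply: L_ge0; first exact: CcB.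
by move=> x; rewrite subr_ge0.
Qed.

(** [v] bounds [L] along an increasing sequence of test functions that reaches 1 at each point of
    [A]. Sequences, in place of single test functions, also reach unbounded sets and make the outer
    measure countably subadditive. *)
Let cover A (v : R) := exists g, [/\ (forall k, Cc (g k)),
  (forall k x, 0 <= g k x /\ g k x <= g k.+1 x),
  (forall x, A x -> exists k, 1 <= g k x) & (forall k, L (g k) <= v)].

Let cover_homo g : (forall k x, 0 <= g k x /\ g k x <= g k.+1 x) ->
  forall k m x, (k <= m)%N -> g k x <= g m x.
Proof.
move=> gi k m x km; rewrite -(subnKC km); elim: (m - k)%N => [|n IH]; first by rewrite addn0.
by rewrite addnS (le_trans IH)// (gi _ _).2.
Qed.

Let om A : \bar R := ereal_inf [set v%:E | v in cover A].

Let cover_ge0 A v : cover A v -> 0 <= v.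
Proof.
move=> [g [cg gi _ /(_ 0%N)]]; apply: le_trans.
by apply: L_ge0 => // x; exact: (gi _ _).1.
Qed.

Let om_ge0 A : (0 <= om A)%E.
Proof. by apply: le_ereal_inf_tmp => _ [v /cover_ge0 v0 <-]; rewrite lee_fin. Qed.

Let om_le A v : cover A v -> (om A <= v%:E)%E.
Proof. by move=> cv; apply: ge_ereal_inf; exists v%:E => //; exists v. Qed.

Let L0 : L (fun=> 0) = 0.
Proof.
transitivity (L (fun x => 0 * (fun _ : Rd R d => 0) x)).
  by congr L; apply/funext => x; rewrite mul0r.
by rewrite (LZ 0 (@Cc0 R d)) mul0r.
Qed.

Let om0 : om set0 = 0%E.
Proof.
apply/le_anti; rewrite om_ge0 andbT; apply: om_le; exists (fun _ _ => 0).
split=> // k; first exact: Cc0.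
by rewrite L0.
Qed.

Let om_approx A (e : R) : 0 < e -> (om A < +oo)%E ->
  exists2 v, cover A v & (v%:E <= om A + e%:E)%E.
Proof.
move=> e0 Aoo; have fA : om A \is a fin_num by rewrite ge0_fin_numE.
have [_ [v cv <-] ve] := lb_ereal_inf_adherent e0 fA.
by exists v => //; exact: ltW.
Qed.

Let om_sub A (F : (set (Rd R d))^nat) : subset_sigma_subadditive om A F.
Proof.
move=> AF; have [[i Fi]|nFi] := pselect (exists i, om (F i) = +oo%E).
  rewrite (_ : (\sum_(n <oo) om (F n))%E = +oo%E) ?leey//.
  by apply: (@eseries_pinfty _ _ xpredT i) => // n _; rewrite -ltNye (lt_le_trans (ltNyr 0)).
have Foo i : (om (F i) < +oo)%E.
  by rewrite ltey; apply/negP => /eqP Fi; apply: nFi; exists i.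
apply/lee_addgt0Pr => e e0.
apply: le_trans (epsilon_trick xpredT _ (ltW e0)) => //.
have en0 i : 0 < e / (2 ^ i.+1)%:R by rewrite divr_gt0// ltr0n expn_gt0.
have /choice[v cv] i : exists v, cover (F i) v /\ (v%:E <= om (F i) + (e / (2 ^ i.+1)%:R)%:E)%E.
  by have [v ? ?] := om_approx (en0 i) (Foo i); exists v.
have /choice[g gP] i := (cv i).1.
pose S := (\sum_(i <oo) (om (F i) + (e / (2 ^ i.+1)%:R)%:E))%E.
have S0 : (0 <= S)%E.
  by apply: nneseries_ge0 => i _ _; rewrite adde_ge0 ?om_ge0 ?lee_fin ?ltW.
have [Soo|Soo] := eqVneq S +oo%E; first by rewrite -/S Soo leey.
have fS : S \is a fin_num by rewrite ge0_fin_numE// ltey.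
rewrite -/S -(fineK fS); apply: om_le.
(* A diagonal sum: stage [k] adds the [k]-th functions of the first [k + 1] covers, so that each
   stage is a finite sum of test functions. *)
exists (fun k x => \sum_(0 <= i < k.+1) g i k x); split.
- by move=> k; apply: Cc_sum => i; case: (gP i).
- move=> k x; split; first by apply: sumr_ge0 => i _; case: (gP i) => _ + _ _; case/(_ k x).
  rewrite [leRHS]big_nat_recr//= -[leLHS]addr0 lerD//.
    by apply: ler_sum => i _; case: (gP i) => _ /(_ k x)[].
  by case: (gP k.+1) => _ /(_ k.+1 x)[].
- move=> x /AF[i _ Fix]; have [_ gi /(_ x Fix)[k gk] _] := gP i.
  exists (maxn i k); have ik : (i < (maxn i k).+1)%N by rewrite ltnS leq_maxl.
  rewrite (le_trans gk)// (le_trans (cover_homo gi x (leq_maxr i k)))//.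
  rewrite big_mkord (bigD1 (Ordinal ik))//= lerDl; apply: sumr_ge0 => j _.
  by case: (gP j) => _ /(_ (maxn i k) x)[].
- move=> k; have -> : L (fun x => \sum_(0 <= i < k.+1) g i k x) = \sum_(0 <= i < k.+1) L (g i k).
    elim: (k.+1) {2 4}k => [|n IH] m.
      by rewrite big_geq//= -L0; congr L; apply/funext => x; rewrite big_geq.
    rewrite big_nat_recr//= -IH -LD.
    + by congr L; apply/funext => x; rewrite big_nat_recr.
    + by apply: Cc_sum => i; case: (gP i).
    + by case: (gP n).
  rewrite -lee_fin (fineK fS) -sumEFin.
  apply: (@le_trans _ _ (\sum_(0 <= i < k.+1) (om (F i) + (e / (2 ^ i.+1)%:R)%:E))%E).
    apply: lee_sum => i _; apply: le_trans (cv i).2.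
    by rewrite lee_fin; case: (gP i).
  by apply: nneseries_lim_ge => i _ _; rewrite adde_ge0 ?om_ge0 ?lee_fin ?ltW.
Qed.

Let om_mixin := isSubsetOuterMeasure.Build R (Rd R d) om om0 om_ge0 om_sub.
Let omO : {outer_measure set (Rd R d) -> \bar R} := HB.pack om om_mixin.

(** A cover [g] of [X] is split by cutoffs [e k] that increase to the indicator of [U]. The products
    [e k * g k] cover the part of [X] in [U], at the cost [sup (range a)]; with [m] frozen,
    [(1 - e m) * g k] covers the rest at the cost [v - a m], and [a m] comes as close to the
    supremum as desired. *)
Let om_open (U : set (Rd R d)) : open U -> omO.-caratheodory U.
Proof.
move=> oU; have [->|nU] := pselect (U = setT).
  by move=> X; rewrite setIT setCT setI0 outer_measure0 adde0.
have nU' : exists y, ~ U y.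
  by apply: contra_notP nU => nU; apply/seteqP; split => // x _; apply: contrapT => Ux; apply: nU; exists x.
have [D [cD D0 Dn Dp]] := exists_distance_to_complement oU nU'.
pose e k x := Num.min 1 (k%:R * D x).
have ce k : continuous (e k).
  move=> x; apply: (@continuous_min _ _ (fun=> 1) (fun x => k%:R * D x)); first exact: cst_continuous.
  by apply: continuousM; [exact: cst_continuous|exact: cD].
have e01 k x : 0 <= e k x <= 1.
  by rewrite /e le_min ler01 ge_min lexx mulr_ge0.
have e_homo k m x : (k <= m)%N -> e k x <= e m x.
  move=> km; rewrite /e le_min !ge_min lexx/=; apply/orP; right.
  by rewrite ler_wpM2r// ler_nat.
have en k x : ~ U x -> e k x = 0 by move=> Ux; rewrite /e Dn// mulr0 min_r.
have ep x : U x -> exists k, e k x = 1.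
  move=> Ux; exists (Num.truncn (D x)^-1).+1; rewrite /e min_l// -ler_pdivrMr ?Dp// div1r.
  exact/ltW/truncnS_gt.
apply: le_caratheodory_measurable => X /=; rewrite -/(om X).
have [->|Xoo] := eqVneq (om X) +oo%E; first by rewrite leey.
apply/lee_addgt0Pr => eps eps0.
have eps20 : 0 < eps / 2 by rewrite divr_gt0.
have [v [g [cg gi gX gv]] vX] := om_approx eps20 (etrans (ltey _) Xoo).
have g_homo := cover_homo gi.
have cge k m : Cc (fun x => e k x * g m x) by exact: CcMl.
pose a k := L (fun x => e k x * g k x).
have g0 k x : 0 <= g k x by case: (gi k x).
have av k : a k <= v.
  apply: le_trans (gv k); apply: le_L => // x.
  by rewrite ler_piMl//; case/andP: (e01 k x).
have supa : has_sup (range a).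
  split; first by exists (a 0%N); exists 0%N.
  by exists v => _ [k _ <-].
have h1 : (om (X `&` U) <= (sup (range a))%:E)%E.
  apply: om_le; exists (fun k x => e k x * g k x); split => //.
  - move=> k x; split; first by rewrite mulr_ge0//; case/andP: (e01 k x).
    rewrite ler_pM//; [by case/andP: (e01 k x)|exact: e_homo|].
    by case: (gi k x).
  - move=> x [Xx Ux]; have [k gk] := gX x Xx; have [m em] := ep x Ux.
    exists (maxn k m); rewrite -[leLHS]mulr1 ler_pM//.
      by rewrite -em; apply: e_homo; rewrite leq_maxr.
    by rewrite (le_trans gk)//; apply: g_homo; rewrite leq_maxl.
  - by move=> k; apply: ub_le_sup; [case: supa|exists k].
have h2 m : (om (X `&` ~` U) <= (v - a m)%:E)%E.
  apply: om_le; exists (fun k x => g k x - e m x * g k x); split => //.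
  - by move=> k; apply: CcB.
  - have eq k x : g k x - e m x * g k x = (1 - e m x) * g k x by rewrite mulrBl mul1r.
    have em0 x : 0 <= 1 - e m x by rewrite subr_ge0; case/andP: (e01 m x).
    move=> k x; rewrite !eq; split; first by rewrite mulr_ge0.
    by rewrite ler_wpM2l//; case: (gi k x).
  - by move=> x [Xx Ux]; have [k gk] := gX x Xx; exists k; rewrite en// mul0r subr0.
  (* Raising the index to [maxn k m] makes the subtracted term at least [a m]. *)
  - move=> k; apply: (@le_trans _ _ (L (fun x => g (maxn k m) x - e m x * g (maxn k m) x))).
      apply: le_L; [exact: CcB|exact: CcB|move=> x].
      have eq j : g j x - e m x * g j x = (1 - e m x) * g j x by rewrite mulrBl mul1r.
      rewrite !eq ler_wpM2l//; first by rewrite subr_ge0; case/andP: (e01 m x).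
      by apply: g_homo; rewrite leq_maxl.
    rewrite LB// lerB//; apply: le_L => // x; rewrite ler_wpM2l//.
      by case/andP: (e01 m x).
    by apply: g_homo; rewrite leq_maxr.
have [_ [m _ <-] am] := sup_adherent eps20 supa.
apply: (le_trans (leeD h1 (h2 m))).
apply: (@le_trans _ _ (v%:E + (eps / 2)%:E)%E).
  rewrite -!EFinD lee_fin; lra.
rewrite [X in (_ <= _ + X%:E)%E](_ : eps = eps / 2 + eps / 2); last by field.
by rewrite EFinD addeA leeD2r.
Qed.

Let om_measurable (A : set (RdB R d)) : measurable A -> omO.-caratheodory A.
Proof.
apply: smallest_sub; last by move=> U; exact: om_open.
exact: (@sigma_algebra_measurable _ (caratheodory_type omO)).
Qed.

Let om_sigma_additive : semi_sigma_additive (om : set (RdB R d) -> \bar R).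
Proof.
move=> F mF tF mUF; apply: (@caratheodory_measure_sigma_additive _ _ omO F) => //.
- by move=> i; exact: om_measurable.
- exact: om_measurable.
Qed.

Let om_measure_mixin := isMeasure.Build _ (RdB R d) R om om0 om_ge0 om_sigma_additive.
Let mu : Meas R d := HB.pack (om : set (RdB R d) -> \bar R) om_measure_mixin.

Let mu_le_L f A : Cc f -> (forall x, 0 <= f x) -> (forall x, A x -> 1 <= f x) ->
  (mu A <= (L f)%:E)%E.
Proof.
move=> cf f0 fA; apply: om_le; exists (fun=> f); split => //.
by move=> x Ax; exists 0%N; exact: fA.
Qed.

Let mu_radon : radon mu.
Proof.
move=> r.
apply: (@le_lt_trans _ _ (L (bump r))%:E); last exact: ltry.
apply: mu_le_L => [|x|x]; [exact: bump_Cc|exact: bump_ge0|].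
by rewrite EballE/= => xr; apply: bump_ge1; exact: ltW.
Qed.

(** An argument of Dini type: the increasing functions [g k] of a cover eventually exceed [f - e] on
    the compact ball that carries [f]. The loss [e] is paid for by [e * L chi <= eps], where
    [chi >= 1] on that ball. *)
Let L_le_mu f A : Cc f -> (forall x, 0 <= f x <= 1) -> (forall x, ~ A x -> f x = 0) ->
  ((L f)%:E <= mu A)%E.
Proof.
move=> cf f01 fA; apply: le_ereal_inf_tmp => _ [v [g [cg gi gA gv]] <-].
rewrite lee_fin; have g_homo := cover_homo gi.
have g0 k x : 0 <= g k x by case: (gi k x).
have [r r0 fr] := Cc_vanish cf.
pose chi : Rd R d -> R := bump r.
have cchi : Cc chi by exact: bump_Cc.
have chi0 x : 0 <= chi x by exact: bump_ge0.
have chi1 x : enorm x <= r -> 1 <= chi x by exact: bump_ge1.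
apply/ler_addgt0Pr => eps eps0.
pose e := eps / (L chi + 1).
have Lchi0 : 0 <= L chi by exact: L_ge0.
have e0 : 0 < e by rewrite divr_gt0// ltr_wpDl.
have /compact_near_coveringP ncov := @compact_enorm_le R d r.
have : \forall k \near \oo, [set x : Rd R d | enorm x <= r] `<=` (fun x => f x < g k x + e).
  apply: (ncov nat \oo (fun k x => f x < g k x + e)) => x _.
  have [k fk] : exists k, f x <= g k x.
    have [Ax|Ax] := pselect (A x); last by exists 0%N; rewrite fA.
    by have [k gk] := gA x Ax; exists k; rewrite (le_trans _ gk)//; case/andP: (f01 x).
  have cfg : continuous (fun y => g k y - f y).
    by move=> y; apply: continuousB; [exact: (Cc_continuous (cg k))|exact: (Cc_continuous cf)].
  near=> y m.
  have : - e < g k y - f y.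
    near: y; apply: (cvgr_gt (g k x - f x)); first exact: cfg.
    by rewrite (lt_le_trans (y := 0)) ?oppr_lt0// subr_ge0.
  have : g k y <= g m y by apply: g_homo; near: m; exact: nbhs_infty_ge.
  by lra.
move=> /filter_ex[k fgk].
apply: (@le_trans _ _ (L (fun x => g k x + e * chi x))).
  apply: le_L => //; first by apply: CcD => //; exact: CcZ.
  move=> x; have [xr|rx] := leP (enorm x) r.
    rewrite (le_trans (ltW (fgk x xr)))// lerD2l.
    by rewrite ler_peMr ?(ltW e0)// chi1.
  by rewrite fr ?(ltW rx)// addr_ge0// mulr_ge0// ltW.
rewrite LD//; last exact: CcZ.
rewrite LZ// lerD// /e mulrAC ler_pdivrMr ?ltr_wpDl//.
by rewrite ler_pM2l// lerDl.
Unshelve. all: by end_near. Qed.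

(** The function is cut into horizontal slices of height [1 / (n + 1)]; a slice rescaled to height 1
    lies between the indicators of two consecutive superlevel sets. With [J] taken as [L] and then
    as the integral, both functionals are enclosed by the same two sums. *)
Let slice (J : (Rd R d -> R) -> R) f (n : nat) :
  (forall f h : Rd R d -> R, Cc f -> Cc h -> J (fun x => f x + h x) = J f + J h) ->
  (forall (c : R) f, Cc f -> J (fun x => c * f x) = c * J f) ->
  (forall f A, measurable (A : set (RdB R d)) -> Cc f -> (forall x, 0 <= f x) -> (forall x, A x -> 1 <= f x) ->
    (mu A <= (J f)%:E)%E) ->
  (forall f A, measurable (A : set (RdB R d)) -> Cc f -> (forall x, 0 <= f x <= 1) -> (forall x, ~ A x -> f x = 0) ->
    ((J f)%:E <= mu A)%E) ->
  Cc f -> (forall x, 0 <= f x <= 1) ->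
  forall a, a = (fun j => fine (mu [set x | j%:R / n.+1%:R < f x])) ->
  \sum_(0 <= j < n.+1) a j.+1 <= n.+1%:R * J f <= \sum_(0 <= j < n.+1) a j.
Proof.
move=> JD JZ J1 J2 cf f01 a aE; have [cf' _] := cf; set N : R := n.+1%:R.
have N0 : 0 < N by rewrite ltr0n.
pose t (j : nat) : R := j%:R / N.
have t0 j : 0 <= t j by rewrite divr_ge0// ltW.
have tS j : t j.+1 = t j + N^-1 by rewrite /t -(natr1 j) mulrDl div1r.
have mA j : measurable ([set x | t j < f x] : set (RdB R d)).
  apply: open_measurable_RdB; rewrite (_ : [set _ | _] = f @^-1` [set y | t j < y])//.
  by apply: open_comp; [move=> x _; exact: cf'|exact: open_gt].
have [r r0 fr] := Cc_vanish cf.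
have fA j : mu [set x | t j < f x] \is a fin_num.
  rewrite ge0_fin_numE// (le_lt_trans _ (mu_radon r))// le_measure ?inE//.
    exact: measurable_Eball.
  move=> x /= jx; rewrite EballE/= ltNge; apply/negP => /fr fx.
  by move: jx; rewrite fx ltNge t0.
pose m j x := Num.min (f x) (t j).
have cm j : Cc (m j).
  apply: (@vanish_Cc _ _ r) => [x|x /fr fx].
    by apply: (@continuous_min _ _ f (fun=> t j)); [exact: cf'|exact: cst_continuous].
  by rewrite /m fx min_l.
pose h j x := N * (m j.+1 x - m j x).
have ch j : Cc (h j) by apply: CcZ; exact: CcB.
have hE j x : h j x = if f x <= t j then 0 else if t j.+1 <= f x then 1 else N * (f x - t j).
  rewrite /h /m; have [fj|jf] := leP (f x) (t j).
    by rewrite !min_l ?subrr ?mulr0// (le_trans fj)// tS lerDl invr_ge0 ltW.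
  have [fj|jf'] := leP (t j.+1) (f x); last by [].
  by rewrite tS addrAC subrr add0r divff ?gt_eqF.
have h01 j x : 0 <= h j x <= 1.
  rewrite hE; case: ifPn => [_|]; first by rewrite lexx ler01.
  rewrite -ltNge => jf; case: ifPn => [_|]; first by rewrite lexx ler01.
  rewrite -ltNge tS => fj; rewrite mulr_ge0 ?subr_ge0 ?(ltW jf) ?(ltW N0)//=.
  by rewrite mulrC -ler_pdivlMr// div1r lerBlDl ltW.
have Jh j : a j.+1 <= J (h j) <= a j.
  have faj k : (a k)%:E = mu [set x | t k < f x] by rewrite aE fineK// fA.
  rewrite -!lee_fin !faj; apply/andP; split.
    apply: J1; [exact: (mA j.+1)|exact: ch|by move=> x; case/andP: (h01 j x)|].
    move=> x /= jf.
    rewrite hE (ltW jf) ifF//; apply/negbTE; rewrite -ltNge (le_lt_trans _ jf)//.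
    by rewrite tS lerDl invr_ge0 ltW.
  apply: J2; [exact: (mA j)|exact: ch|exact: h01|move=> x /= /negP]; rewrite -leNgt => fj; by rewrite hE fj.
have Jm k : N * J (m k) = \sum_(0 <= j < k) J (h j).
  elim: k => [|k IH].
    rewrite big_geq// (_ : m 0%N = fun x => 0 * f x); first by rewrite JZ// mul0r mulr0.
    by apply/funext => x; rewrite mul0r /m /t mul0r min_r//; case/andP: (f01 x).
  rewrite big_nat_recr//= -IH -!JZ// -JD//; last exact: CcZ.
  by congr J; apply/funext => x; rewrite /h mulrBr addrC subrK.
have -> : f = m n.+1.
  by apply/funext => x; rewrite /m /t divff ?gt_eqF// min_l//; case/andP: (f01 x).
rewrite Jm; apply/andP; split; apply: ler_sum => j _; by case/andP: (Jh j).
Qed.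

Let int_fin f : Cc f -> (\int[mu]_x (f x)%:E)%E \is a fin_num.
Proof. by move=> cf; apply: integrable_fin_num => //; exact: (@Cc_integrable _ _ mu _ mu_radon). Qed.

Let I f : R := fine (\int[mu]_x (f x)%:E)%E.

Let ID f h : Cc f -> Cc h -> I (fun x => f x + h x) = I f + I h.
Proof.
move=> cf ch; rewrite /I -fineD ?int_fin//; congr fine.
by rewrite -integralD_EFin//; exact: (@Cc_integrable _ _ mu _ mu_radon).
Qed.

Let IZ c f : Cc f -> I (fun x => c * f x) = c * I f.
Proof.
move=> cf; rewrite /I.
have -> : (\int[mu]_x (c * f x)%:E = c%:E * \int[mu]_x (f x)%:E)%E.
  under eq_integral do rewrite EFinM.
  by rewrite integralZl//; exact: (@Cc_integrable _ _ mu _ mu_radon).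
by rewrite fineM// int_fin.
Qed.

Let I_L01 f : Cc f -> (forall x, 0 <= f x <= 1) -> I f = L f.
Proof.
move=> cf f01; apply/eqP; rewrite -subr_eq0 -normr_le0; apply/ler_addgt0Pr => e e0.
rewrite add0r.
pose a0 := fine (mu [set x | 0 < f x]).
(* The two enclosing sums telescope to a difference of at most [a 0], so after division by [N] the
   functionals differ by at most [a0 / N <= e]. *)
pose n := Num.truncn (a0 / e); set N : R := n.+1%:R.
have N0 : 0 < N by rewrite ltr0n.
have aN : a0 <= e * N by rewrite mulrC -ler_pdivrMr// ltW// truncnS_gt.
pose a j := fine (mu [set x | j%:R / n.+1%:R < f x]).
have s1 := @slice L f n LD LZ (fun f A _ => @mu_le_L f A) (fun f A _ => @L_le_mu f A) cf f01 a erefl.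
have I1 h A : measurable (A : set (RdB R d)) -> Cc h -> (forall x, 0 <= h x) -> (forall x, A x -> 1 <= h x) ->
    (mu A <= (I h)%:E)%E.
  move=> mA ch h0 hA; rewrite fineK ?int_fin//.
  rewrite -(setIT A) -integral_indic//; apply: ge0_le_integral => //.
  - exact/measurable_EFinP/measurable_indic.
  - by apply/measurable_EFinP; apply: Cc_measurable.
  - move=> x _; rewrite lee_fin indicE; have [xA|xA] := boolP (x \in A); last exact: h0.
    by rewrite hA//; rewrite inE in xA.
have I2 h A : measurable (A : set (RdB R d)) -> Cc h -> (forall x, 0 <= h x <= 1) -> (forall x, ~ A x -> h x = 0) ->
    ((I h)%:E <= mu A)%E.
  move=> mA ch h01 hA; rewrite fineK ?int_fin//.
  rewrite -[X in (_ <= mu X)%E](setIT A) -integral_indic//; apply: ge0_le_integral => //.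
  - by move=> x _; rewrite lee_fin; case/andP: (h01 x).
  - by apply/measurable_EFinP; apply: Cc_measurable.
  - exact/measurable_EFinP/measurable_indic.
  - move=> x _; rewrite lee_fin indicE; have [xA|xA] := boolP (x \in A); first by case/andP: (h01 x).
    by rewrite hA// => Ax; case/negP: xA; exact: mem_set.
have s2 := @slice I f n ID IZ I1 I2 cf f01 a erefl.
move: s1 s2; rewrite -/N => /andP[s1 s1'] /andP[s2 s2'].
have a_ge0 j : 0 <= a j by rewrite fine_ge0.
have tel : \sum_(0 <= j < n.+1) a j - \sum_(0 <= j < n.+1) a j.+1 <= a 0%N.
  rewrite big_nat_recl// [X in _ - X]big_nat_recr//= opprD addrA addrK.
  by rewrite gerDl oppr_le0.
have a00 : a 0%N = a0 by rewrite /a /a0 mul0r.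
rewrite -(ler_pM2l N0) -[X in X * `|_|]gtr0_norm// -normrM mulrBr mulrC [N * e]mulrC.
rewrite ler_norml (le_trans _ aN) -?a00; lra.
Qed.

Theorem riesz_markov : exists2 m : Meas R d, radon m &
  forall f, Cc f -> (\int[m]_x (f x)%:E)%E = (L f)%:E.
Proof.
exists mu => // f cf; rewrite -(fineK (int_fin cf)); congr EFin; rewrite -/(I f).
have [M M0 fM] := Cc_bounded cf.
have [r r0 fr] := Cc_vanish cf.
have [cf' _] := cf.
pose fp x := Num.max (f x) 0; pose fn x := Num.max (- f x) 0.
have cfp : Cc fp.
  apply: (@vanish_Cc _ _ r) => [x|x /fr fx]; last by rewrite /fp fx max_l.
  by apply: (@continuous_max _ _ f (fun=> 0)); [exact: cf'|exact: cst_continuous].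
have cfn : Cc fn.
  apply: (@vanish_Cc _ _ r) => [x|x /fr fx]; last by rewrite /fn fx oppr0 max_l.
  apply: (@continuous_max _ _ (fun x => - f x) (fun=> 0)); last exact: cst_continuous.
  by apply: continuousN; exact: cf'.
have I_L h : Cc h -> (forall x, 0 <= h x <= M) -> I h = L h.
  move=> ch h0M; have M' : M != 0 by rewrite gt_eqF.
  have hE : h = fun x => M * (M^-1 * h x) by apply/funext => x; rewrite mulrA divff ?mul1r.
  have ch' : Cc (fun x => M^-1 * h x) by exact: CcZ.
  rewrite [LHS](_ : _ = M * I (fun x => M^-1 * h x)); last by rewrite -IZ// -hE.
  rewrite [RHS](_ : _ = M * L (fun x => M^-1 * h x)); last by rewrite -LZ// -hE.
  congr (_ * _); apply: I_L01 => // x; have /andP[h0 hM] := h0M x.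
  by rewrite mulr_ge0 ?invr_ge0 ?(ltW M0)//= ler_pdivrMl ?mulr1.
have fE : f = fun x => fp x + (-1) * fn x.
  apply/funext => x; rewrite /fp /fn mulN1r.
  exact: max0_decomposition.
rewrite fE ID ?LD ?IZ ?LZ//; try exact: CcZ.
by rewrite !I_L// => x; rewrite le_max lexx orbT/= ge_max (ltW M0) andbT
  (le_trans (ler_norm _))// ?normrN fM.
Qed.
End RieszMarkov.

(** * Differentiable test functions *)

Section SmoothFunctions.
Context (R : realType).

Definition pos2 (y : R) : R := Num.max 0 y ^+ 2.

Lemma pos2_quadratic (y h : R) :
  0 <= pos2 (h + y) - pos2 y - h * (2 * Num.max 0 y) <= h ^+ 2.
Proof. by rewrite /pos2 /Num.max; do 2 case: ltP => ?; apply/andP; split; nra. Qed.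

(** The elementary functions used as building blocks are polynomials of degree at most 2 or
    piecewise such, and a quadratic remainder is an algebraic check for them, also across the
    kinks. *)
Lemma is_derive_quadratic (g : R -> R) (x l : R) :
  (forall h, `|g (h + x) - g x - h * l| <= h ^+ 2) -> is_derive x 1 g l.
Proof.
move=> gl.
have cg : (fun h : R => h^-1 *: ((g \o shift x) (h *: (1 : R)) - g x)) @ 0^' --> l.
  apply/cvgrPdist_le => e e0; near=> h.
  have h0 : h != 0 by near: h; exact: nbhs_dnbhs_neq.
  have he : `|h| <= e.
    near: h; apply: nbhs_dnbhs; apply/nbhs_normP; exists e => //= h.
    by rewrite /= sub0r normrN => /ltW.
  rewrite (_ : (g \o shift x) (h *: 1) = g (h + x)); last first.
    by rewrite /= /GRing.scale/= mulr1.
  have -> : l - h^-1 *: (g (h + x) - g x) = - (h^-1 * (g (h + x) - g x - h * l)).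
    by rewrite [_ *: _](_ : _ = h^-1 * (g (h + x) - g x))//; field.
  rewrite normrN normrM normfV ler_pdivrMl ?normr_gt0// (le_trans (gl h))//.
  by rewrite -real_normK ?num_real// expr2 ler_wpM2l.
apply: DeriveDef; first by apply/cvg_ex; exists l.
exact/cvg_lim.
Unshelve. all: by end_near. Qed.

Lemma is_derive_pos2 (y : R) : is_derive y 1 pos2 (2 * Num.max 0 y).
Proof.
apply: is_derive_quadratic => h; have /andP[h1 h2] := pos2_quadratic y h.
by rewrite ger0_norm.
Qed.

Lemma continuous_max0 : continuous (fun y : R => Num.max 0 y).
Proof.
move=> y; apply: (@continuous_max _ _ (fun=> 0) id); [exact: cst_continuous|exact: cvg_id].
Qed.

(* A C^1 step from 0 on ]-oo, 0] to 1 on [2, +oo[: the integral of the hat function *)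
Definition sstep (y : R) : R := 2^-1 * (pos2 y - 2 * pos2 (y - 1) + pos2 (y - 2)).
Definition dsstep (y : R) : R :=
  Num.max 0 y - 2 * Num.max 0 (y - 1) + Num.max 0 (y - 2).

Lemma is_derive_sstep (y : R) : is_derive y (1 : R) sstep (dsstep y).
Proof.
apply: is_derive_quadratic => h; rewrite /sstep /dsstep -!addrA.
have := pos2_quadratic y h; have := pos2_quadratic (y - 1) h.
have := pos2_quadratic (y - 2) h.
move=> /andP[? ?] /andP[? ?] /andP[? ?].
by rewrite ler_norml; apply/andP; split; lra.
Qed.

Lemma continuous_dsstep : continuous dsstep.
Proof.
have cp c : continuous (fun z : R => Num.max 0 (z - c)).
  apply: (continuous_compose (@continuous_max0)).
  by apply: continuous_sub; [move=> x; exact: cvg_id|exact: continuous_const].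
apply: continuous_add; last exact: cp.
apply: continuous_sub; first exact: continuous_max0.
by apply: continuous_mul; [exact: continuous_const|exact: cp].
Qed.

Lemma sstep_le0 y : y <= 0 -> sstep y = 0.
Proof. by rewrite /sstep /pos2 => y0; rewrite !max_l; [ring|lra..]. Qed.

Lemma sstep_ge2 y : 2 <= y -> sstep y = 1.
Proof. by rewrite /sstep /pos2 => y0; rewrite !max_r; [field|lra..]. Qed.

Lemma dsstep_ge0 y : 0 <= dsstep y.
Proof. by rewrite /dsstep /Num.max; do 3 case: ltP => ?; lra. Qed.

Lemma dsstep_ge2 y : 2 <= y -> dsstep y = 0.
Proof. by rewrite /dsstep => y0; rewrite !max_r; [ring|lra..]. Qed.

Lemma dsstep_le0 y : y <= 0 -> dsstep y = 0.
Proof. by rewrite /dsstep => y0; rewrite !max_l; [ring|lra..]. Qed.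

Lemma sstep_shift_le y : sstep (y - 1) <= sstep y.
Proof. by rewrite /sstep /pos2 /Num.max; do 6 case: ltP => ?; nra. Qed.

Lemma sstep01 y : 0 <= sstep y <= 1.
Proof.
by rewrite /sstep /pos2 /Num.max; do 3 case: ltP => ?; apply/andP; split; nra.
Qed.
End SmoothFunctions.

Section C1Functions.
Context (R : realType) (d : nat).
Implicit Types (f g : Rd R d -> R) (df dg : 'I_d -> Rd R d -> R).

(** The partial derivatives are carried as data, so that the product and chain rules return explicit
    gradients whose size can be estimated. *)
Definition C1with f df := [/\ continuous f, (forall i, continuous (df i)) &
  forall x i, is_derive (0 : R) (1 : R) (fun s : R => f (x + s *: evec R i)) (df i x)].

Definition C1fun f := exists df, C1with f df.

Lemma C1with_cst (c : R) : C1with (fun=> c) (fun _ _ => 0).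
Proof.
split=> [x|i x|x i]; [exact: cst_continuous|exact: cst_continuous|].
exact: is_derive_cst.
Qed.

Lemma C1with_coord (i : 'I_d) : C1with (fun x => x ord0 i) (fun j _ => (i == j)%:R).
Proof.
split=> [x|j x|x j]; [exact: continuous_coord|exact: cst_continuous|].
apply: is_derive_quadratic => h; rewrite !mxE eqxx/= addr0 mul0r addr0.
by rewrite (_ : _ - _ - _ = 0) ?normr0 ?sqr_ge0//; ring.
Qed.

Lemma C1with_add f df g dg : C1with f df -> C1with g dg ->
  C1with (fun x => f x + g x) (fun i x => df i x + dg i x).
Proof.
move=> [cf cdf Df] [cg cdg Dg]; split=> [|i|x i].
- exact: continuous_add.
- exact: continuous_add.
- exact: (is_deriveD (Df x i) (Dg x i)).
Qed.

Lemma C1with_mul f df g dg : C1with f df -> C1with g dg ->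
  C1with (fun x => f x * g x) (fun i x => f x * dg i x + g x * df i x).
Proof.
move=> [cf cdf Df] [cg cdg Dg]; split=> [|i|x i].
- exact: continuous_mul.
- by apply: continuous_add; exact: continuous_mul.
- have := is_deriveM (Df x i) (Dg x i).
  by rewrite scale0r addr0.
Qed.

Lemma C1with_comp (h dh : R -> R) f df :
  (forall y : R, is_derive y (1 : R) h (dh y)) -> continuous dh -> C1with f df ->
  C1with (fun x => h (f x)) (fun i x => dh (f x) * df i x).
Proof.
move=> Dh cdh [cf cdf Df].
have ch : continuous h.
  by move=> y; apply: differentiable_continuous; apply/derivable1_diffP; exact: ex_derive.
split=> [|i|x i].
- exact: continuous_compose.
- by apply: continuous_mul => //; exact: continuous_compose.
- have Df' := Df x i.
  have := @is_derive1_comp _ h (fun s : R => f (x + s *: evec R i)) 0 _ _ (Dh _) Df'.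
  by rewrite scale0r addr0.
Qed.

Lemma C1with_expr f df n : C1with f df ->
  C1with (fun x => f x ^+ n.+1) (fun i x => n.+1%:R * f x ^+ n * df i x).
Proof.
move=> D; elim: n => [|n IH].
  have -> : (fun x => f x ^+ 1) = f by apply/funext => x; rewrite expr1.
  have -> // : (fun i x => 1%:R * f x ^+ 0 * df i x) = df.
  by apply/funext => i; apply/funext => x; rewrite expr0 !mul1r.
have -> : (fun x => f x ^+ n.+2) = (fun x => f x * f x ^+ n.+1).
  by apply/funext => x; rewrite exprS.
have -> : (fun i x => n.+2%:R * f x ^+ n.+1 * df i x) =
    (fun i x => f x * (n.+1%:R * f x ^+ n * df i x) + f x ^+ n.+1 * df i x).
  by apply/funext => i; apply/funext => x; rewrite -[n.+2%:R]natr1 exprS; ring.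
exact: C1with_mul.
Qed.

Lemma C1fun_sum (I : Type) (s : seq I) (F : I -> Rd R d -> R) :
  (forall i, C1fun (F i)) -> C1fun (fun x => \sum_(i <- s) F i x).
Proof.
move=> cF; elim: s => [|a s [df IH]].
  under eq_fun do rewrite big_nil; exists (fun _ _ => 0); exact: C1with_cst.
under eq_fun do rewrite big_cons; have [da Da] := cF a.
by exists (fun i x => da i x + df i x); exact: C1with_add.
Qed.

Lemma C1fun_prod (I : Type) (s : seq I) (F : I -> Rd R d -> R) :
  (forall i, C1fun (F i)) -> C1fun (fun x => \prod_(i <- s) F i x).
Proof.
move=> cF; elim: s => [|a s [df IH]].
  under eq_fun do rewrite big_nil; exists (fun _ _ => 0); exact: C1with_cst.
under eq_fun do rewrite big_cons; have [da Da] := cF a.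
by eexists; exact: C1with_mul Da IH.
Qed.

Lemma C1fun_mul f g : C1fun f -> C1fun g -> C1fun (fun x => f x * g x).
Proof. by move=> [df Df] [dg Dg]; eexists; exact: C1with_mul Df Dg. Qed.

Lemma C1fun_cst (c : R) : C1fun (fun=> c).
Proof. by eexists; exact: C1with_cst. Qed.

(** A truncated paraboloid, between 1 and 2 on the ball of radius [r] and zero from radius [2 r] on.
    It has a kink where it reaches zero; its even powers are powers of [pos2] of a polynomial, hence
    C^1. *)
Definition cutoff (r : R) (x : Rd R d) : R := Num.max 0 (2 - (r ^+ 2)^-1 * sqn x).

Lemma cutoff_ge0 r x : 0 <= cutoff r x. Proof. by rewrite le_max lexx. Qed.

Lemma cutoff_le2 r x : cutoff r x <= 2.
Proof.
by rewrite ge_max ler0n/= lerBlDr lerDl mulr_ge0 ?invr_ge0 ?sqr_ge0 ?sqn_ge0.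
Qed.

Lemma cutoff_ge1 r x : 0 < r -> enorm x <= r -> 1 <= cutoff r x.
Proof.
move=> r0 xr; rewrite le_max; apply/orP; right.
have : (r ^+ 2)^-1 * sqn x <= 1.
  rewrite ler_pdivrMl ?exprn_gt0// mulr1 -sqr_enorm.
  by rewrite ler_pXn2r// nnegrE ?enorm_ge0// ltW.
lra.
Qed.

Lemma cutoff_vanish r : 0 < r -> vanish (2 * r) (cutoff r).
Proof.
move=> r0 x rx; rewrite /cutoff max_l// subr_le0 -sqr_enorm ler_pdivlMl ?exprn_gt0//.
have : (2 * r) ^+ 2 <= enorm x ^+ 2.
  by rewrite ler_pXn2r// nnegrE ?enorm_ge0// mulr_ge0// ltW.
by apply: le_trans; rewrite exprMn mulrC ler_wpM2r ?sqr_ge0//; lra.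
Qed.

Lemma continuous_cutoff r : continuous (cutoff r).
Proof.
move=> x; apply: (@continuous_max _ _ (fun=> 0) (fun x => 2 - (r ^+ 2)^-1 * sqn x)); first exact: cst_continuous.
apply: continuousB; first exact: cst_continuous.
by apply: continuousM; [exact: cst_continuous|exact: continuous_sqn].
Qed.

Lemma Cc_cutoffX r k : 0 < r -> (0 < k)%N -> Cc (fun x => cutoff r x ^+ k).
Proof.
move=> r0 k0; apply: (@vanish_Cc _ _ (2 * r)) => [x|x /(cutoff_vanish r0) ->].
  apply: (@continuous_comp _ _ _ (cutoff r) (fun y => y ^+ k)).
    exact: continuous_cutoff.
  exact: exprn_continuous.
by rewrite expr0n gtn_eqF.
Qed.

Lemma C1with_sqn : C1with (@sqn R d) (fun i x => 2 * x ord0 i).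
Proof.
split=> [x|i x|x i]; first exact: continuous_sqn.
  by apply: continuous_mul; [exact: continuous_const|exact: continuous_coord].
apply: is_derive_quadratic => h; rewrite addr0 scale0r addr0.
have -> : sqn (x + h *: evec R i) = sqn x + h * (2 * x ord0 i) + h ^+ 2.
  rewrite /sqn (bigD1 i)//= [\sum_(j < d) x ord0 j ^+ 2](bigD1 i)//= !mxE !eqxx/= mulr1.
  rewrite (eq_bigr (fun j => x ord0 j ^+ 2)); last first.
    by move=> j ji; rewrite !mxE (negbTE ji) andbF mulr0 addr0.
  by ring.
by rewrite (_ : _ - _ = h ^+ 2); [rewrite ger0_norm ?sqr_ge0|ring].
Qed.

(* This domination makes the mass of a curve weighted by the cutoff control its own growth. *)
Lemma C1with_cutoffX r m : 0 < r -> exists (df : 'I_d -> Rd R d -> R) (C : R),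
  [/\ 0 < C, C1with (fun x => cutoff r x ^+ (2 * m.+1)) df &
      forall i x, `|df i x| <= C * cutoff r x ^+ (2 * m.+1).-1].
Proof.
move=> r0; pose u (x : Rd R d) : R := 2 + (- (r ^+ 2)^-1) * sqn x.
have uE x : u x = 2 - (r ^+ 2)^-1 * sqn x by rewrite /u mulNr.
have cE x : cutoff r x = Num.max 0 (u x) by rewrite uE.
have Du := C1with_add (C1with_cst 2) (C1with_mul (C1with_cst (- (r ^+ 2)^-1)) C1with_sqn).
have c2 : continuous (fun y : R => 2 * Num.max 0 y).
  by apply: continuous_mul; [exact: continuous_const|exact: continuous_max0].
have D2 := C1with_comp (@is_derive_pos2 R) c2 Du.
have := C1with_expr m D2.
set df := (X in C1with _ X) => D.
(* The last factor [2 * r] bounds the coordinates where the cutoff does not vanish; the others come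
   from the chain rule. *)
exists df, (m.+1%:R * 2 * (r ^+ 2)^-1 * 2 * (2 * r)); split.
- by rewrite !mulr_gt0 ?invr_gt0 ?exprn_gt0 ?ltr0n.
- have -> // : (fun x => cutoff r x ^+ (2 * m.+1)) = (fun x => pos2 (u x) ^+ m.+1).
  by apply/funext => x; rewrite exprM cE.
move=> i x; rewrite /df /= -/(u x).
have -> : m.+1%:R * pos2 (u x) ^+ m * (2 * Num.max 0 (u x) *
    (0 + (- (r ^+ 2)^-1 * (2 * x ord0 i) + sqn x * 0))) =
    (m.+1%:R * 2 * (r ^+ 2)^-1 * 2) * - (x ord0 i * cutoff r x) * pos2 (u x) ^+ m.
  by rewrite cE; ring.
have -> : cutoff r x ^+ (2 * m.+1).-1 = cutoff r x * pos2 (u x) ^+ m.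
  by rewrite /pos2 -cE mulnS add2n/= exprS exprM.
have p0 : 0 <= pos2 (u x) ^+ m by rewrite exprn_ge0// sqr_ge0.
set A := m.+1%:R * 2 * (r ^+ 2)^-1 * 2; set P := pos2 _ ^+ m.
have A0 : 0 <= A by rewrite /A !mulr_ge0// invr_ge0 sqr_ge0.
have c0 := cutoff_ge0 r x.
rewrite normrM (ger0_norm p0) normrM (ger0_norm A0) normrN normrM (ger0_norm c0) -/P.
have [/(cutoff_vanish r0) ->|xr] := leP (2 * r) (enorm x); first by rewrite mulr0 mulr0 !mul0r mulr0.
have -> : A * (`|x ord0 i| * cutoff r x) * P = A * (cutoff r x * P) * `|x ord0 i| by ring.
have -> : A * (2 * r) * (cutoff r x * P) = A * (cutoff r x * P) * (2 * r) by ring.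
apply: ler_wpM2l; first by apply: mulr_ge0 => //; exact: mulr_ge0.
by rewrite (le_trans (coord_le_enorm x i))// ltW.
Qed.

Lemma enorm_large_coord (x : Rd R d) (c : R) :
  d%:R * c < enorm x -> exists i, c < `|x ord0 i|.
Proof.
move=> cx; apply: contrapT => nx; move: cx; rewrite ltNge => /negP; apply.
apply: (le_trans (enorm_le_sum x)).
have -> : d%:R * c = \sum_(i < d) c by rewrite sumr_const card_ord mulr_natl.
by apply: ler_sum => i _; rewrite leNgt; apply/negP => ri; apply: nx; exists i.
Qed.

Lemma Cc_uniformly_continuous f (e : R) : Cc f -> 0 < e ->
  exists2 h : R, 0 < h & forall x y, `|x - y| <= h -> `|f x - f y| <= e.
Proof.
move=> /[dup] [[cf _]] /Cc_vanish[r r0 fr] e0.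
(* The distance [|x - y|] is the maximum norm. Beyond the Euclidean radius [d (r + 1)] some
   coordinate exceeds [r + 1], and it is still at least [r] after a move of size [h <= 1]. *)
have /compact_near_coveringP ncov := @compact_enorm_le R d (d%:R * (r + 1)).
have : \forall h \near 0^'+, [set x : Rd R d | enorm x <= d%:R * (r + 1)] `<=`
    (fun x => forall y, `|x - y| <= h -> `|f x - f y| <= e).
  apply: (ncov R (0^'+) (fun h x => forall y, `|x - y| <= h -> `|f x - f y| <= e)) => x _.
  have e20 : 0 < e / 2 by rewrite divr_gt0.
  have /cvgrPdist_lt/(_ _ e20)/nbhs_ballP[s /= s0 fs] := cf x.
  have s20 : 0 < s / 2 by rewrite divr_gt0.
  near=> x' h => y /= x'y.
  have xx' : `|x - x'| < s / 2 by near: x'; exact: cvgr_dist_lt.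
  have hs : h < s / 2 by near: h; exact: nbhs_right_lt.
  have f1 : `|f x - f x'| < e / 2.
    by apply: fs; rewrite -ball_normE/= (lt_trans xx')//; lra.
  have f2 : `|f x - f y| < e / 2.
    apply: fs; rewrite -ball_normE/= (_ : x - y = x - x' + (x' - y)); last by rewrite addrA subrK.
    by rewrite (le_lt_trans (ler_normD _ _))//; lra.
  rewrite (_ : f x' - f y = (f x - f y) - (f x - f x')); last by ring.
  by rewrite (le_trans (ler_normB _ _))//; lra.
move=> H; have : \forall h \near 0^'+, 0 < h /\ h <= 1 /\ [set x : Rd R d | enorm x <= d%:R * (r + 1)] `<=`
    (fun x => forall y, `|x - y| <= h -> `|f x - f y| <= e).
  near=> h; split; first by near: h; exact: nbhs_right_gt.
  by split; [near: h; exact: nbhs_right_le|near: h].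
move=> /filter_ex[h [h0 [h1 Hh]]]; exists h => // x y xy.
have [xK|xK] := leP (enorm x) (d%:R * (r + 1)); first exact: Hh.
(* outside of the ball both values vanish *)
suff [fx fy] : f x = 0 /\ f y = 0 by rewrite fx fy subrr normr0 ltW.
have [i ri] := enorm_large_coord xK.
split; apply: fr.
  by rewrite (le_trans _ (coord_le_enorm x i))//; lra.
rewrite (le_trans _ (coord_le_enorm y i))//.
have := coord_le_norm (x - y) i; rewrite !mxE => xyi.
have : `|x ord0 i| <= `|x ord0 i - y ord0 i| + `|y ord0 i|.
  by rewrite -{1}(subrK (y ord0 i) (x ord0 i)) ler_normD.
by lra.
Unshelve. all: by end_near. Qed.

(** The quadratic B-spline on three consecutive intervals of length [h], written as a difference of
    two translates of [sstep] so that the sum over [k] telescopes to 1. *)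
Definition spline_cell (h : R) (n : nat) (k : nat) (y : R) : R :=
  sstep (y / h + n%:R - k%:R) - sstep (y / h + n%:R - k%:R - 1).

Lemma spline_cell_ge0 h n k y : 0 <= spline_cell h n k y.
Proof. by rewrite subr_ge0; exact: sstep_shift_le. Qed.

Lemma spline_cell_eq0 h n k y : 0 < h -> 3 * h <= `|y - (k%:R - n%:R) * h| ->
  spline_cell h n k y = 0.
Proof.
move=> h0; rewrite /spline_cell.
have -> : y / h + n%:R - k%:R = (y - (k%:R - n%:R) * h) / h by field; rewrite gt_eqF.
set u := y - _; case: ger0P => u0 hu.
  have : 3 <= u / h by rewrite ler_pdivlMr.
  by move=> u3; rewrite !sstep_ge2 ?subrr//; lra.
have : u / h <= 0 by rewrite pmulr_lle0 ?invr_gt0// ltW.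
by move=> u3; rewrite !sstep_le0 ?subrr//; lra.
Qed.

Lemma spline_cell_sum h n y : 0 < h -> `|y| <= (n%:R - 2) * h ->
  \sum_(k < n.*2) spline_cell h n k y = 1.
Proof.
move=> h0; rewrite ler_norml => /andP[y1 y2].
have yh1 : - (n%:R - 2) <= y / h by rewrite ler_pdivlMr// mulNr.
have yh2 : y / h <= n%:R - 2 by rewrite ler_pdivrMr.
rewrite -(big_mkord xpredT (fun k => spline_cell h n k y)).
have -> : \sum_(0 <= k < n.*2) spline_cell h n k y =
    sstep (y / h + n%:R) - sstep (y / h + n%:R - (n.*2)%:R).
  elim: (n.*2) => [|m IH]; first by rewrite big_geq// subr0 subrr.
  rewrite big_nat_recr//= IH /spline_cell -(natr1 m) opprD addrA.
  by rewrite addrA subrK.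
rewrite sstep_ge2 ?sstep_le0 ?subr0// -?addnn ?natrD; lra.
Qed.

Lemma C1fun_spline_cell h n k (i : 'I_d) : C1fun (fun x => spline_cell h n k (x ord0 i)).
Proof.
have lin c : C1fun (fun x => x ord0 i / h + c).
  by eexists; exact: C1with_add (C1with_mul (C1with_coord i) (C1with_cst h^-1)) (C1with_cst c).
have st c : C1fun (fun x => sstep (x ord0 i / h + c)).
  have [dl Dl] := lin c; eexists.
  exact: C1with_comp (@is_derive_sstep R) (@continuous_dsstep R) Dl.
have [d1 D1] := st (n%:R - k%:R).
have [d2 D2] := C1fun_mul (C1fun_cst (-1)) (st (n%:R - k%:R - 1)).
have [d3 D3] := ex_intro (C1with _) _ (C1with_add D1 D2).
exists d3; congr C1with: D3; apply/funext => x.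
by rewrite /spline_cell mulN1r !addrA.
Qed.

(* Quasi-interpolation on the grid of mesh h by tensor products of quadratic splines. *)
Theorem C1_approximation f : Cc f -> exists2 r : R, 0 < r &
  vanish r f /\ forall e, 0 < e ->
    exists g, [/\ C1fun g, vanish r g & forall x, `|f x - g x| <= e].
Proof.
move=> cf; have [r0 r00 fr] := Cc_vanish cf.
(* Beyond this radius some coordinate exceeds [r0 + 4]; a cell that is nonzero there has its node at
   distance less than [3 h <= 3] in that coordinate, hence outside the support of [f]. The radius
   does not depend on [e], as [pairing_oscillation] requires. *)
pose r := d%:R * (r0 + 4) + r0 + 1.
have far (x : Rd R d) : r <= enorm x -> exists i, r0 + 4 < `|x ord0 i|.
  by move=> rx; apply: enorm_large_coord; move: rx; rewrite /r; lra.
have dr0 : 0 <= d%:R * (r0 + 4) by rewrite mulr_ge0//; lra.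
exists r; first by rewrite /r; lra.
split; first by apply: vanish_le fr; rewrite /r; lra.
move=> e e0; have [h0 h00 fu] := Cc_uniformly_continuous cf e0.
(* [f] varies by at most [e] across a cell, whose extent [3 h] is at most [h0]. *)
pose h := Num.min (h0 / 3) 1.
have h_gt0 : 0 < h by rewrite lt_min ltr01 divr_gt0.
have h1 : h <= 1 by rewrite ge_min lexx orbT.
have hh0 : 3 * h <= h0 by rewrite mulrC -ler_pdivlMr// ge_min lexx.
pose n := (Num.truncn ((r0 + 4) / h)).+3.
have nh : r0 + 4 <= (n%:R - 2) * h.
  rewrite -ler_pdivrMr// /n -(addn2 (Num.truncn _).+1) natrD addrK ltW//; exact: truncnS_gt.
pose pt (k : {ffun 'I_d -> 'I_n.*2}) : Rd R d := \row_i (((k i)%:R - n%:R) * h).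
pose cell (k : {ffun 'I_d -> 'I_n.*2}) (x : Rd R d) := \prod_(i < d) spline_cell h n (k i) (x ord0 i).
have cell_ge0 k x : 0 <= cell k x by apply: prodr_ge0 => i _; exact: spline_cell_ge0.
have cell0 k (x : Rd R d) i : 3 * h <= `|x ord0 i - pt k ord0 i| -> cell k x = 0.
  by rewrite mxE => xi; rewrite /cell (bigD1 i)//= spline_cell_eq0// mul0r.
pose g (x : Rd R d) := \sum_k f (pt k) * cell k x.
have gfar (x : Rd R d) : (exists i, r0 + 4 < `|x ord0 i|) -> g x = 0.
  move=> [i xi]; rewrite /g big1// => k _.
  have [/cell0 ->|] := leP (3 * h) `|x ord0 i - pt k ord0 i|; first by rewrite mulr0.
  move=> xp; rewrite fr ?mul0r// (le_trans _ (coord_le_enorm _ i))//.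
  have : `|x ord0 i| <= `|x ord0 i - pt k ord0 i| + `|pt k ord0 i|.
    by rewrite -{1}(subrK (pt k ord0 i) (x ord0 i)) ler_normD.
  by lra.
exists g; split.
- apply: C1fun_sum => k; apply: C1fun_mul; first exact: C1fun_cst.
  by apply: C1fun_prod => i; exact: C1fun_spline_cell.
- by move=> x /far; exact: gfar.
move=> x; have [xf|xn] := pselect (exists i, r0 + 4 < `|x ord0 i|).
  rewrite gfar// fr ?subr0 ?normr0 ?(ltW e0)//; have [i xi] := xf.
  by rewrite (le_trans _ (coord_le_enorm x i))//; lra.
have sum1 : \sum_k cell k x = 1.
  rewrite /cell -(bigA_distr_bigA (fun i (j : 'I_n.*2) => spline_cell h n j (x ord0 i))) big1// => i _.
  apply: spline_cell_sum => //; apply: le_trans nh.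
  by rewrite leNgt; apply/negP => xi; apply: xn; exists i.
have -> : f x - g x = \sum_k (f x - f (pt k)) * cell k x.
  rewrite -[in LHS](mulr1 (f x)) -sum1 mulr_sumr /g -sumrB.
  by apply: eq_bigr => k _; rewrite mulrBl.
apply: (le_trans (ler_norm_sum _ _ _)).
rewrite -[leRHS]mulr1 -sum1 mulr_sumr ler_sum// => k _.
rewrite normrM (ger0_norm (cell_ge0 k x)).
have [[i xi]|near] := pselect (exists i, 3 * h <= `|x ord0 i - pt k ord0 i|).
  by rewrite (cell0 _ _ _ xi) !mulr0.
rewrite ler_wpM2r// fu// (le_trans _ hh0)//.
rewrite [leLHS]/Num.norm/= mx_normrE; apply/bigmax_leP; split.
  by rewrite mulr_ge0// ltW.
move=> [i j] _ /=; rewrite (ord1 i) !mxE leNgt; apply/negP => xi; apply: near.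
by exists j; rewrite mxE ltW.
Qed.
End C1Functions.

(** * Bounds by the action *)

Section DensityMeasure.
Context d (T : measurableType d) (R : realType) (m : {measure set T -> \bar R}).
Variable g : T -> R.
Hypotheses (mg : measurable_fun setT g) (g0 : forall x, 0 <= g x).
Local Open Scope ereal_scope.
Import HBNNSimple.

Definition density_measure (A : set T) : \bar R := \int[m]_(x in A) (g x)%:E.

Let mgE (A : set T) : measurable_fun A (fun x => (g x)%:E).
Proof. by apply/measurable_EFinP; exact: measurable_funTS. Qed.

Let dens0 : density_measure set0 = 0.
Proof. exact: integral_set0. Qed.

Let dens_ge0 A : 0 <= density_measure A.
Proof. by apply: integral_ge0 => x _; rewrite lee_fin. Qed.

Let dens_sigma : semi_sigma_additive density_measure.
Proof. by apply: semi_sigma_additive_nng_induced. Qed.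

HB.instance Definition _ := isMeasure.Build _ T R density_measure
  dens0 dens_ge0 dens_sigma.

Let simple (k : {nnsfun T >-> R}) :
  \int[density_measure]_x (k x)%:E = \int[m]_x ((k x)%:E * (g x)%:E).
Proof.
have mI r : measurable_fun setT (fun x => \1_(k @^-1` [set r]) x * g x)%R.
  by apply: measurable_funM => //; exact: measurable_indic.
have I0 r x : (0 <= \1_(k @^-1` [set r]) x * g x)%R by rewrite mulr_ge0.
rewrite integralT_nnsfun sintegralE.
rewrite (_ : (fun x => _) = (fun x => \sum_(r \in range k)
    (r * (\1_(k @^-1` [set r]) x * g x))%:E)); last first.
  apply/funext => x; rewrite fsumEFin// -EFinM; congr EFin.
  by rewrite [in LHS]fimfunE mulr_fsuml; apply: eq_fsbigr => r _; rewrite mulrA.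
rewrite ge0_integral_fsum//; last 2 first.
- by move=> r; apply/measurable_EFinP; exact: measurable_funM.
- move=> r x _; rewrite indicE; have [|_] := boolP (x \in _); last by rewrite mul0r mulr0.
  by rewrite inE /= => <-; rewrite lee_fin mulr_ge0// mul1r.
apply: eq_fsbigr => r; rewrite inE => -[x _ <-].
under eq_integral do rewrite EFinM.
rewrite ge0_integralZl_EFin//; last 2 first.
- by move=> y _; rewrite lee_fin.
- exact/measurable_EFinP.
congr (_ * _); rewrite [LHS]integral_mkcond; apply: eq_integral => y _.
by rewrite /patch indicE; case: ifP => _; rewrite ?mul1r ?mul0r.
Qed.

Let integral_setT (f : T -> \bar R) : (forall x, 0 <= f x) -> measurable_fun setT f ->
  \int[density_measure]_x f x = \int[m]_x (f x * (g x)%:E).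
Proof.
move=> f0 mf; pose h := nnsfun_approx measurableT mf.
have hf x : (h n x)%:E @[n --> \oo] --> f x by exact: cvg_nnsfun_approx.
have nd x a b : (a <= b)%N -> (h a x)%:E <= (h b x)%:E.
  by move=> ab; rewrite lee_fin; exact/lefP/nd_nnsfun_approx.
have c1 : \int[density_measure]_x (h n x)%:E @[n --> \oo] --> \int[density_measure]_x f x.
  have -> : f = (fun x => limn (fun n => (h n x)%:E)).
    by apply/funext => x; apply/esym/cvg_lim => //; exact: hf.
  apply: cvg_monotone_convergence => // [n|n x _|x _ a b]; last exact: nd.
    exact/measurable_EFinP.
  by rewrite lee_fin.
have c2 : \int[m]_x ((h n x)%:E * (g x)%:E) @[n --> \oo] --> \int[m]_x (f x * (g x)%:E).
  have -> : (fun x => f x * (g x)%:E) = (fun x => limn (fun n => (h n x)%:E * (g x)%:E)).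
    by apply/funext => x; apply/esym/cvg_lim => //; apply: cvgeZr => //; exact: hf.
  apply: cvg_monotone_convergence => // [n|n x _|x _ a b ab].
  - by apply: emeasurable_funM; exact/measurable_EFinP.
  - by rewrite -EFinM lee_fin mulr_ge0.
  - by rewrite lee_wpmul2r ?lee_fin//; exact: nd.
rewrite (_ : (fun n => _) = (fun n => \int[m]_x ((h n x)%:E * (g x)%:E))) in c1.
  exact: (@cvg_unique _ (@ereal_hausdorff R) _ _ _ _ c1 c2).
by apply/funext => n; exact: simple.
Qed.

Lemma ge0_integral_density (f : T -> \bar R) (E : set T) :
  (forall x, 0 <= f x) -> measurable E -> measurable_fun E f ->
  \int[density_measure]_(x in E) f x = \int[m]_(x in E) (f x * (g x)%:E).
Proof.
move=> f0 mE mf; rewrite [LHS]integral_mkcond [RHS]integral_mkcond integral_setT.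
- by apply: eq_integral => x _; rewrite /patch; case: ifP => // _; rewrite mul0e.
- by move=> x; rewrite /patch; case: ifP.
- exact/(measurable_restrictT _ mE).
Qed.

(** [Phi_repr] describes [mu] and [nu] by their values on bounded Borel sets. Turning the densities
    into measures carries these relations over to integrals of test functions. *)
Lemma exists_density : exists n : {measure set T -> \bar R},
  (forall A, n A = \int[m]_(x in A) (g x)%:E) /\
  (forall (f : T -> \bar R) (E : set T),
    (forall x, 0 <= f x) -> measurable E -> measurable_fun E f ->
    \int[n]_(x in E) f x = \int[m]_(x in E) (f x * (g x)%:E)).
Proof. by exists density_measure; split => // f E; exact: ge0_integral_density. Qed.
End DensityMeasure.

Section MeasureComparison.
Context d (T : measurableType d) (R : realType).
Local Open Scope ereal_scope.

Lemma le_measure_integral_on (m1 m2 : {measure set T -> \bar R}) (D : set T)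
    (f : T -> \bar R) : measurable D ->
  (forall A, measurable A -> A `<=` D -> m1 A <= m2 A) ->
  (forall x, 0 <= f x) -> measurable_fun setT f ->
  \int[m1]_(x in D) f x <= \int[m2]_(x in D) f x.
Proof.
move=> mD m12 f0 mf.
have re (k : {measure set T -> \bar R}) :
    \int[k]_(x in D) f x = \int[mrestr k mD]_(x in D) f x.
  by apply: eq_measure_integral => A mA AD; rewrite /= /mrestr setIidl.
rewrite (re m1) (re m2); apply: ge0_le_measure_integral => // S mS.
by rewrite /= /mrestr m12//; exact: measurableI.
Qed.

Lemma integral_vanish (m : {measure set T -> \bar R}) (D : set T) (f : T -> \bar R) :
  (forall x, ~ D x -> f x = 0) -> \int[m]_x f x = \int[m]_(x in D) f x.
Proof.
move=> fD; rewrite [RHS]integral_mkcond; apply: eq_integral => x _.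
by rewrite /patch; case: ifPn => //; rewrite notin_setE => /fD.
Qed.
End MeasureComparison.

Section ActionBounds.
Context (R : realType) (d : nat) (p : R) (phi : R -> Rd R d -> R).
Hypotheses (p1 : 1 < p) (adm : admissible p phi).
Implicit Types (mu gamma : Meas R d) (nu : vmeasure R d) (f : Rd R d -> R).

Lemma measure_add_apply (a b : Meas R d) A : (measure_add a b : Meas R d) A = (a A + b A)%E.
Proof. exact: measure_addE. Qed.

Lemma ge0_integral_lebesgue_decomposition mu gamma (s : Meas R d)
    (rho rhos : RdB R d -> R) (r : R) f :
  measurable_fun setT rho -> measurable_fun setT rhos ->
  (forall x, 0 <= rho x /\ 0 <= rhos x) ->
  (forall A, measurable A -> bnd A ->
     mu A = (\int[gamma]_(x in A) (rho x)%:E + \int[s]_(x in A) (rhos x)%:E)%E) ->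
  measurable_fun setT (f : RdB R d -> R) -> (forall x, 0 <= f x) -> vanish r f ->
  (\int[mu]_x (f x)%:E =
   \int[gamma]_x (f x * rho x)%:E + \int[s]_x (f x * rhos x)%:E)%E.
Proof.
move=> mrho mrhos rho0 muE mf f0 fr.
have mB : measurable (Eball r : set (RdB R d)) by exact: measurable_Eball.
have fB (h : RdB R d -> R) x : ~ (Eball r : set (RdB R d)) x -> (f x * h x)%:E = 0%E.
  by rewrite EballE/= => /negP; rewrite -leNgt => /fr ->; rewrite mul0r.
have fB1 x : ~ (Eball r : set (RdB R d)) x -> (f x)%:E = 0%E.
  by rewrite EballE/= => /negP; rewrite -leNgt => /fr ->.
rewrite (integral_vanish _ fB1) (integral_vanish _ (fB rho)) (integral_vanish _ (fB rhos)).
have [m1 [m1E m1I]] := exists_density gamma mrho (fun x => (rho0 x).1).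
have [m2 [m2E m2I]] := exists_density s mrhos (fun x => (rho0 x).2).
have mfE : measurable_fun (Eball r) (fun x : RdB R d => (f x)%:E).
  by apply/measurable_EFinP; exact: measurable_funTS.
rewrite (@eq_measure_integral _ _ _ _ (measure_add m1 m2)); last first.
  move=> A mA AB; rewrite measure_add_apply muE ?m1E ?m2E//.
  exact: bnd_sub AB (@bnd_Eball R d r).
have f0E (x : RdB R d) : (0 <= (f x)%:E)%E by rewrite lee_fin.
by rewrite (ge0_integral_measure_add m1 m2 mB (fun x _ => f0E x) mfE)
  (m1I _ _ f0E mB mfE) (m2I _ _ f0E mB mfE).
Qed.

Lemma vmeas_abs_le nu gamma (s : Meas R d) (w ws : RdB R d -> Rd R d) i A :
  vradon nu -> measurable A -> bnd A ->
  (measurable_fun setT (fun x => w x ord0 i) /\ measurable_fun setT (fun x => ws x ord0 i)) ->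
  [/\ (\int[gamma]_(x in A) `|w x ord0 i|%:E < +oo)%E,
      (\int[s]_(x in A) `|ws x ord0 i|%:E < +oo)%E &
      vmeas nu A i = fine (\int[gamma]_(x in A) (w x ord0 i)%:E)%E
                     + fine (\int[s]_(x in A) (ws x ord0 i)%:E)%E] ->
  (`|vmeas nu A i|%:E <= \int[gamma]_(x in A) `|w x ord0 i|%:E +
     \int[s]_(x in A) `|ws x ord0 i|%:E)%E.
Proof.
move=> rnu mA bA [mw mws] [w1 ws1 ->].
have fint (m : Meas R d) (h : RdB R d -> R) : measurable_fun setT h ->
    (\int[m]_(x in A) `|h x|%:E < +oo)%E ->
    (`|fine (\int[m]_(x in A) (h x)%:E)|%:E <= \int[m]_(x in A) `|h x|%:E)%E.
  move=> mh h1.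
  have mhA : measurable_fun A (EFin \o h) by apply/measurable_EFinP; exact: measurable_funTS.
  have ih : m.-integrable A (EFin \o h) by apply/integrableP; split.
  rewrite -abse_EFin fineK ?integrable_fin_num//.
  by have := le_abse_integral m mA mhA.
apply: (@le_trans _ _ (`|fine (\int[gamma]_(x in A) (w x ord0 i)%:E)|%:E +
    `|fine (\int[s]_(x in A) (ws x ord0 i)%:E)|%:E)%E).
  by rewrite -EFinD lee_fin ler_normD.
by rewrite leeD// fint.
Qed.

(** [vpos] and [vneg] need not be the Jordan parts of [nu], so only their difference is controlled.
    Bounding each by the other plus a measure is a form that can be integrated against a nonnegative
    test function. *)
Lemma vpos_vneg_le nu gamma (s : Meas R d) (w ws : RdB R d -> Rd R d) i A :
  vradon nu -> measurable A -> bnd A ->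
  (`|vmeas nu A i|%:E <= \int[gamma]_(x in A) `|w x ord0 i|%:E +
     \int[s]_(x in A) `|ws x ord0 i|%:E)%E ->
  (vpos nu i A <= vneg nu i A + (\int[gamma]_(x in A) `|w x ord0 i|%:E +
     \int[s]_(x in A) `|ws x ord0 i|%:E))%E /\
  (vneg nu i A <= vpos nu i A + (\int[gamma]_(x in A) `|w x ord0 i|%:E +
     \int[s]_(x in A) `|ws x ord0 i|%:E))%E.
Proof.
move=> rnu mA [r Ar]; have [rp rn] := rnu i.
have fin (m : Meas R d) : radon m -> m A \is a fin_num.
  move=> rm; rewrite ge0_fin_numE// (le_lt_trans _ (rm r))// le_measure ?inE//.
  exact: measurable_Eball.
move: (fin _ rp) (fin _ rn); rewrite /vmeas.
case: (vpos nu i A) => // a _; case: (vneg nu i A) => // b _ /=.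
move: (_ + _)%E => [c| |]//=; last by move=> _; split; rewrite addey// leey.
rewrite -!EFinD !lee_fin ler_norml => /andP[h1 h2]; split; lra.
Qed.

Lemma vint_ge0_le nu gamma (s : Meas R d) (w ws : RdB R d -> Rd R d) i f :
  vradon nu ->
  (measurable_fun setT (fun x => w x ord0 i) /\ measurable_fun setT (fun x => ws x ord0 i)) ->
  (forall A, measurable A -> bnd A ->
  [/\ (\int[gamma]_(x in A) `|w x ord0 i|%:E < +oo)%E,
      (\int[s]_(x in A) `|ws x ord0 i|%:E < +oo)%E &
      vmeas nu A i = fine (\int[gamma]_(x in A) (w x ord0 i)%:E)%E
                     + fine (\int[s]_(x in A) (ws x ord0 i)%:E)%E]) ->
  Cc f -> (forall x, 0 <= f x) ->
  (`|vint nu i f|%:E <= \int[gamma]_x (f x * `|w x ord0 i|)%:E +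
     \int[s]_x (f x * `|ws x ord0 i|)%:E)%E.
Proof.
move=> rnu mw wP cf f0; have [r r0 fr] := Cc_vanish cf; have [rp rn] := rnu i.
have mB : measurable (Eball r : set (RdB R d)) by exact: measurable_Eball.
have mf := Cc_measurable cf.
have mfE : measurable_fun setT (fun x : RdB R d => (f x)%:E) by exact/measurable_EFinP.
have fB (h : RdB R d -> R) x : ~ (Eball r : set (RdB R d)) x -> (f x * h x)%:E = 0%E.
  by rewrite EballE/= => /negP; rewrite -leNgt => /fr ->; rewrite mul0r.
have fB1 x : ~ (Eball r : set (RdB R d)) x -> (f x)%:E = 0%E.
  by rewrite EballE/= => /negP; rewrite -leNgt => /fr ->.
have m1w : measurable_fun setT (fun x => `|w x ord0 i|) by apply: measurableT_comp => //; case: mw.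
have m2w : measurable_fun setT (fun x => `|ws x ord0 i|) by apply: measurableT_comp => //; case: mw.
have [m1 [m1E m1I]] := exists_density gamma m1w (fun x => normr_ge0 _).
have [m2 [m2E m2I]] := exists_density s m2w (fun x => normr_ge0 _).
have le_int (a b : Meas R d) :
    (forall A, measurable A -> bnd A -> (a A <= b A + (m1 A + m2 A))%E) ->
    (\int[a]_x (f x)%:E <= \int[b]_x (f x)%:E +
      (\int[gamma]_x (f x * `|w x ord0 i|)%:E + \int[s]_x (f x * `|ws x ord0 i|)%:E))%E.
  move=> ab; rewrite (integral_vanish a fB1) (integral_vanish b fB1).
  rewrite (integral_vanish _ (fB (fun x => `|w x ord0 i|))).
  rewrite (integral_vanish _ (fB (fun x => `|ws x ord0 i|))).
  have mfB : measurable_fun (Eball r) (fun x : RdB R d => (f x)%:E) by exact: measurable_funTS.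
  apply: (@le_trans _ _ (\int[measure_add b (measure_add m1 m2)]_(x in Eball r) (f x)%:E)%E).
    apply: le_measure_integral_on => // A mA AB.
    by rewrite !measure_add_apply; apply: ab => //; exact: bnd_sub AB (@bnd_Eball R d r).
  have f0E (x : RdB R d) : (0 <= (f x)%:E)%E by rewrite lee_fin.
  by rewrite (ge0_integral_measure_add b (measure_add m1 m2) mB (fun x _ => f0E x) mfB)
    (ge0_integral_measure_add m1 m2 mB (fun x _ => f0E x) mfB)
    (m1I _ _ f0E mB mfB) (m2I _ _ f0E mB mfB).
have nuP A : measurable A -> bnd A -> (vpos nu i A <= vneg nu i A + (m1 A + m2 A))%E /\
    (vneg nu i A <= vpos nu i A + (m1 A + m2 A))%E.
  move=> mA bA; rewrite m1E m2E.
  exact: vpos_vneg_le (vmeas_abs_le rnu mA bA mw (wP A mA bA)).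
have h1 := le_int _ _ (fun A mA bA => (nuP A mA bA).1).
have h2 := le_int _ _ (fun A mA bA => (nuP A mA bA).2).
have f1 := integrable_fin_num measurableT (Cc_integrable rp cf).
have f2 := integrable_fin_num measurableT (Cc_integrable rn cf).
move: h1 h2 f1 f2; rewrite /vint; set S := (\int[gamma]_x _ + _)%E.
case: (\int[vpos nu i]_x _)%E => // a; case: (\int[vneg nu i]_x _)%E => // b /=.
case: S => [c| |]; [|by move=> *; rewrite leey|by rewrite addeNy].
by rewrite -!EFinD !lee_fin ler_norml => h1 h2 _ _; apply/andP; split; lra.
Qed.

Lemma vintB nu i f g : vradon nu -> Cc f -> Cc g ->
  vint nu i (fun x => f x - g x) = vint nu i f - vint nu i g.
Proof.
move=> rnu cf cg; have [rp rn] := rnu i.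
have h (m : Meas R d) : radon m -> fine (\int[m]_x (f x - g x)%:E)%E =
    fine (\int[m]_x (f x)%:E)%E - fine (\int[m]_x (g x)%:E)%E.
  move=> rm; have if1 := Cc_integrable rm cf; have ig1 := Cc_integrable rm cg.
  under eq_integral do rewrite EFinB.
  by rewrite integralB_EFin// fineB// integrable_fin_num.
by rewrite /vint !h//; ring.
Qed.

(** The pointwise Young inequalities, integrated against [gamma] and [s]. The action integrands are
    not shown to be measurable, so each integral is split by [lower_integralD_le], with the mass
    term as the measurable summand. [M] is chosen before [mu] and its decomposition. *)
Lemma action_density_bound (k : nat) (r e : R) gamma : p <= k%:R -> 0 < r -> 0 < e ->
  exists2 M : R, 0 < M & forall mu (s : Meas R d) (rho rhos : RdB R d -> R)
    (w ws : RdB R d -> Rd R d) i,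
  measurable_fun setT rho -> measurable_fun setT rhos ->
  (forall x, 0 <= rho x /\ 0 <= rhos x) ->
  (forall A, measurable A -> bnd A ->
     mu A = (\int[gamma]_(x in A) (rho x)%:E + \int[s]_(x in A) (rhos x)%:E)%E) ->
  (\int[gamma]_x (cutoff r x ^+ k.-1 * `|w x ord0 i|)%:E +
     \int[s]_x (cutoff r x ^+ k.-1 * `|ws x ord0 i|)%:E <=
   M%:E * (\int[gamma]_x phi_ext phi (rho x) (w x) + \int[s]_x phi_inf phi (rhos x) (ws x)) +
   e%:E * (\int[gamma]_x (cutoff r x ^+ k)%:E + \int[mu]_x (cutoff r x ^+ k)%:E))%E.
Proof.
move=> pk r0 e0.
have [M1 M10 H1] := phi_ext_young p1 adm pk e0.
have [M2 M20 H2] := phi_inf_young p1 adm pk e0.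
have k0 : (0 < k)%N by rewrite -(@ltr_nat R); apply: lt_le_trans pk; exact: lt_trans p1.
pose M := Num.max M1 M2.
have M0 : 0 < M by rewrite lt_max M10.
have M1M : M1 <= M by rewrite le_max lexx.
have M2M : M2 <= M by rewrite le_max lexx orbT.
exists M => // mu s rho rhos w ws i mrho mrhos rho0 muE.
have cz := @Cc_cutoffX R d r k r0 k0.
have mz := Cc_measurable cz.
have [rz _ zv] := Cc_vanish cz.
have z0 (x : Rd R d) : 0 <= cutoff r x ^+ k by rewrite exprn_ge0// cutoff_ge0.
have c02 (x : Rd R d) : 0 <= cutoff r x <= 2 by rewrite cutoff_ge0 cutoff_le2.
rewrite (ge0_integral_lebesgue_decomposition mrho mrhos rho0 muE mz z0 zv).
have pe0 x : (0 <= phi_ext phi (rho x) (w x))%E by exact: (phi_ext_ge0 p1 adm).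
have pi0 x : (0 <= phi_inf phi (rhos x) (ws x))%E by apply: (phi_inf_ge0 p1 adm); case: (rho0 x).
have zr0 x : 0 <= cutoff r x ^+ k * rho x by rewrite mulr_ge0//; case: (rho0 x).
have zs0 x : 0 <= cutoff r x ^+ k * rhos x by rewrite mulr_ge0//; case: (rho0 x).
have mzr : measurable_fun setT (fun x : RdB R d => (cutoff r x ^+ k * rho x)%:E).
  by apply/measurable_EFinP; apply: measurable_funM.
have mzs : measurable_fun setT (fun x : RdB R d => (cutoff r x ^+ k * rhos x)%:E).
  by apply/measurable_EFinP; apply: measurable_funM.
have mzE : measurable_fun setT (fun x : RdB R d => (cutoff r x ^+ k)%:E) by exact/measurable_EFinP.
have h1 : (\int[gamma]_x (cutoff r x ^+ k.-1 * `|w x ord0 i|)%:E <=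
    M%:E * \int[gamma]_x phi_ext phi (rho x) (w x) +
    e%:E * (\int[gamma]_x (cutoff r x ^+ k)%:E + \int[gamma]_x (cutoff r x ^+ k * rho x)%:E))%E.
  rewrite -(@lower_integralZl _ _ _ gamma setT)//.
  rewrite -ge0_integralD//; try by move=> x _; rewrite lee_fin.
  have mD : measurable_fun setT (fun x : RdB R d => (cutoff r x ^+ k)%:E + (cutoff r x ^+ k * rho x)%:E)%E.
    exact: emeasurable_funD.
  rewrite -ge0_integralZl_EFin ?(ltW e0)//; last by move=> x _; rewrite -EFinD lee_fin addr_ge0.
  apply: (le_trans _ (@lower_integralD_le _ _ _ gamma setT (fun x => M%:E * phi_ext phi (rho x) (w x))%E
    (fun x : RdB R d => e%:E * ((cutoff r x ^+ k)%:E + (cutoff r x ^+ k * rho x)%:E))%E _ _ _ _)) => //.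
  - apply: le_lower_integral => x _.
      by rewrite lee_fin mulr_ge0// exprn_ge0// cutoff_ge0.
    apply: (@le_trans _ _ (`|w x| * cutoff r x ^+ k.-1)%:E).
      by rewrite lee_fin mulrC ler_wpM2r ?coord_le_norm// exprn_ge0// cutoff_ge0.
    apply: (le_trans (H1 (rho x) (w x) (cutoff r x) (rho0 x).1 (c02 x))).
    apply: leeD; first by rewrite lee_wpmul2r// lee_fin.
    by rewrite -EFinD -EFinM lee_fin mulrDr mulrDr mulr1 mulrA lexx.
  - by move=> x _; rewrite mule_ge0// lee_fin ltW.
  - by move=> x _; rewrite -EFinD -EFinM lee_fin mulr_ge0 ?addr_ge0// ltW.
  - by apply: measurable_funeM.
have h2 : (\int[s]_x (cutoff r x ^+ k.-1 * `|ws x ord0 i|)%:E <=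
    M%:E * \int[s]_x phi_inf phi (rhos x) (ws x) +
    e%:E * \int[s]_x (cutoff r x ^+ k * rhos x)%:E)%E.
  rewrite -(@lower_integralZl _ _ _ s setT)//.
  rewrite -ge0_integralZl_EFin ?(ltW e0)//; last by move=> x _; rewrite lee_fin.
  apply: (le_trans _ (@lower_integralD_le _ _ _ s setT (fun x => M%:E * phi_inf phi (rhos x) (ws x))%E
    (fun x : RdB R d => e%:E * (cutoff r x ^+ k * rhos x)%:E)%E _ _ _ _)) => //.
  - apply: le_lower_integral => x _.
      by rewrite lee_fin mulr_ge0// exprn_ge0// cutoff_ge0.
    apply: (@le_trans _ _ (`|ws x| * cutoff r x ^+ k.-1)%:E).
      by rewrite lee_fin mulrC ler_wpM2r ?coord_le_norm// exprn_ge0// cutoff_ge0.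
    apply: (le_trans (H2 (rhos x) (ws x) (cutoff r x) (rho0 x).2 (c02 x))).
    apply: leeD; first by rewrite lee_wpmul2r// lee_fin.
    by rewrite -EFinM mulrA.
  - by move=> x _; rewrite mule_ge0// lee_fin ltW.
  - by move=> x _; rewrite -EFinM lee_fin mulr_ge0// ltW.
  - by apply: measurable_funeM.
apply: (le_trans (leeD h1 h2)).
have A0 : (0 <= \int[gamma]_x phi_ext phi (rho x) (w x))%E by apply: integral_ge0.
have B0 : (0 <= \int[s]_x phi_inf phi (rhos x) (ws x))%E by apply: integral_ge0.
have C0 : (0 <= \int[gamma]_x (cutoff r x ^+ k)%:E)%E.
  by apply: integral_ge0 => x _; rewrite lee_fin.
have D0 : (0 <= \int[gamma]_x (cutoff r x ^+ k * rho x)%:E)%E.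
  by apply: integral_ge0 => x _; rewrite lee_fin.
have E0 : (0 <= \int[s]_x (cutoff r x ^+ k * rhos x)%:E)%E.
  by apply: integral_ge0 => x _; rewrite lee_fin.
rewrite (ge0_muleDr _ A0 B0) (ge0_muleDr _ C0 D0) (ge0_muleDr _ C0 (adde_ge0 D0 E0)).
by rewrite (ge0_muleDr _ D0 E0) addeACA [X in (_ <= _ + X)%E]addeA.
Qed.
End ActionBounds.

Section ErealAux.
Context (R : realType).
Local Open Scope ereal_scope.

(** Passes a bound that holds for every decomposition on to [Phi], an infimum over
    decompositions. *)
Lemma le_affine_ereal_inf (S : set (\bar R)) (M : R) (D X : \bar R) :
  (0 < M)%R -> D \is a fin_num -> (forall v, S v -> X <= M%:E * v + D) ->
  X <= M%:E * ereal_inf S + D.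
Proof.
move=> M0 fD H; rewrite -leeBlDr// -lee_pdivrMl//.
apply: le_ereal_inf_tmp => v Sv; rewrite lee_pdivrMl// leeBlDr//; exact: H.
Qed.

Lemma fine_mul_pos (c : R) (x : \bar R) : (0 < c)%R -> fine (c%:E * x) = (c * fine x)%R.
Proof.
move=> c0; have c0' : 0 < c%:E by rewrite lte_fin.
by case: x => [x| |]; rewrite ?gt0_muley ?gt0_muleNy//= mulr0.
Qed.

Lemma mule_sub_pos (c : R) (x y : \bar R) : (0 < c)%R ->
  c%:E * x - c%:E * y = c%:E * (x - y).
Proof.
move=> c0; have c0' : 0 < c%:E by rewrite lte_fin.
case: x y => [x| |] [y| |]; rewrite ?gt0_muley ?gt0_muleNy//= ?gt0_muley ?gt0_muleNy//=.
by rewrite -EFinM -!EFinD -EFinM mulrBr.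
Qed.

Lemma integral_mscale_pos d (T : measurableType d) (m : {measure set T -> \bar R})
    (c : {nonneg R}) (D : set T) (f : T -> \bar R) :
  (0 < c%:num)%R -> measurable D -> measurable_fun D f ->
  \int[mscale c m]_(x in D) f x = (c%:num)%:E * \int[m]_(x in D) f x.
Proof.
move=> c0 mD mf; rewrite (integralE m D f) [LHS]integralE -mule_sub_pos//.
by rewrite !ge0_integral_mscale//; [exact: measurable_funeneg|exact: measurable_funepos].
Qed.

Lemma sume_const (n : nat) (x : \bar R) : 0 <= x -> \sum_(i < n) x = n%:R%:E * x.
Proof.
move=> x0; elim: n => [|n ih]; first by rewrite big_ord0 mul0e.
by rewrite big_ord_recr/= ih -natr1 EFinD ge0_muleDl ?lee_fin// mul1e.
Qed.
End ErealAux.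

(** * Scaling of vector measures and homogeneity of the action *)

Section VectorMeasureOperations.
Context (R : realType) (d : nat).
Implicit Types (nu : vmeasure R d) (mu : Meas R d).

(** A negative factor exchanges the two parts, which have to stay nonnegative; [c = -1] occurs when
    a curve is reversed in time. *)
Definition vscale (c : R) nu : vmeasure R d :=
  let k : {nonneg R} := NngNum (normr_ge0 c) in
  if 0 < c then VMeasure (fun i => mscale k (vpos nu i) : Meas R d)
                         (fun i => mscale k (vneg nu i) : Meas R d)
  else VMeasure (fun i => mscale k (vneg nu i) : Meas R d)
                (fun i => mscale k (vpos nu i) : Meas R d).

Definition vzero : vmeasure R d :=
  VMeasure (fun _ => mzero : Meas R d) (fun _ => mzero : Meas R d).

Lemma radon_mscale (k : {nonneg R}) mu : radon mu -> radon (mscale k mu : Meas R d).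
Proof. by move=> rmu r; rewrite /= /mscale lte_mul_pinfty ?lee_fin. Qed.

Lemma vradon_vscale c nu : vradon nu -> vradon (vscale c nu).
Proof.
by move=> rnu i; have [rp rn] := rnu i; rewrite /vscale; case: ifP => _ /=;
  split; exact: radon_mscale.
Qed.

Lemma vradon_vzero : vradon vzero.
Proof. by move=> i; split => r; rewrite /= /mzero ltry. Qed.

Lemma vmeas_vscale c nu A i : c != 0 -> vmeas (vscale c nu) A i = c * vmeas nu A i.
Proof.
move=> c0; have nc0 : 0 < `|c| by rewrite normr_gt0.
rewrite /vmeas /vscale; case: ltP => cp /=; rewrite /mscale/= !fine_mul_pos// -mulrBr.
  by rewrite gtr0_norm.
by rewrite ler0_norm// mulNr -mulrN opprB.
Qed.

Lemma vint_vscale c nu i f : c != 0 -> measurable_fun setT (f : RdB R d -> R) ->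
  vint (vscale c nu) i f = c * vint nu i f.
Proof.
move=> c0 mf; have nc0 : 0 < `|c| by rewrite normr_gt0.
have mfE : measurable_fun setT (fun x : RdB R d => (f x)%:E) by exact/measurable_EFinP.
rewrite /vint /vscale; case: ltP => cp /=; rewrite !integral_mscale_pos//= !fine_mul_pos// -mulrBr.
  by rewrite gtr0_norm.
by rewrite ler0_norm// mulNr -mulrN opprB.
Qed.

Lemma vsupp_vscale c nu : c != 0 -> vsupp (vscale c nu) `<=` vsupp nu.
Proof.
move=> c0 x sx r r0; have := sx r r0; apply: contraTT; rewrite -!leNgt => tv0.
apply: ge_ereal_sup => _ [F [mF tF UF ->]].
have : (\sum_(0 <= k <oo) (enorm (\row_i vmeas nu (F k) i))%:E <= 0)%E.
  by apply: le_trans tv0; apply: ereal_sup_ubound; exists F.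
have en k : enorm (\row_i vmeas (vscale c nu) (F k) i) = `|c| * enorm (\row_i vmeas nu (F k) i).
  rewrite !enormE (_ : sqn (\row_i vmeas (vscale c nu) (F k) i) =
     c ^+ 2 * sqn (\row_i vmeas nu (F k) i)).
    by rewrite sqrtrM ?sqr_ge0// sqrtr_sqr.
  rewrite /sqn mulr_sumr; apply: eq_bigr => i _.
  by rewrite !mxE vmeas_vscale// exprMn.
move=> s0; under eq_eseriesr do rewrite en EFinM.
rewrite nneseriesZl//; last by move=> k _; rewrite lee_fin enorm_ge0.
by rewrite mule_ge0_le0.
Qed.

Lemma meq_integral mu eta (f : RdB R d -> \bar R) : meq mu eta ->
  (\int[mu]_x f x = \int[eta]_x f x)%E.
Proof. by move=> me; apply: eq_measure_integral => A mA _; exact: me. Qed.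

Lemma meq_sym mu eta : meq mu eta -> meq eta mu.
Proof. by move=> me A mA; rewrite me. Qed.

Lemma meq_trans mu eta xi : meq mu eta -> meq eta xi -> meq mu xi.
Proof. by move=> me ex A mA; rewrite me// ex. Qed.

Lemma meq_refl mu : meq mu mu. Proof. by []. Qed.

Lemma meq_radon mu eta : meq mu eta -> radon mu -> radon eta.
Proof. by move=> me rmu r; rewrite -me//; exact: measurable_Eball. Qed.

Lemma meq_supp mu eta : meq mu eta -> supp mu = supp eta.
Proof.
move=> me; apply/seteqP; split => x sx r r0; have := sx r r0;
  by rewrite me//; exact: measurable_Eball_at.
Qed.
End VectorMeasureOperations.

Section ActionFunctional.
Context (R : realType) (d : nat) (p : R) (phi : R -> Rd R d -> R).
Hypotheses (p1 : 1 < p) (adm : admissible p phi).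
Implicit Types (mu gamma : Meas R d) (nu : vmeasure R d) (f : Rd R d -> R).

Lemma Phi_repr_ge0 gamma mu nu v : Phi_repr phi gamma mu nu v -> (0 <= v)%E.
Proof.
move=> [rho [w [s [rhos [ws [[_ _ _ rho0] _ _ _ ->]]]]]].
by apply: adde_ge0; apply: integral_ge0 => x _;
  [exact: (phi_ext_ge0 p1 adm)|apply: (phi_inf_ge0 p1 adm); case: (rho0 x)].
Qed.

Lemma Phi_ge0 gamma mu nu : (0 <= Phi phi gamma mu nu)%E.
Proof. by apply: le_ereal_inf_tmp => v [_ _ /Phi_repr_ge0]. Qed.

(** A decomposition for [(eta, nu)] becomes one for [(mu, c nu)] when both flux densities are
    multiplied by [c], and both integrands are homogeneous of degree [p]. *)
Lemma Phi_vscale_le gamma mu eta nu (c : R) : c != 0 -> meq mu eta ->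
  (Phi phi gamma mu (vscale c nu) <= (powR `|c| p)%:E * Phi phi gamma eta nu)%E.
Proof.
move=> c0 me.
have cp0 : 0 < powR `|c| p by rewrite powR_gt0// normr_gt0.
rewrite -[leRHS]adde0; apply: le_affine_ereal_inf => // v [se snu hv].
rewrite adde0; apply: ge_ereal_inf; exists ((powR `|c| p)%:E * v)%E => //; split.
- by rewrite (meq_supp me).
- by apply: subset_trans snu; exact: vsupp_vscale.
case: hv => rho [w [s [rhos [ws [[mrho mrhos mw rho0] sP muE nuE ->]]]]].
exists rho, (fun x => c *: w x), s, rhos, (fun x => c *: ws x); split.
- split => // i; have [mwi mwsi] := mw i.
  have eqZ (h : RdB R d -> Rd R d) : (fun x => (c *: h x) ord0 i) = (fun x => c * h x ord0 i).
    by apply/funext => x; rewrite mxE.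
  by rewrite !eqZ; split; exact: measurable_funM.
- exact: sP.
- by move=> A mA bA; rewrite me// muE.
- move=> A i mA bA; have [h1 h2 h3] := nuE A i mA bA.
  have [mwi mwsi] := mw i.
  have nZ (m : Meas R d) (h : RdB R d -> Rd R d) : measurable_fun setT (fun x => h x ord0 i) ->
      (\int[m]_(x in A) `|(c *: h x) ord0 i|%:E = `|c|%:E * \int[m]_(x in A) `|h x ord0 i|%:E)%E.
    move=> mh; under eq_integral do rewrite mxE normrM EFinM.
    rewrite ge0_integralZl_EFin//; apply/measurable_EFinP; apply: measurableT_comp => //.
    exact: measurable_funTS.
  have iZ (m : Meas R d) (h : RdB R d -> Rd R d) : measurable_fun setT (fun x => h x ord0 i) ->
      (\int[m]_(x in A) `|h x ord0 i|%:E < +oo)%E ->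
      fine (\int[m]_(x in A) ((c *: h x) ord0 i)%:E)%E =
        c * fine (\int[m]_(x in A) (h x ord0 i)%:E)%E.
    move=> mh hoo; have ih : m.-integrable A (fun x => (h x ord0 i)%:E).
      by apply/integrableP; split => //; apply/measurable_EFinP; exact: measurable_funTS.
    under eq_integral do rewrite mxE EFinM.
    by rewrite integralZl// fineM// integrable_fin_num.
  rewrite !nZ// !iZ// vmeas_vscale// h3 mulrDr; split => //; by rewrite lte_mul_pinfty ?lee_fin.
- have -> : (\int[gamma]_x phi_ext phi (rho x) (c *: w x) =
      (powR `|c| p)%:E * \int[gamma]_x phi_ext phi (rho x) (w x))%E.
    rewrite -lower_integralZl//; last by move=> x _; exact: (phi_ext_ge0 p1 adm).
    by apply: eq_integral => x _; exact: (phi_extZ p1 adm).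
  have -> : (\int[s]_x phi_inf phi (rhos x) (c *: ws x) =
      (powR `|c| p)%:E * \int[s]_x phi_inf phi (rhos x) (ws x))%E.
    rewrite -lower_integralZl//; last by move=> x _; apply: (phi_inf_ge0 p1 adm); case: (rho0 x).
    by apply: eq_integral => x _; apply: (phi_infZ p1 adm) => //; case: (rho0 x).
  rewrite ge0_muleDr//; apply: integral_ge0 => x _;
    [exact: (phi_ext_ge0 p1 adm)|by apply: (phi_inf_ge0 p1 adm); case: (rho0 x)].
Qed.

Lemma Cc_integral_fin_num mu f : radon mu -> Cc f -> (\int[mu]_x (f x)%:E)%E \is a fin_num.
Proof. by move=> rmu cf; apply: integrable_fin_num => //; exact: Cc_integrable. Qed.

Lemma Phi_vint_bound (k : nat) (r e C : R) gamma : p <= k%:R -> 0 < r -> 0 < e -> 0 < C ->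
  radon gamma ->
  exists2 M : R, 0 < M & forall mu nu (g : 'I_d -> Rd R d -> R), radon mu -> vradon nu ->
  (forall i, Cc (g i)) -> (forall i x, `|g i x| <= C * cutoff r x ^+ k.-1) ->
  (`|\sum_(i < d) vint nu i (g i)|%:E <= M%:E * Phi phi gamma mu nu +
   e%:E * (\int[gamma]_x (cutoff r x ^+ k)%:E + \int[mu]_x (cutoff r x ^+ k)%:E))%E.
Proof.
move=> pk r0 e0 C0 rg.
(* [C] is the domination constant of the test, 2 accounts for its positive and negative parts, and
   [d + 1] for the coordinates, being nonzero also for [d = 0]. *)
pose c := C * 2 * d.+1%:R; have c0 : 0 < c by rewrite !mulr_gt0.
have ec0 : 0 < e / c by rewrite divr_gt0.
have [M M0 H] := action_density_bound p1 adm gamma pk r0 ec0.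
exists (c * M) => [|mu nu g rmu rnu cg gC]; first by rewrite mulr_gt0.
have k1 : (1 < k)%N by rewrite -(@ltr_nat R); exact: lt_le_trans pk.
have k0 : (0 < k)%N by exact: ltnW.
have k'0 : (0 < k.-1)%N by rewrite -subn1 subn_gt0.
have cz := @Cc_cutoffX R d r k r0 k0.
have z0 n (x : Rd R d) : 0 <= cutoff r x ^+ n by rewrite exprn_ge0// cutoff_ge0.
set D := (\int[gamma]_x _ + \int[mu]_x _)%E.
have D0 : (0 <= D)%E.
  by apply: adde_ge0; apply: integral_ge0 => x _; rewrite lee_fin.
have fD : D \is a fin_num by rewrite fin_numD !Cc_integral_fin_num.
apply: le_affine_ereal_inf; [by rewrite mulr_gt0|by rewrite fin_numM|].
move=> v [_ _ hv]; have v0 := Phi_repr_ge0 hv.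
case: hv => rho [w [s [rhos [ws [[mrho mrhos mw rho0] sP muE nuE vE]]]]].
set Q := (M%:E * v + (e / c)%:E * D)%E.
have Q0 : (0 <= Q)%E by rewrite adde_ge0 ?mule_ge0 ?lee_fin ?(ltW M0) ?(ltW ec0).
have Hi i : (\int[gamma]_x (cutoff r x ^+ k.-1 * `|w x ord0 i|)%:E +
     \int[s]_x (cutoff r x ^+ k.-1 * `|ws x ord0 i|)%:E <= Q)%E.
  by rewrite /Q vE; exact: H.
have ck1 := @Cc_cutoffX R d r k.-1 r0 k'0.
have pos i f : Cc f -> (forall x, 0 <= f x <= C * cutoff r x ^+ k.-1) ->
    (`|vint nu i f|%:E <= C%:E * Q)%E.
  move=> cf fC; have f0 x : 0 <= f x by case/andP: (fC x).
  apply: (le_trans (vint_ge0_le rnu (mw i) (fun A mA bA => nuE A i mA bA) cf f0)).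
  apply: (@le_trans _ _ (C%:E * (\int[gamma]_x (cutoff r x ^+ k.-1 * `|w x ord0 i|)%:E +
     \int[s]_x (cutoff r x ^+ k.-1 * `|ws x ord0 i|)%:E))%E); last first.
    by rewrite lee_wpmul2l// lee_fin ltW.
  have bd (m : Meas R d) (h : RdB R d -> R) : (forall x, 0 <= h x) ->
      (\int[m]_x (f x * h x)%:E <= C%:E * \int[m]_x (cutoff r x ^+ k.-1 * h x)%:E)%E.
    move=> h0; rewrite -lower_integralZl//; last by move=> x _; rewrite lee_fin mulr_ge0.
    apply: le_lower_integral => x _; first by rewrite lee_fin mulr_ge0.
    by rewrite -EFinM lee_fin mulrA ler_wpM2r//; case/andP: (fC x).
  rewrite ge0_muleDr; last 2 first.
  - by apply: integral_ge0 => x _; rewrite lee_fin mulr_ge0.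
  - by apply: integral_ge0 => x _; rewrite lee_fin mulr_ge0.
  by apply: leeD; apply: bd.
have all i : (`|vint nu i (g i)|%:E <= (C * 2)%:E * Q)%E.
  have [cgi' _] := cg i; have [rr _ gv] := Cc_vanish (cg i).
  pose fp x := Num.max (g i x) 0; pose fn x := Num.max (- g i x) 0.
  have cfp : Cc fp.
    apply: (@vanish_Cc _ _ rr) => [x|x /gv fx]; last by rewrite /fp fx max_l.
    by apply: (@continuous_max _ _ (g i) (fun=> 0)); [exact: cgi'|exact: cst_continuous].
  have cfn : Cc fn.
    apply: (@vanish_Cc _ _ rr) => [x|x /gv fx]; last by rewrite /fn fx oppr0 max_l.
    apply: (@continuous_max _ _ (fun x => - g i x) (fun=> 0)); last exact: cst_continuous.
    by apply: continuousN; exact: cgi'.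
  have -> : g i = fun x => fp x - fn x.
    by apply/funext => x; exact: max0_decomposition.
  rewrite vintB//; apply: (@le_trans _ _ (`|vint nu i fp|%:E + `|vint nu i fn|%:E)%E).
    by rewrite -EFinD lee_fin ler_normB.
  have cb (x : Rd R d) : 0 <= C * cutoff r x ^+ k.-1 by rewrite mulr_ge0 ?(ltW C0).
  have -> : ((C * 2)%:E * Q = C%:E * Q + C%:E * Q)%E.
    rewrite (_ : C * 2 = C + C); last by ring.
    by rewrite EFinD ge0_muleDl// lee_fin ltW.
  apply: leeD; apply: pos => // x; rewrite le_max lexx orbT/= ge_max cb andbT.
    by rewrite (le_trans (ler_norm _)).
  by rewrite (le_trans (ler_norm _))// normrN.
apply: (@le_trans _ _ (\sum_(i < d) (C * 2)%:E * Q)%E).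
  apply: (@le_trans _ _ (\sum_(i < d) `|vint nu i (g i)|)%:E).
    by rewrite lee_fin ler_norm_sum.
  by rewrite -sumEFin; apply: lee_sum => i _; exact: all.
rewrite sume_const ?mule_ge0 ?lee_fin ?mulr_ge0 ?(ltW C0)//.
apply: (@le_trans _ _ (c%:E * Q)%E).
  rewrite /c EFinM muleCA muleA -EFinM lee_wpmul2r// lee_fin.
  by rewrite ler_wpM2l ?ler_nat// mulr_ge0// ltW.
rewrite /Q ge0_muleDr ?mule_ge0 ?lee_fin ?(ltW M0) ?(ltW ec0)//.
by rewrite !muleA -!EFinM (_ : c * (e / c) = e)//; field; rewrite gt_eqF.
Qed.

(** This recovers from a finite action the time-integrability of the total variation that [CE]
    demands. *)
Lemma Phi_tv_bound (k : nat) (r : R) gamma : p <= k%:R -> 0 < r -> radon gamma ->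
  exists2 M : R, 0 < M & forall mu nu, radon mu -> vradon nu ->
  (tv nu (Eball r) <= M%:E * Phi phi gamma mu nu +
   (\int[gamma]_x (cutoff r x ^+ k)%:E + \int[mu]_x (cutoff r x ^+ k)%:E))%E.
Proof.
move=> pk r0 rg.
have dd0 : 0 < d.+1%:R :> R by [].
(* With this weight the [d] coordinates together produce the mass term with coefficient at most
   1. *)
have e0 : 0 < (d.+1%:R : R)^-1 by rewrite invr_gt0.
have [M M0 H] := action_density_bound p1 adm gamma pk r0 e0.
exists (d.+1%:R * M) => [|mu nu rmu rnu]; first by rewrite mulr_gt0.
have k0 : (0 < k)%N by rewrite -(@ltr_nat R); apply: lt_le_trans pk; exact: lt_trans p1.
have cz := @Cc_cutoffX R d r k r0 k0.
have z0 n (x : Rd R d) : 0 <= cutoff r x ^+ n by rewrite exprn_ge0// cutoff_ge0.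
set D := (\int[gamma]_x _ + \int[mu]_x _)%E.
have D0 : (0 <= D)%E.
  by apply: adde_ge0; apply: integral_ge0 => x _; rewrite lee_fin.
have fD : D \is a fin_num by rewrite fin_numD !Cc_integral_fin_num.
apply: le_affine_ereal_inf; [by rewrite mulr_gt0|by []|].
move=> v [_ _ hv]; have v0 := Phi_repr_ge0 hv.
case: hv => rho [w [s [rhos [ws [[mrho mrhos mw rho0] sP muE nuE vE]]]]].
set Q := (M%:E * v + (d.+1%:R^-1)%:E * D)%E.
have Q0 : (0 <= Q)%E by rewrite adde_ge0 ?mule_ge0 ?lee_fin ?(ltW M0) ?(ltW e0).
have Hi i : (\int[gamma]_x (cutoff r x ^+ k.-1 * `|w x ord0 i|)%:E +
     \int[s]_x (cutoff r x ^+ k.-1 * `|ws x ord0 i|)%:E <= Q)%E.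
  by rewrite /Q vE; exact: H.
have mB : measurable (Eball r : set (RdB R d)) by exact: measurable_Eball.
have mn (i : 'I_d) : measurable_fun setT (fun x => `|w x ord0 i|) /\
    measurable_fun setT (fun x => `|ws x ord0 i|).
  by split; apply: measurableT_comp => //; case: (mw i).
pose I (i : 'I_d) (A : set (RdB R d)) := (\int[gamma]_(x in A) `|w x ord0 i|%:E +
    \int[s]_(x in A) `|ws x ord0 i|%:E)%E.
have IQ i : (I i (Eball r) <= Q)%E.
  apply: le_trans (Hi i).
  have bd (m : Meas R d) (h : RdB R d -> R) : (forall x, 0 <= h x) ->
      (\int[m]_(x in Eball r) (h x)%:E <= \int[m]_x (cutoff r x ^+ k.-1 * h x)%:E)%E.
    move=> h0; rewrite [leLHS]integral_mkcond; apply: le_lower_integral => x _.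
      by rewrite /patch; case: ifP; rewrite lee_fin.
    rewrite /patch; case: ifPn => xB; last by rewrite lee_fin mulr_ge0.
    move: xB; rewrite inE EballE/= => xr; rewrite lee_fin ler_peMl// exprn_ege1//.
    by apply: cutoff_ge1 => //; exact: ltW.
  by apply: leeD; apply: bd.
apply: ge_ereal_sup => _ [F [mF tF UF ->]].
have FB k' : F k' `<=` Eball r by rewrite -UF; exact: bigcup_sup.
apply: (@le_trans _ _ (\sum_(0 <= k' <oo) \sum_(i < d) I i (F k'))%E).
  apply: lee_nneseries => [k' _ _|k' _]; first by rewrite lee_fin enorm_ge0.
  apply: (@le_trans _ _ (\sum_(i < d) `|vmeas nu (F k') i|)%:E).
    rewrite lee_fin; apply: (le_trans (enorm_le_sum _)).
    by apply: ler_sum => i _; rewrite mxE.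
  rewrite -sumEFin; apply: lee_sum => i _.
  have bF : bnd (F k') by exact: bnd_sub (FB k') (@bnd_Eball R d r).
  exact: vmeas_abs_le rnu (mF k') bF (mw i) (nuE _ i (mF k') bF).
have I0 i A : (0 <= I i A)%E by apply: adde_ge0; apply: integral_ge0 => x _; rewrite lee_fin.
rewrite nneseries_sum; last by move=> i k' _; exact: I0.
apply: (@le_trans _ _ (\sum_(i < d) Q)%E).
  apply: lee_sum => i _; apply: le_trans (IQ i).
  rewrite /I nneseriesD; last 2 first.
  - by move=> k' _ _; apply: integral_ge0 => x _; rewrite lee_fin.
  - by move=> k' _ _; apply: integral_ge0 => x _; rewrite lee_fin.
  rewrite -!ge0_integral_bigcup// ?UF//; try by move=> x _; rewrite lee_fin.
  - by apply/measurable_EFinP; apply: measurable_funTS; case: (mn i).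
  - by apply/measurable_EFinP; apply: measurable_funTS; case: (mn i).
rewrite sume_const//.
apply: (@le_trans _ _ (d.+1%:R%:E * Q)%E).
  by rewrite lee_wpmul2r// lee_fin ler_nat.
rewrite /Q ge0_muleDr ?mule_ge0 ?lee_fin ?(ltW M0) ?(ltW e0)//.
by rewrite !muleA -!EFinM divff// mul1e.
Qed.
End ActionFunctional.

Section DominatedConvergence.
Context d (T : measurableType d) (R : realType) (mu : {measure set T -> \bar R}).

Lemma dominated_cvg_EFin (D : set T) (f_ : nat -> T -> R) (f : T -> R) (g : T -> \bar R) :
  measurable D ->
  (forall n, measurable_fun D (f_ n)) -> (forall x, D x -> f_ n x @[n --> \oo] --> f x) ->
  mu.-integrable D g -> (forall n x, D x -> (`|f_ n x|%:E <= g x)%E) ->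
  mu.-integrable D (fun x => (f x)%:E) /\
  (\int[mu]_(x in D) (f_ n x)%:E @[n --> \oo] --> \int[mu]_(x in D) (f x)%:E)%E.
Proof.
move=> mD mf_ ff ig fg.
have mf : measurable_fun D f by exact: measurable_fun_cvg ff.
have := @dominated_convergence _ T R mu D mD (fun n x => (f_ n x)%:E) (fun x => (f x)%:E) g.
case=> [n|||||//]; [exact/measurable_EFinP|exact/measurable_EFinP| | |].
- by apply: aeW => x /= Dx; apply: cvg_EFin; [exact: nearW|exact: ff].
- exact: ig.
- by apply: aeW => x n /= Dx; exact: fg.
Qed.

Lemma dominated_cvg_fine (D : set T) (f_ : nat -> T -> R) (f : T -> R) (g : T -> \bar R) :
  measurable D ->
  (forall n, measurable_fun D (f_ n)) -> (forall x, D x -> f_ n x @[n --> \oo] --> f x) ->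
  mu.-integrable D g -> (forall n x, D x -> (`|f_ n x|%:E <= g x)%E) ->
  fine (\int[mu]_(x in D) (f_ n x)%:E)%E @[n --> \oo] -->
  fine (\int[mu]_(x in D) (f x)%:E)%E.
Proof.
move=> mD mf_ ff ig fg; have [fi cf] := dominated_cvg_EFin mD mf_ ff ig fg.
by apply: fine_cvg; rewrite fineK//; exact: integrable_fin_num.
Qed.
End DominatedConvergence.

(** * Pairings of measures and fluxes with test functions *)

Section Pairing.
Context (R : realType) (d : nat).
Implicit Types (mu gamma : Meas R d) (nu : vmeasure R d) (f g : Rd R d -> R) (w : 'I_d -> Rd R d -> R).

Definition pairing mu f : R := fine (\int[mu]_x (f x)%:E)%E.
Definition flux nu w : R := \sum_(i < d) vint nu i (w i).

Lemma pairingE mu f : radon mu -> Cc f -> (\int[mu]_x (f x)%:E)%E = (pairing mu f)%:E.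
Proof. by move=> rmu cf; rewrite fineK// Cc_integral_fin_num. Qed.

Lemma pairing_le mu f g : radon mu -> Cc f -> Cc g -> (forall x, f x <= g x) ->
  pairing mu f <= pairing mu g.
Proof.
move=> rmu cf cg fg; rewrite -lee_fin -!pairingE//.
by apply: le_integral => //; [exact: Cc_integrable|exact: Cc_integrable|move=> x _; rewrite lee_fin].
Qed.

Lemma pairing_ge0 mu f : (forall x, 0 <= f x) -> 0 <= pairing mu f.
Proof. by move=> f0; apply: fine_ge0; apply: integral_ge0 => x _; rewrite lee_fin. Qed.

Lemma pairingD mu f g : radon mu -> Cc f -> Cc g ->
  pairing mu (fun x => f x + g x) = pairing mu f + pairing mu g.
Proof.
move=> rmu cf cg; apply: EFin_inj; rewrite EFinD -!pairingE//; last exact: CcD.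
by rewrite -integralD//; exact: Cc_integrable.
Qed.

Lemma pairingZ mu c f : radon mu -> Cc f ->
  pairing mu (fun x => c * f x) = c * pairing mu f.
Proof.
move=> rmu cf; apply: EFin_inj; rewrite EFinM -!pairingE//; last exact: CcZ.
by rewrite -integralZl//; exact: Cc_integrable.
Qed.

Lemma pairingB mu f g : radon mu -> Cc f -> Cc g ->
  pairing mu (fun x => f x - g x) = pairing mu f - pairing mu g.
Proof.
move=> rmu cf cg; rewrite -(mulN1r (pairing _ g)) -pairingZ// -pairingD//; last exact: CcZ.
by congr pairing; apply/funext => x; rewrite mulN1r.
Qed.

Lemma norm_pairing_le mu f g : radon mu -> Cc f -> Cc g -> (forall x, `|f x| <= g x) ->
  `|pairing mu f| <= pairing mu g.
Proof.
move=> rmu cf cg fg; rewrite ler_norml; apply/andP; split.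
  rewrite -mulN1r -pairingZ//; apply: pairing_le => // [|x]; first exact: CcZ.
  by rewrite mulN1r; have := fg x; rewrite ler_norml => /andP[].
by apply: pairing_le => // x; exact: le_trans (ler_norm _) (fg x).
Qed.

Lemma pairing_cvg mu (f_ : nat -> Rd R d -> R) f (r C : R) : radon mu ->
  (forall n, Cc (f_ n)) -> (forall n, vanish r (f_ n)) ->
  (forall n x, `|f_ n x| <= C) -> (forall x, f_ n x @[n --> \oo] --> f x) ->
  pairing mu (f_ n) @[n --> \oo] --> pairing mu f.
Proof.
move=> rmu cf_ v_ b_ ff.
have C0 : 0 <= C := le_trans (normr_ge0 _) (b_ 0%N 0).
have mB : measurable (Eball r : set (RdB R d)) by exact: measurable_Eball.
have mh : measurable_fun setT (fun x : RdB R d => C * \1_(Eball r) x).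
  by apply: measurable_funM => //; exact: measurable_indic.
have ih : mu.-integrable setT (fun x : RdB R d => (C * \1_(Eball r) x)%:E).
  apply: (@vanish_integrable _ _ mu r C (fun x => C * \1_(Eball r) x) rmu mh) => x.
    move=> rx; rewrite indicE (_ : x \in _ = false) ?mulr0//.
    by apply/negbTE/negP; rewrite inE EballE/= ltNge rx.
  by rewrite ger0_norm ?mulr_ge0// ler_piMr// indicE; case: (_ \in _).
apply: (dominated_cvg_fine measurableT _ _ ih) => [n|x _|n x _].
- exact: Cc_measurable.
- exact: ff.
- rewrite lee_fin indicE; have [xB|xB] := boolP (x \in _); first by rewrite mulr1.
  rewrite mulr0 v_ ?normr0// leNgt; apply: contra xB => xr.
  by rewrite inE EballE.
Qed.

Lemma vint_cvg nu i (f_ : nat -> Rd R d -> R) f (r C : R) : vradon nu ->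
  (forall n, Cc (f_ n)) -> (forall n, vanish r (f_ n)) ->
  (forall n x, `|f_ n x| <= C) -> (forall x, f_ n x @[n --> \oo] --> f x) ->
  vint nu i (f_ n) @[n --> \oo] --> vint nu i f.
Proof.
move=> rnu cf_ v_ b_ ff; have [rp rn] := rnu i.
by apply: cvgB; [exact: (pairing_cvg rp cf_ v_ b_ ff)|exact: (pairing_cvg rn cf_ v_ b_ ff)].
Qed.

Lemma flux_cvg nu (w_ : nat -> 'I_d -> Rd R d -> R) w (r C : R) : vradon nu ->
  (forall n i, Cc (w_ n i)) -> (forall n i, vanish r (w_ n i)) ->
  (forall n i x, `|w_ n i x| <= C) -> (forall i x, w_ n i x @[n --> \oo] --> w i x) ->
  flux nu (w_ n) @[n --> \oo] --> flux nu w.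
Proof.
move=> rnu cw v_ b_ ww; rewrite /flux.
apply: cvg_big => [|i _]; first exact: add_continuous.
exact: (@vint_cvg nu i (fun n => w_ n i) (w i) r C rnu (cw^~ i) (v_^~ i) (b_^~ i) (ww i)).
Qed.

Lemma flux_vscale nu c w : c != 0 -> (forall i, Cc (w i)) ->
  flux (vscale c nu) w = c * flux nu w.
Proof.
move=> c0 cw; rewrite /flux mulr_sumr; apply: eq_bigr => i _.
by rewrite vint_vscale//; exact: Cc_measurable.
Qed.
End Pairing.

Section ActionBounds.
Context (R : realType) (d : nat) (p : R) (phi : R -> Rd R d -> R).
Hypotheses (p1 : 1 < p) (adm : admissible p phi).
Implicit Types (mu gamma : Meas R d) (nu : vmeasure R d) (f g : Rd R d -> R)
  (w : 'I_d -> Rd R d -> R).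

(** At least [p], for Young's inequality, and even, for the cutoff power to be C^1. *)
Definition kexp : nat := (2 * (Num.truncn p).+1)%N.

Lemma le_kexp : p <= kexp%:R.
Proof.
have : p <= (Num.truncn p).+1%:R by exact/ltW/truncnS_gt.
by move=> /le_trans; apply; rewrite ler_nat leq_pmull.
Qed.

Definition mass (r : R) mu := pairing mu (fun x => cutoff r x ^+ kexp).

Lemma Cc_mass r : 0 < r -> Cc (fun x : Rd R d => cutoff r x ^+ kexp).
Proof. by move=> r0; exact: Cc_cutoffX. Qed.

Lemma mass_ge0 r mu : 0 <= mass r mu.
Proof. by apply: pairing_ge0 => x; rewrite exprn_ge0// cutoff_ge0. Qed.

Lemma flux_bound gamma (r e C : R) : radon gamma -> 0 < r -> 0 < e -> 0 < C ->
  exists2 M : R, 0 < M & forall mu nu w, radon mu -> vradon nu -> (forall i, Cc (w i)) ->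
  (forall i x, `|w i x| <= C * cutoff r x ^+ kexp.-1) ->
  (`|flux nu w|%:E <= M%:E * Phi phi gamma mu nu + (e * (mass r gamma + mass r mu))%:E)%E.
Proof.
move=> rg r0 e0 C0.
have [M M0 H] := Phi_vint_bound p1 adm le_kexp r0 e0 C0 rg.
exists M => // mu nu w rmu rnu cw wC; apply: (le_trans (H mu nu w rmu rnu cw wC)).
by rewrite !pairingE//; exact: Cc_mass.
Qed.

Lemma tv_bound gamma (r : R) : radon gamma -> 0 < r ->
  exists2 M : R, 0 < M & forall mu nu, radon mu -> vradon nu ->
  (tv nu (Eball r) <= M%:E * Phi phi gamma mu nu + (mass r gamma + mass r mu)%:E)%E.
Proof.
move=> rg r0; have [M M0 H] := Phi_tv_bound p1 adm le_kexp r0 rg.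
exists M => // mu nu rmu rnu; apply: (le_trans (H mu nu rmu rnu)).
by rewrite !pairingE//; exact: Cc_mass.
Qed.
End ActionBounds.

Section C1Vanish.
Context (R : realType) (d : nat).
Implicit Types (g : Rd R d -> R) (dg : 'I_d -> Rd R d -> R).

Lemma C1with_vanish r g dg i (x : Rd R d) : C1with g dg -> vanish r g -> r < enorm x ->
  dg i x = 0.
Proof.
move=> [cg cdg H] gv rx; have D := H x i.
have nz : \forall s \near (0 : R), (cst 0 : R -> R) s = g (x + s *: evec R i).
  have cs : continuous (fun s : R => enorm (x + s *: evec R i)).
    move=> s; apply: (continuous_comp (f := fun s : R => x + s *: evec R i));
      last exact: continuous_enorm.
    by apply: cvgD; [exact: cvg_cst|apply: cvgZr_tmp; exact: cvg_id].
  have := cs 0; rewrite /continuous_at scale0r addr0 => /cvgr_gt/(_ _ rx).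
  by apply: filterS => s /ltW h; rewrite /cst gv.
have D0 := near_eq_is_derive nz (is_derive_cst (0 : R) (0 : R) (1 : R)).
by rewrite -(@derive_val _ _ _ _ _ _ _ D) (@derive_val _ _ _ _ _ _ _ D0).
Qed.

Lemma C1with_Cc r g dg i : C1with g dg -> vanish r g -> Cc (dg i).
Proof.
move=> h gv; case: (h) => _ cdg _; apply: (@vanish_Cc _ _ (r + 1)) => // x rx.
by apply: (C1with_vanish i h gv); apply: lt_le_trans rx; rewrite ltrDl.
Qed.

Lemma C1with_cutoff_bound r n g dg : 0 < r -> C1with g dg -> vanish r g ->
  exists2 C, 0 < C & forall i x, `|dg i x| <= C * cutoff r x ^+ n.
Proof.
move=> r0 h gv.
have /choice[M HM] i : exists M : R, 0 < M /\ forall x, `|dg i x| <= M.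
  by have [M M0 HM] := Cc_bounded (C1with_Cc i h gv); exists M.
have S0 i : M i <= \sum_(j < d) M j.
  rewrite (bigD1 i)//= lerDl; apply: sumr_ge0 => j _; apply: ltW; by case: (HM j).
exists (1 + \sum_(j < d) M j) => [|i x].
  by rewrite ltr_pwDl// sumr_ge0// => j _; apply: ltW; case: (HM j).
have [rx|xr] := ltP r (enorm x).
  rewrite (C1with_vanish i h gv rx) normr0 mulr_ge0 ?exprn_ge0 ?cutoff_ge0//.
  by rewrite addr_ge0// sumr_ge0// => j _; apply: ltW; case: (HM j).
have [Mi dgM] := HM i.
have SM : `|dg i x| <= 1 + \sum_(j < d) M j.
  by apply: (le_trans (dgM x)); apply: (le_trans (S0 i)); rewrite lerDr.
apply: (le_trans SM); rewrite ler_peMr ?exprn_ege1 ?cutoff_ge1//.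
exact: le_trans SM.
Qed.
End C1Vanish.

(** * Curves of finite action *)

Section IntervalIntegral.
Context (R : realType).
Notation leb := (@lebesgue_measure R).

Lemma integral_itv_split (a b c : R) (f : R -> \bar R) : a <= b -> b <= c ->
  measurable_fun `]a, c[ f ->
  (\int[leb]_(t in `]a, c[) f t = \int[leb]_(t in `]a, b[) f t + \int[leb]_(t in `]b, c[) f t)%E.
Proof.
move=> ab; rewrite le_eqVlt => /predU1P[<- _|bc mf].
  by rewrite [X in (_ + X)%E](_ : _ = 0%E) ?adde0// set_itvoo0 integral_set0.
have E : `]a, c[%classic = `]a, b]%classic `|` `]b, c[%classic.
  by apply: itv_bndbnd_setU; rewrite bnd_simp.
have sub (i : interval R) : [set` i] `<=` `]a, c[ -> measurable_fun [set` i] f.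
  by move=> h; apply: measurable_funS mf.
rewrite E integral_setU//; last 2 first.
- by rewrite -E.
- rewrite disj_set2E; apply/eqP/seteqP; split => x //= []; rewrite !in_itv/=.
  by move=> /andP[_ xb] /andP[]; rewrite ltNge xb.
congr (_ + _)%E; rewrite integral_itv_bndo_bndc//; apply: sub => x/=.
by rewrite !in_itv/= => /andP[-> xb]; exact: lt_trans bc.
Qed.
End IntervalIntegral.

Section Curves.
Context (R : realType) (d : nat) (p : R) (phi : R -> Rd R d -> R) (gamma : Meas R d).
Hypotheses (p1 : 1 < p) (adm : admissible p phi) (rg : radon gamma).
Implicit Types (mu : R -> Meas R d) (nu : R -> vmeasure R d) (f g : Rd R d -> R)
  (w dg : 'I_d -> Rd R d -> R).
Notation leb := (@lebesgue_measure R).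
Local Notation mass := (@mass R d p).
Local Notation kexp := (kexp p).

Definition action mu nu : \bar R :=
  (\int[leb]_(t in `]0%R, 1%R[) Phi phi gamma (mu t) (nu t))%E.

(** What remains of [CE] once the equation itself is stated by [flows]; the bound on the total
    variation is recovered from the finite action. *)
Definition curve mu nu :=
  [/\ ((forall t, 0 <= t <= 1 -> radon (mu t)) /\ (forall t, 0 < t < 1 -> vradon (nu t))),
      (forall f, Cc f -> {within `[0 : R, 1 : R], continuous (fun t => pairing (mu t) f)}),
      (forall f i, Cc f -> measurable_fun `]0 : R, 1 : R[ (fun t => vint (nu t) i f)) &
      (action mu nu < +oo)%E].

(* The weak continuity equation in integrated form: only tests independent of time occur. *)
Definition flows mu nu := forall g dg r, C1with g dg -> vanish r g ->
  forall t, 0 <= t <= 1 ->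
  (\int[leb]_(s in `]0%R, t[) (flux (nu s) dg)%:E)%E = (pairing (mu t) g - pairing (mu 0) g)%:E.

Lemma action_ge0 mu nu : (0 <= action mu nu)%E.
Proof. by apply: integral_ge0 => t _; exact: (Phi_ge0 p1 adm). Qed.

Lemma lower_integral_action_le mu nu (M c : R) (G : R -> \bar R) : 0 < M -> 0 <= c ->
  (forall t : R, (0 < t < 1)%R -> 0 <= G t <= M%:E * Phi phi gamma (mu t) (nu t) + c%:E)%E ->
  (\int[leb]_(t in `]0%R, 1%R[) G t <= M%:E * action mu nu + c%:E)%E.
Proof.
move=> M0 c0 H.
have P0 t : (0 <= M%:E * Phi phi gamma (mu t) (nu t))%E.
  by rewrite mule_ge0 ?lee_fin ?(ltW M0)//; exact: (Phi_ge0 p1 adm).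
have HI t : `]0%R, 1%R[%classic t -> 0 < t < 1 by rewrite /= in_itv.
apply: (@le_trans _ _ (\int[leb]_(t in `]0%R, 1%R[)
    (M%:E * Phi phi gamma (mu t) (nu t) + cst c%:E t))%E).
  by apply: le_lower_integral => t /HI /H /andP[].
apply: (le_trans (@lower_integralD_le _ _ R leb `]0%R, 1%R[%classic
    (fun t => M%:E * Phi phi gamma (mu t) (nu t))%E (cst c%:E) _ _ _ _)) => //.
rewrite lower_integralZl//; last by move=> t _; exact: (Phi_ge0 p1 adm).
have l1 : leb `]0 : R, 1 : R[%classic = 1%E.
  by rewrite lebesgue_measure_itv/= lte_fin ltr01 oppr0 adde0.
have -> : (\int[leb]_(t in `]0%R, 1%R[) cst c%:E t)%E = c%:E; last by [].
rewrite integral_cst//; apply: etrans (mule1 c%:E); congr (_ * _)%E; exact: l1.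
Qed.

(** Continuity in time makes the largest mass a finite number, so that it can be absorbed in
    [mass_control]. *)
Lemma curve_mass_max mu nu r : 0 < r -> curve mu nu ->
  exists2 c, 0 <= c <= 1 & forall t, 0 <= t <= 1 -> mass r (mu t) <= mass r (mu c).
Proof.
move=> r0 [_ cc _ _].
have [c c01 H] := EVT_max ler01 (cc _ (@Cc_mass R d p r r0)).
exists c => [|t t01]; first by move: c01; rewrite in_itv.
by apply: H; rewrite in_itv.
Qed.

Lemma measurable_flux mu nu w : curve mu nu -> (forall i, Cc (w i)) ->
  measurable_fun `]0 : R, 1 : R[ (fun t => flux (nu t) w).
Proof.
by move=> [_ _ mc _] cw; apply: measurable_sum => i; exact: mc.
Qed.

Lemma integral_flux_le r e C : 0 < r -> 0 < e -> 0 < C ->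
  exists2 M : R, 0 < M & forall mu nu w S, curve mu nu ->
  (forall t, 0 <= t <= 1 -> mass r (mu t) <= S) -> (forall i, Cc (w i)) ->
  (forall i x, `|w i x| <= C * cutoff r x ^+ kexp.-1) ->
  (\int[leb]_(t in `]0%R, 1%R[) `|flux (nu t) w|%:E <=
   M%:E * action mu nu + (e * (mass r gamma + S))%:E)%E.
Proof.
move=> r0 e0 C0; have [M M0 H] := flux_bound p1 adm rg r0 e0 C0.
exists M => // mu nu w S cu mS cw wC.
have S0 : 0 <= S by apply: le_trans (mS 0 _); [exact: mass_ge0|rewrite lexx ler01].
case: (cu) => [[rm rn] _ _ _].
apply: lower_integral_action_le => //.
  by rewrite mulr_ge0 ?(ltW e0)// addr_ge0// mass_ge0.
move=> t /andP[t0 t1]; rewrite lee_fin normr_ge0/=.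
have t01 : 0 <= t <= 1 by rewrite !ltW.
apply: (le_trans (H _ _ _ (rm _ t01) (rn _ _) cw wC)); first by rewrite t0.
by rewrite leeD2l// lee_fin ler_wpM2l ?(ltW e0)// lerD2l mS.
Qed.

Lemma integrable_flux mu nu g dg r : curve mu nu -> C1with g dg -> vanish r g ->
  leb.-integrable `]0 : R, 1 : R[ (fun t => (flux (nu t) dg)%:E).
Proof.
move=> cu gd gv.
have cdg i : Cc (dg i) by exact: C1with_Cc gd gv.
have r0 : 0 < Num.max r 1 by rewrite lt_max ltr01 orbT.
have gv' : vanish (Num.max r 1) g by apply: vanish_le gv; rewrite le_max lexx.
have [C C0 dgC] := C1with_cutoff_bound kexp.-1 r0 gd gv'.
have [M M0 H] := integral_flux_le r0 ltr01 C0.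
have [c c01 mc] := curve_mass_max r0 cu.
apply/integrableP; split; first by apply/measurable_EFinP; exact: (measurable_flux cu).
apply: (le_lt_trans (H _ _ _ _ cu mc cdg dgC)).
by rewrite lte_add_pinfty ?ltry// lte_mul_pinfty ?lee_fin ?(ltW M0)//; case: cu.
Qed.

Lemma flows_itv mu nu g dg r s t : curve mu nu -> flows mu nu -> C1with g dg -> vanish r g ->
  0 <= s -> s <= t -> t <= 1 ->
  (\int[leb]_(x in `]s, t[) (flux (nu x) dg)%:E)%E = (pairing (mu t) g - pairing (mu s) g)%:E.
Proof.
move=> cu fl gd gv s0 st t1.
have mF : measurable_fun `]0, t[ (fun x => (flux (nu x) dg)%:E).
  have /integrableP[+ _] := integrable_flux cu gd gv; apply: measurable_funS => // x/=.
  by rewrite !in_itv/= => /andP[-> xt]; exact: lt_le_trans t1.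
have := integral_itv_split s0 st mF.
rewrite !(fl _ _ _ gd gv) ?(le_trans s0 st) ?s0 ?(le_trans st t1)//.
case: (\int[leb]_(x in _) _)%E => [x| |]//=; rewrite -EFinD => -[h].
by congr EFin; lra.
Qed.

Lemma pairing_flux_le mu nu g dg r t : curve mu nu -> flows mu nu ->
  C1with g dg -> vanish r g -> 0 <= t <= 1 ->
  (`|pairing (mu t) g - pairing (mu 0) g|%:E <=
     \int[leb]_(x in `]0%R, 1%R[) `|flux (nu x) dg|%:E)%E.
Proof.
move=> cu fl gd gv /[dup] t01 /andP[t0 t1]; have /integrableP[mF _] := integrable_flux cu gd gv.
have sub : `]0, t[ `<=` (`]0, 1[ : set R).
  by move=> x/=; rewrite !in_itv/= => /andP[-> xt]; exact: lt_le_trans t1.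
rewrite -abse_EFin -(fl _ _ _ gd gv t t01).
apply: (le_trans (le_abse_integral _ _ _)) => //; first exact: measurable_funS mF.
by apply: ge0_subset_integral => //; exact: measurableT_comp mF.
Qed.

(** The test is the mass weight itself, whose gradient [flux_bound] admits. With [e = 1/2] the
    largest mass [S] satisfies [S <= m + M E + (mass r gamma + S) / 2], where [m] is the initial
    mass, and half of [S] is absorbed by the left-hand side. *)
Lemma mass_control r : 0 < r -> exists2 M : R, 0 < M & forall mu nu E,
  curve mu nu -> flows mu nu -> (action mu nu <= E%:E)%E -> forall t, 0 <= t <= 1 ->
  mass r (mu t) <= 2 * mass r (mu 0) + M * E + mass r gamma.
Proof.
move=> r0; have [dg [C [C0 gd dgC]]] := @C1with_cutoffX R d r (Num.truncn p) r0.
have e0 : 0 < 2^-1 :> R by rewrite invr_gt0.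
have [M M0 H] := integral_flux_le r0 e0 C0.
exists (2 * M) => [|mu nu E cu fl aE t t01]; first by rewrite mulr_gt0.
have gv : vanish (2 * r) (fun x : Rd R d => cutoff r x ^+ (2 * (Num.truncn p).+1)).
  by move=> x rx; rewrite (cutoff_vanish r0)// expr0n.
have cdg i : Cc (dg i) by exact: C1with_Cc gd gv.
have [c c01 mc] := curve_mass_max r0 cu; apply: (le_trans (mc t t01)).
have := le_trans (pairing_flux_le cu fl gd gv c01) (H _ _ _ _ cu mc cdg dgC).
rewrite -/(mass r (mu c)) -/(mass r (mu 0)) => h.
have : (`|mass r (mu c) - mass r (mu 0)|%:E <=
    M%:E * E%:E + (2^-1 * (mass r gamma + mass r (mu c)))%:E)%E.
  by apply: (le_trans h); rewrite leeD2r// lee_wpmul2l// lee_fin ltW.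
rewrite -EFinM -EFinD lee_fin => h'.
have := le_trans (ler_norm _) h'; rewrite -mulrA; move: (M * E) => q; lra.
Qed.

(* A C^1 approximation [g] of [f] feels the action through the flux only, and the error [f - g]
   is paid for by the mass. *)
Lemma pairing_oscillation f : Cc f -> exists2 r : R, 0 < r & forall B e : R, 0 < e ->
  exists2 a : R, 0 < a & forall mu nu, curve mu nu -> flows mu nu ->
  (action mu nu <= a%:E)%E -> mass r (mu 0) <= B -> forall t, 0 <= t <= 1 ->
  `|pairing (mu t) f - pairing (mu 0) f| <= e.
Proof.
move=> cf; have [r r0 [fv app]] := C1_approximation cf; exists r => // B e e0.
have [M M0 HM] := mass_control r0.
(* The bound of [mass_control] for action at most 1 and initial mass at most [B]. *)
pose S := 2 * `|B| + M + mass r gamma.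
have G0 := mass_ge0 p r gamma.
have S0 : 0 <= S by rewrite !addr_ge0 ?mulr_ge0// ltW.
have S1 : 0 < S + 1 by rewrite ltr_wpDl.
pose e1 := e / (4 * (S + 1)).
have e10 : 0 < e1 by rewrite divr_gt0// mulr_gt0.
have [g [[dg gd] gv fg]] := app e1 e10.
have [C C0 dgC] := C1with_cutoff_bound kexp.-1 r0 gd gv.
have GS1 : 0 < mass r gamma + S + 1 by rewrite ltr_wpDl// addr_ge0.
pose e2 := e / (4 * (mass r gamma + S + 1)).
have e20 : 0 < e2 by rewrite divr_gt0// mulr_gt0.
have [M1 M10 H] := integral_flux_le r0 e20 C0.
(* The budget is [e / 4] for each of four errors: replacing [f] by [g] at time [t] and at time 0,
   the mass part of the flux bound, and its action part. *)
exists (Num.min 1 (e / (4 * M1))).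
  by rewrite lt_min ltr01 divr_gt0// mulr_gt0.
move=> mu nu cu fl aE mB t t01.
have cdg i : Cc (dg i) by exact: C1with_Cc gd gv.
have cg : Cc g by case: (gd) => cg _ _; exact: vanish_Cc gv.
have mS s : 0 <= s <= 1 -> mass r (mu s) <= S.
  move=> s01; apply: (le_trans (HM _ _ _ cu fl aE s s01)).
  rewrite lerD2r lerD//; first by rewrite ler_pM2l// (le_trans mB)// ler_norm.
  by rewrite ler_piMr ?(ltW M0)// ge_min lexx.
have [rm _] : (forall t, 0 <= t <= 1 -> radon (mu t)) /\ True by case: cu => [[]].
have approx s : 0 <= s <= 1 -> `|pairing (mu s) f - pairing (mu s) g| <= e1 * S.
  move=> s01; rewrite -pairingB//; try exact: rm.
  apply: (@le_trans _ _ (e1 * mass r (mu s))); last by rewrite ler_wpM2l ?(ltW e10)// mS.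
  rewrite -pairingZ//; [|exact: rm|exact: Cc_mass].
  apply: norm_pairing_le; [exact: rm|exact: CcB|exact/CcZ/Cc_mass|move=> x].
  have [rx|xr] := leP r (enorm x).
    by rewrite fv// gv// subrr normr0 mulr_ge0 ?(ltW e10)// exprn_ge0// cutoff_ge0.
  by apply: (le_trans (fg x)); rewrite ler_peMr ?(ltW e10)// exprn_ege1// cutoff_ge1// ltW.
have hg : `|pairing (mu t) g - pairing (mu 0) g| <= e / 2.
  rewrite -lee_fin; apply: (le_trans (pairing_flux_le cu fl gd gv t01)).
  apply: (le_trans (H _ _ _ _ cu mS cdg dgC)).
  apply: (@le_trans _ _ (M1%:E * (e / (4 * M1))%:E + (e2 * (mass r gamma + S))%:E)%E).
    rewrite leeD2r// lee_wpmul2l ?lee_fin ?(ltW M10)//.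
    by apply: (le_trans aE); rewrite lee_fin ge_min lexx orbT.
  rewrite -EFinM -EFinD lee_fin.
  have -> : M1 * (e / (4 * M1)) = e / 4 by field; rewrite gt_eqF.
  have : e2 * (mass r gamma + S) <= e / 4.
    apply: (@le_trans _ _ (e2 * (mass r gamma + S + 1))).
      by rewrite ler_wpM2l ?(ltW e20)// lerDl.
    by rewrite /e2 (_ : _ * _ = e / 4)//; field; rewrite gt_eqF.
  by lra.
have e1S : e1 * S <= e / 4.
  apply: (@le_trans _ _ (e1 * (S + 1))); first by rewrite ler_wpM2l ?(ltW e10)// lerDl.
  by rewrite /e1 (_ : _ * _ = e / 4)//; field; rewrite gt_eqF.
have z01 : 0 <= (0 : R) <= 1 by rewrite lexx ler01.
have := approx t t01; have := approx 0 z01; move: hg.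
rewrite !ler_norml => /andP[? ?] /andP[? ?] /andP[? ?]; apply/andP; split; lra.
Qed.
End Curves.

(** * From the weak to the integrated continuity equation *)

Section Ramps.
Context (R : realType).
Implicit Types (s e r c : R) (F m h : R -> R).
Notation leb := (@lebesgue_measure R).

(** Tests of the weak equation live in the open time interval; the end times are reached by
    continuity alone. *)
Lemma const_itv_extend h c : {within `[0 : R, 1 : R], continuous h} ->
  (forall t, 0 < t < 1 -> h t = c) -> forall t, 0 <= t <= 1 -> h t = c.
Proof.
move=> /(continuous_within_itvP _ ltr01)[_ h0 h1] hc t /andP[].
rewrite le_eqVlt => /predU1P[<- _|t0]; last first.
  rewrite le_eqVlt => /predU1P[->|t1]; last by rewrite hc// t0.
  have h1c : h x @[x --> 1^'-] --> c.
    apply: cvg_near_cst; near=> x; apply: hc; apply/andP; split; near: x.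
      by apply: nbhs_left_gt; exact: ltr01.
    exact: nbhs_left_lt.
  exact: (cvg_unique _ h1 h1c).
have h0c : h x @[x --> 0^'+] --> c.
  apply: cvg_near_cst; near=> x; apply: hc; apply/andP; split; near: x.
    exact: nbhs_right_gt.
  by apply: nbhs_right_lt; exact: ltr01.
exact: (cvg_unique _ h0 h0c).
Unshelve. all: by end_near. Qed.

Lemma continuous_primitive F : leb.-integrable `]0 : R, 1 : R[ (fun t => (F t)%:E) ->
  {within `[0 : R, 1 : R], continuous
     (fun t : R => fine (\int[leb]_(x in `]0%R, t[) (F x)%:E)%E)}.
Proof.
move=> iF.
pose F0 : R -> R := F \_ (`]0 : R, 1 : R[%classic).
have iF0 : leb.-integrable setT (EFin \o F0).
  rewrite (_ : _ \o _ = (fun t => (F t)%:E) \_ (`]0 : R, 1 : R[%classic)).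
    by apply: (integrable_mkcond _ _).1.
  by apply/funext => x; rewrite /F0 /patch/=; case: ifP.
have mF0 (i : interval R) : measurable_fun [set` i] (EFin \o F0).
  by have /integrableP[+ _] := iF0; exact: measurable_funTS.
have iF1 : leb.-integrable `[0 : R, 1 : R]%classic (EFin \o F0) by exact: integrableS iF0.
have := @parameterized_integral_continuous R 0 1 F0 ler01 iF1.
apply: subspace_eq_continuous => x; rewrite inE/= in_itv/= => /andP[x0 x1].
rewrite /parameterized_integral /Rintegral; congr fine.
rewrite -integral_itv_bndo_bndc// -integral_itv_obnd_cbnd//.
apply: eq_integral => y; rewrite inE/= in_itv/= => /andP[y0 yx].
by rewrite /F0 /patch mem_setE in_itv/= y0 (lt_le_trans yx x1).
Qed.

(** A C^1 approximation of the indicator of []s, +oo[], rising between [s] and [s + 2 e]; its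
    derivative approximates the unit mass at [s] from the right. *)
Definition ramp s e r : R := sstep ((r - s) / e).
Definition dramp s e r : R := e^-1 * dsstep ((r - s) / e).

Lemma is_derive_ramp s e r : is_derive r (1 : R) (ramp s e) (dramp s e r).
Proof.
have D : is_derive r (1 : R) (fun r => (r - s) / e) e^-1.
  apply: is_derive_quadratic => h.
  by rewrite (_ : _ - _ - _ = 0) ?normr0 ?sqr_ge0//; ring.
by have := @is_derive1_comp _ (@sstep R) _ r _ _ (is_derive_sstep _) D; rewrite mulrC.
Qed.

Lemma continuous_ramp s e : continuous (ramp s e).
Proof.
by move=> r; apply: differentiable_continuous; apply/derivable1_diffP;
  have D := is_derive_ramp s e r; exact: ex_derive.
Qed.

Lemma continuous_dramp s e : continuous (dramp s e).
Proof.
apply: continuous_mul; first exact: continuous_const.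
apply: (continuous_compose (h := @dsstep R)); first exact: continuous_dsstep.
by apply: continuous_mul; [apply: continuous_sub; [move=> x; exact: cvg_id|]|];
  exact: continuous_const.
Qed.

Lemma ramp_le s e r : 0 < e -> r <= s -> ramp s e r = 0.
Proof. by move=> e0 rs; apply: sstep_le0; rewrite pmulr_lle0 ?invr_gt0// subr_le0. Qed.

Lemma ramp_ge s e r : 0 < e -> s + 2 * e <= r -> ramp s e r = 1.
Proof. by move=> e0 rs; apply: sstep_ge2; rewrite ler_pdivlMr//; lra. Qed.

Lemma ramp01 s e r : 0 <= ramp s e r <= 1. Proof. exact: sstep01. Qed.

Lemma dramp_le s e r : 0 < e -> r <= s -> dramp s e r = 0.
Proof.
by move=> e0 rs; rewrite /dramp dsstep_le0 ?mulr0// pmulr_lle0 ?invr_gt0// subr_le0.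
Qed.

Lemma dramp_ge s e r : 0 < e -> s + 2 * e <= r -> dramp s e r = 0.
Proof. by move=> e0 rs; rewrite /dramp dsstep_ge2 ?mulr0// ler_pdivlMr//; lra. Qed.

Lemma dramp_ge0 s e r : 0 < e -> 0 <= dramp s e r.
Proof. by move=> e0; rewrite mulr_ge0 ?invr_ge0 ?(ltW e0)// dsstep_ge0. Qed.

Lemma continuous_itv_integrable h : {within `[0 : R, 1 : R], continuous h} ->
  leb.-integrable `]0 : R, 1 : R[ (fun r => (h r)%:E).
Proof.
move=> ch; apply: (@integrableS _ _ _ leb `[0 : R, 1 : R]%classic) => //.
  by apply: subset_itv; rewrite bnd_simp.
by apply: continuous_compact_integrable => //; exact: segment_compact.
Qed.

Lemma integral_dramp s e : 0 < s -> 0 < e -> s + 2 * e <= 1 ->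
  (\int[leb]_(r in `]0%R, 1%R[) (dramp s e r)%:E = 1)%E.
Proof.
move=> s0 e0 se.
have cd : {within `[0 : R, 1 : R], continuous (dramp s e)}.
  by apply: continuous_subspaceT; exact: continuous_dramp.
have := @continuous_FTC2 R (dramp s e) (ramp s e) 0 1 ltr01 cd.
rewrite ramp_ge// ramp_le ?(ltW s0)// sube0 => <-.
- have mI (i : interval R) : measurable_fun [set` i] (fun r => (dramp s e r)%:E).
    apply/measurable_EFinP; apply: measurable_funTS; apply: continuous_measurable_fun.
    exact: continuous_dramp.
  by rewrite integral_itv_bndo_bndc// integral_itv_obnd_cbnd.
- split.
  + by move=> x _; have D := is_derive_ramp s e x; exact: ex_derive.
  + by apply: cvg_at_right_filter; exact: continuous_ramp.
  + by apply: cvg_at_left_filter; exact: continuous_ramp.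
- move=> x _; rewrite derive1E; exact: (@derive_val _ _ _ _ _ _ _ (is_derive_ramp s e x)).
Qed.

Lemma near_scale (c x : R) : 0 < x -> \forall n \near \oo, c / n.+1%:R < x.
Proof.
move=> x0; have : c * harmonic n @[n --> \oo] --> c * (0 : R).
  by apply: cvgMr; exact: cvg_harmonic.
by rewrite mulr0 => /cvgr_lt/(_ _ x0).
Qed.

Lemma dramp_integral_cvg m s c : {within `[0 : R, 1 : R], continuous m} ->
  0 < s < 1 -> 0 < c ->
  fine (\int[leb]_(r in `]0%R, 1%R[) (dramp s (c / n.+1%:R) r * m r)%:E)%E
    @[n --> \oo] --> m s.
Proof.
move=> cm /andP[s0 s1] c0; apply/cvgrPdist_le => e e0.
have s01 : `]0, 1[%classic s by rewrite /= in_itv/= s0.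
have [b b0 Hb] : exists2 b, 0 < b & forall r, `|s - r| < b -> `|m s - m r| <= e.
  have := (continuous_within_itvP _ ltr01).1 cm => -[/(_ s) h _ _].
  have /cvgrPdist_le/(_ e e0) := h s01; rewrite -filter_from_ballE => -[b b0 H].
  by exists b => // r sr; apply: H.
near=> n.
have en0 : 0 < c / n.+1%:R by rewrite divr_gt0.
have se : s + 2 * (c / n.+1%:R) <= 1.
  have : 2 * c / n.+1%:R < 1 - s by near: n; apply: near_scale; rewrite subr_gt0.
  by rewrite -mulrA; move: (c / _) => q h; lra.
have sb : 2 * (c / n.+1%:R) < b.
  have : 2 * c / n.+1%:R < b by near: n; exact: near_scale.
  by rewrite -mulrA.
set en := c / n.+1%:R in en0 se sb *.
have cd : {within `[0 : R, 1 : R], continuous (dramp s en)}.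
  by apply: continuous_subspaceT; exact: continuous_dramp.
have im : leb.-integrable `]0 : R, 1 : R[ (fun r => (dramp s en r * m r)%:E).
  apply: continuous_itv_integrable.
  exact: (@continuous_mul _ (subspace `[0 : R, 1 : R])).
have is_ : leb.-integrable `]0 : R, 1 : R[ (fun r => (dramp s en r * m s)%:E).
  apply: continuous_itv_integrable.
  apply: (@continuous_mul _ (subspace `[0 : R, 1 : R])) => //; exact: continuous_const.
have id_ : leb.-integrable `]0 : R, 1 : R[ (fun r => (dramp s en r)%:E).
  exact: continuous_itv_integrable.
have E : (\int[leb]_(r in `]0%R, 1%R[) (dramp s en r * m s)%:E = (m s)%:E)%E.
  under eq_integral do rewrite mulrC EFinM.
  by rewrite integralZl// integral_dramp// mule1.
rewrite -[m s]/(fine (m s)%:E) -E -fineB; [|exact: integrable_fin_num..].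
rewrite -integralB// -lee_fin -abse_EFin fineK; last first.
  by apply: integrable_fin_num => //; exact: integrableB.
apply: (le_trans (le_abse_integral _ _ _)) => //.
  by have /(_ (measurable_itv _))/integrableP[] := integrableB _ is_ im.
apply: (@le_trans _ _ (\int[leb]_(r in `]0%R, 1%R[) (e%:E * (dramp s en r)%:E))%E); last first.
  by rewrite integralZl// integral_dramp// mule1.
apply: le_lower_integral => r _ //.
rewrite -EFinB -EFinM lee_fin -mulrBr normrM ger0_norm ?dramp_ge0// mulrC.
have [rs|sr] := leP r s; first by rewrite dramp_le// !mulr0.
have [rs|rse] := leP (s + 2 * en) r; first by rewrite dramp_ge// !mulr0.
rewrite ler_wpM2r ?dramp_ge0// Hb// ltr0_norm ?subr_lt0// opprB; lra.
Unshelve. all: by end_near. Qed.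

Lemma ramp_integral_cvg F s c : leb.-integrable `]0 : R, 1 : R[ (fun t => (F t)%:E) ->
  0 < s -> 0 < c ->
  fine (\int[leb]_(r in `]0%R, 1%R[) (ramp s (c / n.+1%:R) r * F r)%:E)%E
    @[n --> \oo] --> fine (\int[leb]_(r in `]s, 1%R[) (F r)%:E)%E.
Proof.
move=> iF s0 c0.
have en0 n : 0 < c / n.+1%:R by rewrite divr_gt0.
have /integrableP[/measurable_EFinP mF _] := iF.
have -> : (\int[leb]_(r in `]s, 1%R[) (F r)%:E =
    \int[leb]_(r in `]0%R, 1%R[) ((if s < r then F r else 0))%:E)%E.
  have -> : `]s, 1[%classic = `]0, 1[%classic `&` `]s, +oo[%classic :> set R.
    apply/seteqP; split => x/=; rewrite !in_itv/= andbT.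
      by move=> /andP[sx ->]; rewrite (lt_trans s0 sx).
    by move=> [/andP[_ ->] ->].
  rewrite integral_mkcondr; apply: eq_integral => x _; rewrite /patch.
  by rewrite mem_setE in_itv/= andbT; case: ifP.
apply: (dominated_cvg_fine _ _ _ (integrable_abse iF)) => // [n|r _|n r _].
- apply: measurable_funM => //; apply: measurable_funTS; apply: continuous_measurable_fun.
  exact: continuous_ramp.
- apply: cvg_near_cst; have [sr|rs] := ltP s r; last first.
    by apply: nearW => n; rewrite ramp_le// mul0r.
  have sr' : 0 < r - s by rewrite subr_gt0.
  have := near_scale (2 * c) sr'; apply: filterS => n; rewrite -mulrA => h.
  rewrite ramp_ge ?mul1r//; move: h; move: (c / _) => q h; lra.
- have /andP[? ?] := ramp01 s (c / n.+1%:R) r.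
  by rewrite lee_fin normrM ger0_norm// ler_piMl.
Qed.
End Ramps.

Section ContinuityEquationTests.
Context (R : realType) (d : nat).
Implicit Types (f g : Rd R d -> R) (mu : R -> Meas R d) (nu : R -> vmeasure R d)
  (dg : 'I_d -> Rd R d -> R) (eta deta : R -> R).
Notation leb := (@lebesgue_measure R).

Lemma is_derive_translate eta (a t l : R) : is_derive (a + t) (1 : R) eta l ->
  is_derive t (1 : R) (fun s => eta (a + s)) l.
Proof.
move=> D; have D1 : is_derive t (1 : R) (fun s : R => a + s) 1.
  apply: is_derive_quadratic => h.
  by rewrite (_ : _ - _ - _ = 0) ?normr0 ?sqr_ge0//; ring.
by have := @is_derive1_comp _ eta (fun s : R => a + s) t _ _ D D1; rewrite mulr1.
Qed.

Lemma is_derive_shift eta (t l : R) : is_derive t (1 : R) eta l ->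
  is_derive (0 : R) (1 : R) (fun s => eta (t + s)) l.
Proof. by move=> D; apply: is_derive_translate; rewrite addr0. Qed.

Lemma vintZ (n : vmeasure R d) i (c : R) f : vradon n -> Cc f ->
  vint n i (fun x => c * f x) = c * vint n i f.
Proof.
move=> rn cf; have [rp rm] := rn i.
by rewrite /vint -!/(pairing _ _) !pairingZ// mulrBr.
Qed.

Lemma closure_bounded_slab (z : Rd R d -> R -> R) (r a b : R) :
  (forall x t, z x t != 0 -> enorm x <= r /\ a <= t <= b) ->
  closure [set q : Rd R d * R | z q.1 q.2 != 0] `<=` [set x | enorm x <= r] `*` `[a, b]%classic.
Proof.
move=> H.
have cl : closed ([set x : Rd R d | enorm x <= r] `*` `[a, b]%classic).
  apply: compact_closed; first exact: norm_hausdorff.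
  by apply: compact_setX; [exact: compact_enorm_le|exact: segment_compact].
rewrite [X in _ `<=` X](closure_id _).1//.
by apply: closure_subset => -[x t]/= /H[? ?]; split => //=; rewrite in_itv.
Qed.

Lemma CE_product mu nu g dg r eta deta (a b : R) : CE 1 mu nu -> C1with g dg -> vanish r g ->
  0 < a -> b < 1 -> (forall t, is_derive t (1 : R) eta (deta t)) -> continuous deta ->
  (forall t, eta t != 0 -> a <= t <= b) ->
  (\int[leb]_(t in `]0%R, 1%R[) (deta t * pairing (mu t) g)%:E +
   \int[leb]_(t in `]0%R, 1%R[) (eta t * flux (nu t) dg)%:E = 0)%E.
Proof.
move=> [[rm rn] _ _ _ weak] gd gv a0 b1 De cde esupp.
have [cg cdg Dg] := gd.
have ce : continuous eta.
  by move=> t; apply: differentiable_continuous; apply/derivable1_diffP;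
    have D := De t; exact: ex_derive.
have Cg : Cc g by exact: vanish_Cc gv.
have Cdg i : Cc (dg i) by exact: C1with_Cc gd gv.
pose z x t := eta t * g x.
have cfst (f : Rd R d -> R) : continuous f -> continuous (fun q : Rd R d * R => f q.1).
  by move=> cf q; apply: (continuous_comp (f := fst)); [exact: cvg_fst|exact: cf].
have csnd (f : R -> R) : continuous f -> continuous (fun q : Rd R d * R => f q.2).
  by move=> cf q; apply: (continuous_comp (f := snd)); [exact: cvg_snd|exact: cf].
have Dx x t i : is_derive (0 : R) (1 : R) (fun s : R => z (x + s *: evec R i) t)
    (eta t * dg i x).
  exact: (is_deriveZ (eta t) (Dg x i)).
have Dt x t : is_derive (0 : R) (1 : R) (fun s : R => z x (t + s)) (deta t * g x).
  have := is_deriveZ (g x) (is_derive_shift (De t)).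
  rewrite /z [g x *: deta t](_ : _ = deta t * g x); last by rewrite mulrC.
  by congr is_derive; apply/funext => s /=; rewrite /GRing.scale/= mulrC.
have dxE i x t : dxi z i x t = eta t * dg i x.
  by rewrite /dxi derive1E; exact: (@derive_val _ _ _ _ _ _ _ (Dx x t i)).
have dtE x t : dtm z x t = deta t * g x.
  by rewrite /dtm derive1E; exact: (@derive_val _ _ _ _ _ _ _ (Dt x t)).
have slab := @closure_bounded_slab z r a b.
have zs : forall x t, z x t != 0 -> enorm x <= r /\ a <= t <= b.
  move=> x t; rewrite mulf_eq0 negb_or => /andP[/esupp ? gx]; split => //.
  by rewrite leNgt; apply: contra gx => /ltW rx; rewrite gv.
have Cz : C1c 1 z.
  split.
  - by apply: continuous_mul; [exact: csnd|exact: cfst].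
  - by split=> [x t i|x t]; [have D := Dx x t i|have D := Dt x t]; exact: ex_derive.
  - split=> [i|].
      rewrite (_ : (fun q => _) = (fun q : Rd R d * R => eta q.2 * dg i q.1)).
        by apply: continuous_mul; [exact: csnd|exact: (cfst (dg i))].
      by apply/funext => q.
    rewrite (_ : (fun q => _) = (fun q : Rd R d * R => deta q.2 * g q.1)).
      by apply: continuous_mul; [exact: csnd|exact: cfst].
    by apply/funext => q.
  - apply: subclosed_compact (slab zs); first exact: closed_closure.
    by apply: compact_setX; [exact: compact_enorm_le|exact: segment_compact].
  - move=> [x t] /(slab zs)[_ /=]; rewrite in_itv/= => /andP[? ?].
    by apply/andP; split; [exact: lt_le_trans a0 _|exact: le_lt_trans b1].
rewrite -[RHS](weak z Cz); congr (_ + _)%E; apply: eq_integral => t;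
  rewrite inE/= in_itv/= => t01.
- have -> : (fun x : RdB R d => (dtm z x t)%:E) = (fun x => (deta t * g x)%:E).
    by apply/funext => x; rewrite dtE.
  congr EFin; rewrite -[RHS]/(pairing (mu t) (fun x => deta t * g x)) pairingZ//.
  by apply: rm; case/andP: t01 => /ltW-> /ltW->.
- congr EFin; rewrite /flux mulr_sumr; apply: eq_bigr => i _.
  rewrite -vintZ//; last exact: rn.
  by congr vint; apply/funext => x; rewrite dxE.
Qed.
End ContinuityEquationTests.

Section WeakToIntegrated.
Context (R : realType) (d : nat) (p : R) (phi : R -> Rd R d -> R) (gamma : Meas R d).
Hypotheses (p1 : 1 < p) (adm : admissible p phi) (rg : radon gamma).
Implicit Types (mu : R -> Meas R d) (nu : R -> vmeasure R d).
Notation leb := (@lebesgue_measure R).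

Lemma CE_curve mu nu : CE 1 mu nu -> (action phi gamma mu nu < +oo)%E ->
  curve phi gamma mu nu /\ flows mu nu.
Proof.
move=> ce aoo.
have cu : curve phi gamma mu nu by case: ce.
split => // g dg r gd gv.
have [_ cm _ _] := cu.
pose m t := pairing (mu t) g; pose F t := flux (nu t) dg.
have Cg : Cc g by case: (gd) => cg _ _; exact: vanish_Cc gv.
have iF : leb.-integrable `]0 : R, 1 : R[ (fun t => (F t)%:E).
  exact: (integrable_flux p1 adm rg cu gd gv).
have mF : measurable_fun `]0 : R, 1 : R[ (fun t => (F t)%:E) by case/integrableP: iF.
have cmg : {within `[0 : R, 1 : R], continuous m} := cm _ Cg.
pose I t : R := fine (\int[leb]_(x in `]0%R, t[) (F x)%:E)%E.
have cI : {within `[0 : R, 1 : R], continuous I} := continuous_primitive iF.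
have iFs (s t : R) : 0 <= s -> t <= 1 -> leb.-integrable `]s, t[ (fun t => (F t)%:E).
  move=> s0 t1; apply: integrableS iF => // x/=; rewrite !in_itv/= => /andP[sx xt].
  by rewrite (le_lt_trans s0 sx) (lt_le_trans xt t1).
have Is s : 0 <= s <= 1 -> fine (\int[leb]_(x in `]s, 1%R[) (F x)%:E)%E = I 1 - I s.
  move=> /andP[s0 s1]; have h := integral_itv_split s0 s1 mF.
  have f0 : (\int[leb]_(x in `]0%R, s[) (F x)%:E)%E \is a fin_num.
    by apply: integrable_fin_num => //; exact: iFs.
  have f1 : (\int[leb]_(x in `]s, 1%R[) (F x)%:E)%E \is a fin_num.
    by apply: integrable_fin_num => //; exact: iFs.
  by rewrite /I h (fineD f0 f1) addrC addKr.
(* A single ramp is not compactly supported in time, but the difference of two is. As the ramps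
   steepen, the equation says that [m - I] takes the same value at [s] and at [t]. *)
have key s t : 0 < s < 1 -> 0 < t < 1 -> m s - I s = m t - I t.
  wlog st : s t / s <= t => [H s01 t01|s01 t01].
    by have [st|/ltW st] := leP s t; [exact: H|apply/esym/H].
  have [/andP[s0 s1] /andP[t0 t1]] := (s01, t01).
  (* Both ramps are completed at [t + 2 c < 1], so their difference vanishes near time 1. *)
  pose c := (1 - t) / 4; have c0 : 0 < c by rewrite divr_gt0// subr_gt0.
  pose e n := c / n.+1%:R.
  have e0 n : 0 < e n by rewrite divr_gt0.
  have ec n : e n <= c.
    by rewrite ler_pdivrMr// ler_peMr ?(ltW c0)// ler1n.
  pose b := t + 2 * c; have b1 : b < 1 by rewrite /b /c; lra.
  pose eta n x := ramp s (e n) x - ramp t (e n) x.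
  pose deta n x := dramp s (e n) x - dramp t (e n) x.
  have H n : (\int[leb]_(x in `]0%R, 1%R[) (deta n x * m x)%:E +
      \int[leb]_(x in `]0%R, 1%R[) (eta n x * F x)%:E = 0)%E.
    apply: (CE_product ce gd gv s0 b1) => [x||x].
    - exact: (is_deriveB (is_derive_ramp s (e n) x) (is_derive_ramp t (e n) x)).
    - by apply: continuous_sub; exact: continuous_dramp.
    - apply: contraNT; rewrite negb_and -!ltNge => /orP[xs|bx]; apply/eqP.
        by rewrite /eta !ramp_le ?subrr// ltW// (lt_le_trans xs st).
      have h : t + 2 * e n <= x.
        by apply: le_trans (ltW bx); rewrite /b lerD2l ler_pM2l.
      by rewrite /eta !ramp_ge ?subrr//; apply: le_trans h; rewrite lerD2r.
  have id_ u n : leb.-integrable `]0 : R, 1 : R[ (fun x => (dramp u (e n) x * m x)%:E).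
    apply: continuous_itv_integrable.
    apply: (@continuous_mul _ (subspace `[0 : R, 1 : R])) => //.
    by apply: continuous_subspaceT; exact: continuous_dramp.
  have ir_ u n : leb.-integrable `]0 : R, 1 : R[ (fun x => (ramp u (e n) x * F x)%:E).
    apply: (le_integrable _ _ _ (integrable_abse iF)) => //.
      apply/measurable_EFinP; apply: measurable_funM; last exact/measurable_EFinP.
      apply: measurable_funTS; apply: continuous_measurable_fun; exact: continuous_ramp.
    move=> x _; have /andP[? ?] := ramp01 u (e n) x.
    by rewrite !abse_EFin lee_fin normr_id normrM ger0_norm// ler_piMl.
  have H' n : (fine (\int[leb]_(x in `]0%R, 1%R[) (dramp s (e n) x * m x)%:E) -
        fine (\int[leb]_(x in `]0%R, 1%R[) (dramp t (e n) x * m x)%:E)) +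
      (fine (\int[leb]_(x in `]0%R, 1%R[) (ramp s (e n) x * F x)%:E) -
        fine (\int[leb]_(x in `]0%R, 1%R[) (ramp t (e n) x * F x)%:E)) = 0.
    rewrite -!fineB; try by apply: integrable_fin_num.
    rewrite -!integralB// -fineD; try by
      apply: integrable_fin_num => //; apply: integrableB.
    rewrite -[RHS]/(fine 0%E) -(H n); congr (fine (_ + _)%E);
      by apply: eq_integral => x _; rewrite -EFinB -mulrBl.
  have L : (m s - m t) + ((I 1 - I s) - (I 1 - I t)) = 0.
    have := cvgD (cvgB (dramp_integral_cvg cmg s01 c0) (dramp_integral_cvg cmg t01 c0))
      (cvgB (ramp_integral_cvg iF s0 c0) (ramp_integral_cvg iF t0 c0)).
    rewrite !Is; last 2 first.
    - by rewrite !ltW.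
    - by rewrite !ltW.
    move=> h; have {}h := h _ _ _.
    set u := (X in X x @[x --> _] --> _) in h.
    have uE : u = (fun=> 0) by apply/funext => n; exact: H'.
    have /(_ _)h0 := @cvg_cst R 0 nat \oo; rewrite uE in h.
    have h1 : (fun _ : nat => 0 : R) x @[x --> \oo] -->
        m s - m t + (I 1 - I s - (I 1 - I t)) by exact: h.
    exact: (cvg_unique _ h1 h0).
  by move: L; lra.
have h2 : 0 < (2^-1 : R) < 1 by rewrite invr_gt0 ltr0n/= invf_lt1 ?ltr1n.
have cst01 := @const_itv_extend R (fun t => m t - I t) (m 2^-1 - I 2^-1)
  (@continuous_sub _ (subspace `[0 : R, 1 : R]) _ _ cmg cI) (fun t t01 => key _ _ t01 h2).
have I0 : I 0 = 0 by rewrite /I set_itvoo0 integral_set0.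
move=> t t01; have := cst01 t t01; have := cst01 0; rewrite lexx ler01 => /(_ isT) <-.
rewrite I0 subr0 -/(m t) -/(m 0) => mt.
have -> : m t - m 0 = I t by lra.
rewrite /I fineK//; apply: integrable_fin_num => //; apply: iFs => //.
by case/andP: t01.
Qed.
End WeakToIntegrated.

(** * From the integrated to the weak continuity equation *)

Section TimeDependentTests.
Context (R : realType) (d : nat) (z : Rd R d -> R -> R).
Hypothesis Cz : C1c 1 z.

Lemma C1c_support : exists2 r, 0 < r & forall x t, z x t != 0 -> enorm x < r /\ 0 < t < 1.
Proof.
have [_ _ _ cK sub] := Cz.
have cF : compact (fst @` closure [set q : Rd R d * R | z q.1 q.2 != 0]).
  by apply: continuous_compact => //; apply: continuous_subspaceT => q; exact: cvg_fst.
have [r r0 H] := compact_enorm_bounded cF; exists r => // x t zx.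
have cxt : closure [set q : Rd R d * R | z q.1 q.2 != 0] (x, t) by exact: subset_closure.
by split; [apply: H; exists (x, t)|exact: (sub _ cxt)].
Qed.

Lemma continuous_slice (f : Rd R d -> R -> R) (t : R) :
  continuous (fun q : Rd R d * R => f q.1 q.2) -> continuous (fun x => f x t).
Proof.
move=> cf x; have h : (y, t) @[y --> x] --> (x, t).
  by apply: (@cvg_pair _ _ _ (nbhs x) (nbhs x) (nbhs t) _ _ _ id (cst t)); [exact: cvg_id|exact: cvg_cst].
exact: (cvg_comp _ _ h (cf (x, t))).
Qed.

Lemma continuous_time_slice (f : Rd R d -> R -> R) (x : Rd R d) :
  continuous (fun q : Rd R d * R => f q.1 q.2) -> continuous (f x).
Proof.
move=> cf t; have h : (x, s) @[s --> t] --> (x, t).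
  by apply: (@cvg_pair _ _ _ (nbhs t) (nbhs x) (nbhs t) _ _ _ (cst x) id); [exact: cvg_cst|exact: cvg_id].
exact: (cvg_comp _ _ h (cf (x, t))).
Qed.

Lemma C1c_with t : C1with (fun x => z x t) (fun i x => dxi z i x t).
Proof.
have [cz [Dx _] [cdx _] _ _] := Cz; split=> [|i|x i].
- exact: (continuous_slice cz).
- exact: (continuous_slice (cdx i)).
- by have /derivableP := Dx x t i; rewrite /dxi derive1E.
Qed.

Lemma C1c_is_derive_time x t : is_derive t (1 : R) (z x) (dtm z x t).
Proof.
have [_ [_ Dt] _ _ _] := Cz.
have /derivableP := Dt x t; rewrite -derive1E -/(dtm z x t) => D.
have D' : is_derive (- t + t) (1 : R) (fun s => z x (t + s)) (dtm z x t) by rewrite addNr.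
have := is_derive_translate D'.
by congr is_derive; apply/funext => s; rewrite addrA subrr add0r.
Qed.

Lemma slab_bounded (f : Rd R d * R -> R) (r : R) : continuous f ->
  exists2 C, 0 < C & forall x t, enorm x <= r -> 0 <= t <= 1 -> `|f (x, t)| <= C.
Proof.
move=> cf; have cK : compact ([set x : Rd R d | enorm x <= r] `*` `[0 : R, 1 : R]%classic).
  by apply: compact_setX; [exact: compact_enorm_le|exact: segment_compact].
have /compact_bounded[M [_ HM]] : compact (f @`
    ([set x : Rd R d | enorm x <= r] `*` `[0 : R, 1 : R]%classic)).
  by apply: continuous_compact => //; exact: continuous_subspaceT.
exists (Num.max M 0 + 1) => [|x t xr t01]; first by rewrite ltr_wpDl// le_max lexx orbT.
apply: HM => /=; first by rewrite ltr_pwDr// le_max lexx.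
by exists (x, t) => //; split => //=; rewrite in_itv.
Qed.

Lemma C1c_dtm_vanish r t : (forall t, vanish r (fun x => z x t)) -> vanish r (fun x => dtm z x t).
Proof.
move=> zv x rx; have D := C1c_is_derive_time x t.
have zx : z x = cst 0 by apply/funext => s; rewrite zv.
rewrite zx in D.
by rewrite -(@derive_val _ _ _ _ _ _ _ D) derive_cst.
Qed.

Lemma C1c_data k : exists r C, [/\ 0 < r, 0 < C,
  (forall t, vanish r (fun x => z x t)),
  (forall i x t, 0 <= t <= 1 -> `|dxi z i x t| <= C * cutoff r x ^+ k) &
  (forall x t, 0 <= t <= 1 -> `|dtm z x t| <= C * cutoff r x ^+ k)].
Proof.
have [cz _ [cdx cdt] _ _] := Cz.
have [r r0 H] := C1c_support.
have zv t : vanish r (fun x => z x t).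
  by move=> x rx; apply/eqP; apply: contraT => /H[]; rewrite ltNge rx.
have /choice[Cx HCx] (i : 'I_d) : exists C, 0 < C /\
    forall x t, enorm x <= r -> 0 <= t <= 1 -> `|dxi z i x t| <= C.
  by have [C C0 HC] := slab_bounded r (cdx i); exists C.
have [Ct Ct0 HCt] := slab_bounded r cdt.
pose C := Ct + \sum_(i < d) Cx i.
have S0 : 0 <= \sum_(i < d) Cx i by apply: sumr_ge0 => i _; apply: ltW; case: (HCx i).
have CxC i : Cx i <= C.
  rewrite /C (bigD1 i)//= addrCA lerDl addr_ge0 ?(ltW Ct0)//.
  by apply: sumr_ge0 => j _; apply: ltW; case: (HCx j).
have C0 : 0 < C by rewrite ltr_pwDl.
have c1 x : enorm x <= r -> C <= C * cutoff r x ^+ k.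
  by move=> xr; rewrite ler_peMr ?(ltW C0)// exprn_ege1// cutoff_ge1.
have cp x : 0 <= C * cutoff r x ^+ k by rewrite mulr_ge0 ?(ltW C0)// exprn_ge0// cutoff_ge0.
exists r, C; split => // [i x t t01|x t t01].
- have [rx|xr] := ltP r (enorm x).
    by rewrite (C1with_vanish i (C1c_with t) (zv t) rx) normr0.
  apply: le_trans (c1 _ x xr); apply: le_trans (CxC i).
  by case: (HCx i) => _ /(_ x t xr t01).
- have [xr|rx] := leP (enorm x) r.
    apply: le_trans (c1 _ x xr); apply: (le_trans (HCt x t xr t01)).
    by rewrite lerDl.
  by rewrite (C1c_dtm_vanish _ zv) ?normr0// ltW.
Qed.

Lemma C1c_dtm_uniform r k t e : 0 < r -> (forall t, vanish r (fun x => z x t)) -> 0 < e ->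
  exists2 a, 0 < a & forall s, `|t - s| < a -> forall x,
    `|dtm z x s - dtm z x t| <= e * cutoff r x ^+ k.
Proof.
move=> r0 zv e0; have [_ _ [_ cdt] _ _] := Cz.
have := (compact_near_coveringP _).1 (@compact_enorm_le R d r) R (nbhs t)
  (fun s x => `|dtm z x s - dtm z x t| <= e) _.
case=> [x _|].
  have e20 : 0 < e / 2 by rewrite divr_gt0.
  have := cdt (x, t) => /cvgrPdist_le/(_ _ e20) => -[[A B]/= [nA nB] AB].
  have nA' := nA; exists (A, B) => //= -[y s]/= [Ay Bs].
  have h1 := AB (y, s) (conj Ay Bs).
  have h2 := AB (y, t) (conj Ay (nbhs_singleton nB)).
  move: h1 h2; rewrite /= !ler_norml => /andP[? ?] /andP[? ?].
  by apply/andP; split; lra.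
move=> a a0 H; exists a => // s ts x.
have [xr|rx] := leP (enorm x) r; last first.
  by rewrite !(C1c_dtm_vanish _ zv) ?(ltW rx)// subrr normr0 mulr_ge0 ?(ltW e0)// exprn_ge0// cutoff_ge0.
apply: (le_trans (H s ts x xr)).
by rewrite ler_peMr ?(ltW e0)// exprn_ege1// cutoff_ge1.
Qed.

Lemma C1c_mean_value x a b : a < b ->
  exists2 c, a < c < b & z x b - z x a = dtm z x c * (b - a).
Proof.
move=> ab.
have [|c cab E] := @MVT R (z x) (dtm z x) a b ab (fun t _ => C1c_is_derive_time x t).
  apply: continuous_subspaceT => t.
  by have [cz _ _ _ _] := Cz; exact: (continuous_time_slice cz).
by exists c => //; move: cab; rewrite in_itv.
Qed.
End TimeDependentTests.

Lemma measurable_fun_nat_index d1 d2 (T1 : measurableType d1) (T2 : measurableType d2)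
    (D : set T1) (u : T1 -> nat) (G : nat -> T1 -> T2) :
  (forall k, measurable (D `&` u @^-1` [set k])) -> (forall k, measurable_fun D (G k)) ->
  measurable_fun D (fun x => G (u x) x).
Proof.
move=> mu mG.
have DE : D = \bigcup_k (D `&` u @^-1` [set k]).
  apply/seteqP; split => [x Dx|x [k _ []]//]; by exists (u x).
rewrite DE; apply/measurable_fun_bigcup => // k.
apply: (eq_measurable_fun (G k)); first by move=> x; rewrite inE => -[_ /= ->].
by apply: measurable_funS (mG k) => //; rewrite DE; apply: bigcup_measurable => j _.
Qed.

Section IntegratedToWeak.
Context (R : realType) (d : nat) (p : R) (phi : R -> Rd R d -> R) (gamma : Meas R d).
Hypotheses (p1 : 1 < p) (adm : admissible p phi) (rg : radon gamma).
Implicit Types (mu : R -> Meas R d) (nu : R -> vmeasure R d).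
Notation leb := (@lebesgue_measure R).
Local Notation mass := (@mass R d p).
Local Notation kexp := (kexp p).

Lemma tv_ge0 (n : vmeasure R d) (A : set (RdB R d)) : measurable A -> (0 <= tv n A)%E.
Proof.
move=> mA; pose F (k : nat) : set (RdB R d) := if k == 0%N then A else set0.
apply: (@le_trans _ _ (\sum_(0 <= k <oo) (enorm (\row_i vmeas n (F k) i))%:E)%E).
  by apply: nneseries_ge0 => k _ _; rewrite lee_fin enorm_ge0.
apply: ereal_sup_ubound; exists F; split => //.
- by move=> k; rewrite /F; case: ifP.
- apply/trivIsetP => i j _ _ ij; rewrite /F.
  have [i0|i0] := eqVneq i 0%N; last by rewrite set0I.
  have [j0|j0] := eqVneq j 0%N; last by rewrite setI0.
  by rewrite i0 j0 eqxx in ij.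
- apply/seteqP; split => [x [k _]|x Ax]; last by exists 0%N.
  by rewrite /F; case: ifP.
Qed.

Section Discretization.
Variables (mu : R -> Meas R d) (nu : R -> vmeasure R d) (z : Rd R d -> R -> R).
Hypotheses (cu : curve phi gamma mu nu) (fl : flows mu nu) (Cz : C1c 1 z).

(** On a grid of mesh [1 / (n + 1)] the flux term [Fn] freezes [z] at the left end of the cell, and
    the difference quotient [Dn] of [z] is paired with [mu] at the right end. This is a discrete
    product rule: over a cell the two integrals add up to exactly the increment of the pairing of
    [mu] with [z]. *)
Let tau (n k : nat) : R := k%:R / n.+1%:R.
Let idx (n : nat) (s : R) : nat := Num.truncn (n.+1%:R * s).
Let w (t : R) (i : 'I_d) (x : Rd R d) : R := dxi z i x t.
Let Fn n s := flux (nu s) (w (tau n (idx n s))).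
Let Dk n k := n.+1%:R * (pairing (mu (tau n k.+1)) (fun x => z x (tau n k.+1)) -
                         pairing (mu (tau n k.+1)) (fun x => z x (tau n k))).
Let Dn n s := Dk n (idx n s).

Let tauS n k : tau n k.+1 = tau n k + n.+1%:R^-1.
Proof. by rewrite /tau -natr1 mulrDl mul1r. Qed.

Let tau_ge0 n k : 0 <= tau n k. Proof. by rewrite /tau divr_ge0. Qed.

Let tau_le1 n k : (k <= n.+1)%N -> tau n k <= 1.
Proof. by move=> kn; rewrite ler_pdivrMr// mul1r ler_nat. Qed.

Let tau_ltS n k : tau n k < tau n k.+1.
Proof. by rewrite tauS ltrDl invr_gt0. Qed.

Let idx_eq n k s : tau n k <= s < tau n k.+1 -> idx n s = k.
Proof.
rewrite /tau ler_pdivrMr// ltr_pdivlMr// => /andP[h1 h2].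
by apply: truncn_def; rewrite mulrC h1.
Qed.

Let idx_itv n s : 0 < s < 1 ->
  [/\ (idx n s < n.+1)%N, tau n (idx n s) <= s & s < tau n (idx n s).+1].
Proof.
move=> /andP[s0 s1].
have h : 0 <= n.+1%:R * s by rewrite mulr_ge0// ltW.
have /andP[h1 h2] := truncn_itv h; split.
- by rewrite /idx truncn_lt_nat// gtr_pMr.
- by rewrite /tau ler_pdivrMr// mulrC.
- by rewrite /tau ltr_pdivlMr// mulrC.
Qed.

Let midx n k : measurable (`]0 : R, 1 : R[ `&` idx n @^-1` [set k]).
Proof.
rewrite (_ : _ `&` _ = `]0 : R, 1 : R[ `&` `[tau n k, tau n k.+1[); first exact: measurableI.
apply/seteqP; split => s /= []; rewrite !in_itv/= => s01.
  by have [_ h1 h2] := idx_itv n s01 => <-; rewrite h1 h2.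
by move=> h; split => //; exact: idx_eq.
Qed.

Let cw t i : Cc (w t i).
Proof.
have [r [C [r0 _ zv _ _]]] := C1c_data Cz 0.
exact: (C1with_Cc i (C1c_with Cz t) (zv t)).
Qed.

Let cz t : Cc (fun x => z x t).
Proof.
have [r [C [r0 _ zv _ _]]] := C1c_data Cz 0.
by apply: (vanish_Cc _ (zv t)); case: (C1c_with Cz t).
Qed.

Let mFn n : measurable_fun `]0 : R, 1 : R[ (Fn n).
Proof.
apply: (@measurable_fun_nat_index _ _ _ _ `]0 : R, 1 : R[%classic (idx n)
  (fun k s => flux (nu s) (w (tau n k)))) => k; first exact: midx.
exact: (measurable_flux cu (cw (tau n k))).
Qed.

Let mDn n : measurable_fun `]0 : R, 1 : R[ (Dn n).
Proof.
apply: (@measurable_fun_nat_index _ _ _ _ `]0 : R, 1 : R[%classic (idx n)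
  (fun k s => Dk n k)) => k; [exact: midx|exact: measurable_cst].
Qed.

Let telescope n k : (k <= n.+1)%N ->
  (\int[leb]_(s in `]0%R, tau n k[) (Fn n s + Dn n s)%:E =
   (pairing (mu (tau n k)) (fun x => z x (tau n k)))%:E)%E.
Proof.
have [r0 r00 zs] := C1c_support Cz.
elim: k => [_|k ih kn].
  rewrite /tau mul0r set_itvoo0 integral_set0 /pairing; congr EFin.
  rewrite (_ : (fun x => _) = cst 0%E) ?integral_cst0// ?integral0//.
  by apply/funext => x /=; congr EFin; apply/eqP; apply: contraT => /zs[_];
    rewrite ltxx.
have [r [C [_ _ zv _ _]]] := C1c_data Cz 0.
have t1 : tau n k.+1 <= 1 by exact: tau_le1.
have lt := tau_ltS n k.
rewrite (integral_itv_split (tau_ge0 n k) (ltW lt)); last first.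
  apply: (@measurable_funS _ _ _ _ `]0 : R, 1 : R[%classic) => //.
    by move=> x/=; rewrite !in_itv/= => /andP[-> xt]; exact: lt_le_trans t1.
  by apply/measurable_EFinP; exact: measurable_funD.
rewrite ih; last exact: ltnW.
have -> : (\int[leb]_(s in `]tau n k, tau n k.+1[) (Fn n s + Dn n s)%:E =
    \int[leb]_(s in `]tau n k, tau n k.+1[) ((flux (nu s) (w (tau n k)))%:E + cst (Dk n k)%:E s))%E.
  apply: eq_integral => s; rewrite inE/= in_itv/= => /andP[s0 s1].
  by rewrite /Fn /Dn (@idx_eq n k s) ?EFinD// (ltW s0) s1.
have iw : leb.-integrable `]tau n k, tau n k.+1[ (fun s => (flux (nu s) (w (tau n k)))%:E).
  apply: integrableS (integrable_flux p1 adm rg cu (C1c_with Cz (tau n k)) (zv (tau n k))) => //.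
  move=> x/=; rewrite !in_itv/= => /andP[h1 h2].
  by rewrite (le_lt_trans (tau_ge0 n k) h1) (lt_le_trans h2 t1).
have lI : leb `]tau n k, tau n k.+1[%classic = (n.+1%:R^-1)%:E.
  by rewrite lebesgue_measure_itv/= lte_fin lt -EFinD tauS addrAC subrr add0r.
have ic : leb.-integrable `]tau n k, tau n k.+1[ (cst (Dk n k)%:E).
  apply/integrableP; split; first exact: measurable_cst.
  rewrite [X in (X < _)%E](_ : _ = (`|Dk n k|%:E * (n.+1%:R^-1)%:E)%E) ?ltry//.
  by rewrite -lI -integral_cst//.
rewrite integralD// (flows_itv p1 adm rg cu fl (C1c_with Cz (tau n k)) (zv (tau n k)))//; last exact: ltW.
have -> : (\int[leb]_(s in `]tau n k, tau n k.+1[) cst (Dk n k)%:E s =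
    (Dk n k * n.+1%:R^-1)%:E)%E.
  rewrite integral_cst// -[RHS]/((Dk n k)%:E * (n.+1%:R^-1)%:E)%E.
  by congr (_ * _)%E; exact: lI.
by rewrite -!EFinD; congr EFin; rewrite /Dk; field.
Qed.

Lemma flows_weak :
  (\int[leb]_(t in `]0%R, 1%R[) (pairing (mu t) (fun x => dtm z x t))%:E
    + \int[leb]_(t in `]0%R, 1%R[) (flux (nu t) (fun i x => dxi z i x t))%:E = 0)%E.
Proof.
have [r [C [r0 C0 zv xC tC]]] := C1c_data Cz kexp.
have [c c01 mc] := curve_mass_max p r0 cu.
pose S := mass r (mu c); have S0 : 0 <= S by exact: mass_ge0.
have [[rm rn] cm _ aoo] := cu.
have [czz _ [cdx cdt] _ _] := Cz.
have tau01 n k : (k <= n.+1)%N -> 0 <= tau n k <= 1.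
  by move=> kn; rewrite tau_ge0 tau_le1.
have cutk (x : Rd R d) : 0 <= cutoff r x ^+ kexp by rewrite exprn_ge0// cutoff_ge0.
(* One factor of the cutoff, at most 2, is given up to reach the exponent in [flux_bound]. *)
have wC t i x : 0 <= t <= 1 -> `|w t i x| <= (2 * C) * cutoff r x ^+ kexp.-1.
  move=> t01; apply: (le_trans (xC i x t t01)).
  rewrite -(prednK (_ : 0 < kexp)%N)// exprS /= mulrA ler_wpM2r//.
    by rewrite exprn_ge0// cutoff_ge0.
  by rewrite mulrC ler_wpM2r ?(ltW C0)// cutoff_le2.
have tau_near (s a : R) : 0 < s < 1 -> 0 < a -> \forall n \near \oo,
    `|s - tau n (idx n s)| < a /\ `|s - tau n (idx n s).+1| < a.
  move=> s01 a0; have := near_scale 1 a0; apply: filterS => n na.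
  have [_ h1 h2] := idx_itv n s01; rewrite mul1r in na.
  have h3 := h2; rewrite tauS in h3.
  have h4 : tau n (idx n s).+1 <= s + n.+1%:R^-1 by rewrite tauS lerD2r.
  rewrite ger0_norm ?subr_ge0// ltr0_norm ?subr_lt0// opprB; split.
    by apply: le_lt_trans na; rewrite lerBlDl ltW.
  by apply: le_lt_trans na; rewrite lerBlDl.
have cF s : 0 < s < 1 -> Fn n s @[n --> \oo] --> flux (nu s) (w s).
  move=> s01; apply: (@flux_cvg _ _ (nu s) (fun n => w (tau n (idx n s))) (w s) (r + 1)
    (2 * C * 2 ^+ kexp.-1)).
  - exact: rn.
  - by move=> n i; exact: cw.
  - move=> n i x rx; apply: (C1with_vanish i (C1c_with Cz _) (zv _)).
    by apply: lt_le_trans rx; rewrite ltrDl.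
  - move=> n i x; have [h _ _] := idx_itv n s01.
    apply: (le_trans (wC _ i x (tau01 n _ (ltnW h)))).
    rewrite ler_wpM2l ?mulr_ge0 ?(ltW C0)//.
    by rewrite lerXn2r ?nnegrE ?cutoff_ge0// cutoff_le2.
  - move=> i x; have cti : dxi z i x u @[u --> s] --> dxi z i x s.
      exact: (continuous_time_slice (cdx i)).
    apply: (@cvg_comp _ _ _ (fun n => tau n (idx n s)) (dxi z i x) _ (nbhs s)); last exact: cti.
    by apply/cvgrPdist_lt => a a0; apply: filterS (tau_near s a s01 a0) => n [].
(* By the mean value theorem [Dn] pairs the measure at the right end of the cell with [dtm z] at
   intermediate times. Replacing these times by [s] costs [e / 2], by uniform continuity and the
   mass bound [S]; moving the measure to time [s] costs [e / 2], by weak continuity of [mu]. *)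
have cD s : 0 < s < 1 -> Dn n s @[n --> \oo] --> pairing (mu s) (fun x => dtm z x s).
  move=> s01; pose q x := dtm z x s.
  have cq : Cc q.
    by apply: (@vanish_Cc _ _ r); [exact: (continuous_slice cdt)|exact: C1c_dtm_vanish].
  apply/cvgrPdist_le => e e0.
  have e2 : 0 < e / 2 by rewrite divr_gt0.
  have e3 : 0 < e / (2 * (S + 1)) by rewrite divr_gt0// mulr_gt0// ltr_wpDl.
  have [a a0 Ha] := C1c_dtm_uniform Cz kexp s r0 zv e3.
  have := (continuous_within_itvP _ ltr01).1 (cm q cq) => -[hq _ _].
  have s01' : s \in `]0 : R, 1 : R[ by rewrite in_itv.
  have /cvgrPdist_le/(_ _ e2) := hq s s01'; rewrite -filter_from_ballE => -[b b0 Hb].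
  near=> n.
  have [kn h1 h2] := idx_itv n s01.
  have [na1 nb1] : `|s - tau n (idx n s)| < a /\ `|s - tau n (idx n s).+1| < a.
    by near: n; exact: tau_near.
  have [_ nb] : `|s - tau n (idx n s)| < b /\ `|s - tau n (idx n s).+1| < b.
    by near: n; exact: tau_near.
  set k := idx n s in kn h1 h2 na1 nb1 nb.
  have rk : radon (mu (tau n k.+1)) by apply: rm; exact: tau01.
  have n0 : 0 < n.+1%:R^-1 :> R by rewrite invr_gt0.
  have E : Dn n s - pairing (mu (tau n k.+1)) q = n.+1%:R * pairing (mu (tau n k.+1))
      (fun x => (z x (tau n k.+1) - z x (tau n k)) - n.+1%:R^-1 * q x).
    rewrite /Dn -/k /Dk pairingB//; [|exact: CcB|exact: CcZ].
    by rewrite pairingB// pairingZ//; field.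
  have B : `|Dn n s - pairing (mu (tau n k.+1)) q| <= e / 2.
    rewrite E normrM ger0_norm//.
    apply: (@le_trans _ _ (n.+1%:R * pairing (mu (tau n k.+1))
        (fun x => (n.+1%:R^-1 * (e / (2 * (S + 1)))) * cutoff r x ^+ kexp))).
      rewrite ler_wpM2l//; apply: norm_pairing_le => //.
      - by apply: CcB; [exact: CcB|exact: CcZ].
      - by apply: CcZ; exact: Cc_mass.
      - move=> x; have [y /andP[y1 y2] ->] := C1c_mean_value Cz x (tau_ltS n k).
        rewrite [in X in _ * X - _]tauS [_ + _ - tau n k]addrAC subrr add0r mulrC -mulrBr.
        rewrite normrM ger0_norm ?(ltW n0)// -mulrA ler_wpM2l ?(ltW n0)//.
        apply: Ha; move: na1 nb1; rewrite !ltr_norml => /andP[? ?] /andP[? ?].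
        by apply/andP; split; lra.
    rewrite pairingZ//; last exact: Cc_mass.
    rewrite mulrA mulrA divff ?mul1r; last by rewrite lt0r_neq0.
    apply: (@le_trans _ _ (e / (2 * (S + 1)) * (S + 1))).
      rewrite ler_wpM2l ?(ltW e3)// ler_wpDr//.
      exact: (mc _ (tau01 n _ kn)).
    by rewrite (_ : _ * _ = e / 2)//; field; rewrite gt_eqF// ltr_wpDl.
  have := Hb (tau n k.+1) nb; move: B; rewrite -/q /= !ler_norml => /andP[? ?] /andP[? ?].
  by apply/andP; split; lra.
have HI (t : R) : `]0 : R, 1 : R[%classic t -> 0 < t < 1 by rewrite /= in_itv.
have bD n s : 0 < s < 1 -> `|Dn n s| <= C * S.
  move=> s01; have [kn h1 h2] := idx_itv n s01; rewrite /Dn; set k := idx n s in kn h1 h2 *.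
  have rk : radon (mu (tau n k.+1)) by apply: rm; exact: tau01.
  have n0 : 0 < n.+1%:R^-1 :> R by rewrite invr_gt0.
  rewrite /Dk -pairingB// normrM ger0_norm//.
  apply: (@le_trans _ _ (n.+1%:R * pairing (mu (tau n k.+1))
      (fun x => (n.+1%:R^-1 * C) * cutoff r x ^+ kexp))).
    rewrite ler_wpM2l//; apply: norm_pairing_le => //.
    - exact: CcB.
    - by apply: CcZ; exact: Cc_mass.
    - move=> x; have [y /andP[y1 y2] ->] := C1c_mean_value Cz x (tau_ltS n k).
      rewrite [in X in _ * X]tauS [_ + _ - tau n k]addrAC subrr add0r mulrC.
      rewrite normrM ger0_norm ?(ltW n0)// -mulrA ler_wpM2l ?(ltW n0)//.
      apply: tC; have /andP[? ?] := tau01 n _ kn; have := tau_ge0 n k.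
      by move=> ?; apply/andP; split; lra.
  rewrite pairingZ//; last exact: Cc_mass.
  rewrite mulrA mulrA divff ?mul1r; last by rewrite lt0r_neq0.
  by rewrite ler_wpM2l ?(ltW C0)//; exact: (mc _ (tau01 n _ kn)).
have [M M0 HM] := flux_bound p1 adm rg r0 ltr01 (mulr_gt0 (ltr0n _ 2) C0).
(* The action integrand bounds all [Fn n] at once but is not known to be measurable. Their countable
   supremum is, and its integral is bounded by the action. *)
pose G s := esups (fun n => `|Fn n s|%:E) 0.
have G0 s : (0 <= G s)%E.
  apply: (@le_trans _ _ `|Fn 0%N s|%:E); first by rewrite lee_fin.
  by apply: ereal_sup_ubound; exists 0%N.
have FG n s : (`|Fn n s|%:E <= G s)%E by apply: ereal_sup_ubound; exists n.
have iG : leb.-integrable `]0 : R, 1 : R[ G.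
  apply/integrableP; split.
    apply: measurable_fun_esups => n; apply/measurable_EFinP.
    by apply: measurableT_comp => //; exact: mFn.
  rewrite (_ : (fun s => `|G s|%E) = G); last by apply/funext => s; rewrite gee0_abs.
  apply: (@le_lt_trans _ _ (M%:E * action phi gamma mu nu + (mass r gamma + S)%:E)%E).
    apply: (lower_integral_action_le p1 adm) => // [|t t01].
      by rewrite addr_ge0// mass_ge0.
    rewrite G0/=; apply: ge_ereal_sup => _ [n _ <-].
    have t01' : 0 <= t <= 1 by case/andP: t01 => /ltW-> /ltW->.
    have [kn _ _] := idx_itv n t01.
    apply: (le_trans (HM (mu t) (nu t) _ (rm t t01') (rn t t01) (cw _)
      (fun i x => wC _ i x (tau01 n _ (ltnW kn))))).
    by rewrite leeD2l// mul1r lee_fin lerD2l; exact: mc.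
  by rewrite lte_add_pinfty ?ltry// lte_mul_pinfty ?lee_fin ?(ltW M0).
have [iF cvF] := @dominated_cvg_EFin _ _ R leb `]0 : R, 1 : R[%classic Fn _ G
  (measurable_itv _) mFn (fun s h => cF s (HI s h)) iG
  (fun n s _ => FG n s).
have iC : leb.-integrable `]0 : R, 1 : R[ (fun _ => (C * S)%:E).
  by apply: continuous_itv_integrable; apply: continuous_subspaceT; exact: continuous_const.
have [iD cvD] := @dominated_cvg_EFin _ _ R leb `]0 : R, 1 : R[%classic Dn _
  (fun=> (C * S)%:E) (measurable_itv _) mDn (fun s h => cD s (HI s h)) iC
  (fun n s h => bD n s (HI s h)).
have iFn n : leb.-integrable `]0 : R, 1 : R[ (fun s => (Fn n s)%:E).
  apply: (le_integrable _ _ _ iG) => //; first by apply/measurable_EFinP; exact: mFn.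
  by move=> s _; rewrite abse_EFin (gee0_abs (G0 s)).
have iDn n : leb.-integrable `]0 : R, 1 : R[ (fun s => (Dn n s)%:E).
  apply: (le_integrable _ _ _ iC) => //; first by apply/measurable_EFinP; exact: mDn.
  move=> s h; rewrite !abse_EFin lee_fin; apply: (le_trans (bD n s (HI s h))).
  exact: ler_norm.
have sum0 n : (\int[leb]_(s in `]0%R, 1%R[) (Dn n s)%:E + \int[leb]_(s in `]0%R, 1%R[) (Fn n s)%:E = 0)%E.
  have e := @integralD _ _ R leb `]0 : R, 1 : R[%classic (measurable_itv _) _ _ (iFn n) (iDn n).
  apply: etrans (addeC _ _) _; apply: etrans (esym e) _.
  have h := telescope (leqnn n.+1).
  have t1 : tau n n.+1 = 1 by rewrite /tau divff.
  rewrite t1 in h; apply: etrans h _; congr EFin; rewrite /pairing.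
  rewrite (_ : (fun x => _) = cst 0%E) ?integral0//.
  have [r1 _ zs] := C1c_support Cz.
  by apply/funext => x /=; congr EFin; apply/eqP; apply: contraT => /zs[_];
    rewrite ltxx andbF.
have fin1 : (\int[leb]_(t in `]0%R, 1%R[) (pairing (mu t) (fun x => dtm z x t))%:E)%E \is a fin_num.
  exact: integrable_fin_num.
have fin2 : (\int[leb]_(t in `]0%R, 1%R[) (flux (nu t) (w t))%:E)%E \is a fin_num.
  exact: integrable_fin_num.
have := cvgeD (fin_num_adde_defr _ fin1) cvD cvF.
rewrite (_ : (fun n => _) = (fun _ : nat => 0%E)); last by apply/funext => n; exact: sum0.
move=> h; have h1 : (fun _ : nat => 0%E : \bar R) x @[x --> \oo] -->
    (\int[leb]_(t in `]0%R, 1%R[) (pairing (mu t) (fun x => dtm z x t))%:E +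
     \int[leb]_(t in `]0%R, 1%R[) (flux (nu t) (w t))%:E)%E by exact: h.
have h2 : (fun _ : nat => 0%E : \bar R) x @[x --> \oo] --> (0%E : \bar R).
  exact: cvg_cst.
exact: (@cvg_unique _ (@ereal_hausdorff R) _ _ _ _ h1 h2).
Unshelve. all: by end_near. Qed.
End Discretization.

Lemma flows_CE mu nu : curve phi gamma mu nu -> flows mu nu -> CE 1 mu nu.
Proof.
move=> cu fl; have [[rm rn] cm mm aoo] := cu; split => //.
- move=> r r0; have [M M0 H] := tv_bound p1 adm rg r0.
  have [c c01 mc] := curve_mass_max p r0 cu.
  apply: (@le_lt_trans _ _ (M%:E * action phi gamma mu nu + (mass r gamma + mass r (mu c))%:E)%E).
    apply: (lower_integral_action_le p1 adm) => // [|t t01].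
      by rewrite addr_ge0// mass_ge0.
    have t01' : 0 <= t <= 1 by case/andP: t01 => /ltW-> /ltW->.
    rewrite tv_ge0 ?(le_trans (H _ _ (rm t t01') (rn t t01)))//; last exact: measurable_Eball.
    by rewrite leeD2l// lee_fin lerD2l; exact: mc.
  by rewrite lte_add_pinfty ?ltry// lte_mul_pinfty ?lee_fin ?(ltW M0).
- by move=> z Cz; exact: flows_weak.
Qed.
End IntegratedToWeak.

(** * Reparametrization and concatenation *)

Section AffineReparametrization.
Context (R : realType) (d : nat) (p : R) (phi : R -> Rd R d -> R) (gamma : Meas R d).
Hypotheses (p1 : 1 < p) (adm : admissible p phi) (rg : radon gamma).
Variables (mu : R -> Meas R d) (nu : R -> vmeasure R d).
Hypotheses (cu : curve phi gamma mu nu) (fl : flows mu nu).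
Variables (a b s0 s1 : R).
(** [b] may be negative, which reverses time. Only the ends of [[s0, s1]] are required to be sent
    into [[0, 1]]; the points between follow. *)
Let theta (t : R) := a + b * t.
Hypotheses (b0 : b != 0) (th0 : 0 <= theta s0 <= 1) (th1 : 0 <= theta s1 <= 1).
Notation leb := (@lebesgue_measure R).

Let theta_cc t : s0 <= t <= s1 -> 0 <= theta t <= 1.
Proof.
move=> /andP[h0 h1]; move: th0 th1; rewrite /theta.
have [b1|b1] := leP 0 b.
  have := ler_wpM2l b1 h0; have := ler_wpM2l b1 h1.
  by move=> ? ? /andP[? ?] /andP[? ?]; apply/andP; split; lra.
have := ler_wnM2l (ltW b1) h0; have := ler_wnM2l (ltW b1) h1.
by move=> ? ? /andP[? ?] /andP[? ?]; apply/andP; split; lra.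
Qed.

Let b_neq : 0 = b -> False.
Proof. by move=> h; move: b0; rewrite -h eqxx. Qed.

Let theta_oo t : s0 < t < s1 -> 0 < theta t < 1.
Proof.
move=> /andP[h0 h1]; move: th0 th1; rewrite /theta.
have [b1|b1|b1] := ltgtP 0 b.
- have : b * s0 < b * t by rewrite ltr_pM2l.
  have : b * t < b * s1 by rewrite ltr_pM2l.
  by move=> ? ? /andP[? ?] /andP[? ?]; apply/andP; split; lra.
- have : b * t < b * s0 by rewrite ltr_nM2l.
  have : b * s1 < b * t by rewrite ltr_nM2l.
  by move=> ? ? /andP[? ?] /andP[? ?]; apply/andP; split; lra.
- by have := b_neq b1.
Qed.

Let theta_oo_sub : `]s0, s1[ `<=` theta @^-1` (`]0 : R, 1 : R[).
Proof. by move=> t /=; rewrite !in_itv/=; exact: theta_oo. Qed.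

Lemma affine_pairing_continuous f : Cc f ->
  {within `[s0, s1], continuous (fun t => pairing (mu (theta t)) f)}.
Proof.
move=> cf; have [_ /(_ f cf) h _ _] := cu.
apply/subspace_continuousP => t /= ts.
have tt : `[0 : R, 1 : R]%classic (theta t).
  by rewrite /= in_itv/=; apply: theta_cc; move: ts; rewrite in_itv.
have ht := (subspace_continuousP _ _).1 h (theta t) tt.
apply: cvg_trans ht => P /= hP.
have ct : theta x @[x --> t] --> theta t.
  by apply: cvgD; [exact: cvg_cst|apply: cvgMr; exact: cvg_id].
have H : nbhs t (theta @^-1` _) := ct _ hP.
apply: (@filterS _ (nbhs t) (nbhs_filter t) _ _ _ H) => x /= Hx xs; apply: Hx.
by rewrite in_itv/=; apply: theta_cc; move: xs; rewrite in_itv.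
Qed.

Lemma affine_vint_measurable f i : Cc f ->
  measurable_fun `]s0, s1[ (fun t => vint (vscale b (nu (theta t))) i f).
Proof.
move=> cf; have [_ _ /(_ f i cf) h _] := cu.
rewrite (_ : (fun t => _) = (fun t => b * vint (nu (theta t)) i f)); last first.
  by apply/funext => t; rewrite vint_vscale//; exact: Cc_measurable.
apply: measurable_funM => //.
apply: (@measurable_comp _ _ _ _ _ _ `]0 : R, 1 : R[%classic (fun s => vint (nu s) i f)
  _ theta) => //.
- by move=> _ [t ts <-]; exact: theta_oo_sub.
- by apply: measurable_funTS; exact: measurable_affine.
Qed.

(** The factor [|b|^p] comes from homogeneity in the flux and [1 / |b|] from the change of variable.
    It is an inequality because the image of []s0, s1[] may be a part of []0, 1[] only. *)
Lemma affine_action_le : (\int[leb]_(t in `]s0, s1[)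
   Phi phi gamma (mu (theta t)) (vscale b (nu (theta t))) <=
   (powR `|b| p / `|b|)%:E * action phi gamma mu nu)%E.
Proof.
have nb0 : 0 < `|b| by rewrite normr_gt0.
have bp0 : 0 < powR `|b| p by rewrite powR_gt0.
have P0 m n : (0 <= Phi phi gamma m n)%E by exact: (Phi_ge0 p1 adm).
apply: (@le_trans _ _ (\int[leb]_(t in `]s0, s1[)
    ((powR `|b| p)%:E * Phi phi gamma (mu (theta t)) (nu (theta t))))%E).
  apply: le_lower_integral => t _ //.
  exact: (Phi_vscale_le p1 adm gamma (nu (theta t)) b0 (@meq_refl _ _ (mu (theta t)))).
rewrite lower_integralZl//.
rewrite EFinM -muleA lee_wpmul2l ?lee_fin ?(ltW bp0)//.
have := lower_integral_affine_le a b0 (measurable_itv `]0 : R, 1 : R[)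
  (fun x _ => P0 (mu x) (nu x)).
rewrite -/theta => h.
rewrite -lee_pdivrMl ?invr_gt0// invrK; apply: le_trans h.
rewrite lee_wpmul2l ?lee_fin ?(ltW nb0)//.
rewrite [leLHS]integral_mkcond [leRHS]integral_mkcond.
apply: le_lower_integral => t _; rewrite /patch; first by case: ifP.
case: ifPn => ts; last by case: ifP.
case: ifPn => // /negP[]; rewrite inE; apply: theta_oo_sub.
by move: ts; rewrite inE.
Qed.

Lemma affine_flow g dg r t : C1with g dg -> vanish r g -> s0 <= t <= s1 ->
  (\int[leb]_(s in `]s0, t[) (flux (vscale b (nu (theta s))) dg)%:E)%E =
  (pairing (mu (theta t)) g - pairing (mu (theta s0)) g)%:E.
Proof.
move=> gd gv /andP[t0 t1].
have cdg i : Cc (dg i) by exact: C1with_Cc gd gv.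
pose F s := flux (nu s) dg.
have iF : leb.-integrable `]0 : R, 1 : R[ (fun s => (F s)%:E).
  exact: (integrable_flux p1 adm rg cu gd gv).
(* For [b < 0] the map reverses the order of the two ends. *)
pose x := Num.min (theta s0) (theta t); pose y := Num.max (theta s0) (theta t).
have tc : 0 <= theta t <= 1 by apply: theta_cc; rewrite t0.
have x0 : 0 <= x by rewrite le_min; case/andP: th0 => ->; case/andP: tc.
have y1 : y <= 1 by rewrite ge_max; case/andP: th0 => _ ->; case/andP: tc.
have xy : x <= y by rewrite /x /y ge_min le_max lexx.
have pre : theta @^-1` (`]x, y[%classic) = `]s0, t[%classic.
  apply/seteqP; split => s /=; rewrite !in_itv/= /x /y gt_min lt_max /theta;
    have [b1|b1|b1] := ltgtP 0 b; try by have := b_neq b1.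
  - by rewrite !ltrD2l !(ltr_pM2l b1) => /andP[/orP[h1|h1] /orP[h2|h2]]; apply/andP; split; lra.
  - by rewrite !ltrD2l !(ltr_nM2l b1) => /andP[/orP[h1|h1] /orP[h2|h2]]; apply/andP; split; lra.
  - rewrite !ltrD2l !(ltr_pM2l b1) => /andP[h1 h2]; by rewrite h1 h2 orbT.
  - rewrite !ltrD2l !(ltr_nM2l b1) => /andP[h1 h2]; by rewrite h1 h2 orbT.
have iFxy : leb.-integrable `]x, y[ (fun s => (F s)%:E).
  apply: integrableS iF => // s/=; rewrite !in_itv/= => /andP[h1 h2].
  by rewrite (le_lt_trans x0 h1) (lt_le_trans h2 y1).
have iFt : leb.-integrable `]s0, t[ (fun s => (F (theta s))%:E).
  by have := integrable_affine a b0 (measurable_itv _) iFxy; rewrite -/theta pre.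
have E : (\int[leb]_(s in `]x, y[) (F s)%:E = `|b|%:E * \int[leb]_(s in `]s0, t[) (F (theta s))%:E)%E.
  have /integrableP[mF _] := iFxy.
  by rewrite (integral_affine a b0 _ mF)// -/theta pre.
have fI : (\int[leb]_(s in `]s0, t[) (F (theta s))%:E)%E \is a fin_num.
  exact: integrable_fin_num.
rewrite (flows_itv p1 adm rg cu fl gd gv x0 xy y1) in E.
under eq_integral do rewrite flux_vscale// EFinM.
rewrite integralZl//.
move: E; rewrite -(fineK fI) -!EFinM => -[E]; congr EFin.
move: E; rewrite /x /y; have [b1|b1|b1] := ltgtP 0 b; last by have := b_neq b1.
- have le : theta s0 <= theta t by rewrite lerD2l ler_pM2l.
  by rewrite max_r// min_l// gtr0_norm// => <-.
- have le : theta t <= theta s0 by rewrite lerD2l ler_nM2l.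
  by rewrite max_l// min_r// ltr0_norm// mulNr => h; rewrite -[LHS]opprK -h opprB.
Qed.
End AffineReparametrization.

Section UnitReparametrization.
Context (R : realType) (d : nat) (p : R) (phi : R -> Rd R d -> R) (gamma : Meas R d).
Hypotheses (p1 : 1 < p) (adm : admissible p phi) (rg : radon gamma).
Implicit Types (mu : R -> Meas R d) (nu : R -> vmeasure R d).

Lemma curve_affine mu nu (a b : R) : curve phi gamma mu nu -> flows mu nu ->
  b != 0 -> 0 <= a <= 1 -> 0 <= a + b <= 1 ->
  let mu' t := mu (a + b * t) in let nu' t := vscale b (nu (a + b * t)) in
  [/\ curve phi gamma mu' nu', flows mu' nu' &
      (action phi gamma mu' nu' <= (powR `|b| p / `|b|)%:E * action phi gamma mu nu)%E].
Proof.
move=> cu fl b0 a01 ab01 mu' nu'.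
have th0 : 0 <= a + b * 0 <= 1 by rewrite mulr0 addr0.
have th1 : 0 <= a + b * 1 <= 1 by rewrite mulr1.
have ac := affine_action_le gamma p1 adm mu nu b0 th0 th1.
have [[rm rn] _ _ aoo] := cu.
have in01 t : 0 <= t <= 1 -> 0 <= a + b * t <= 1.
  move=> /andP[t0 t1]; have -> : a + b * t = (1 - t) * a + t * (a + b) by ring.
  case/andP: a01 => ? ?; case/andP: ab01 => ? ?; apply/andP; split; first by nra.
  have : (1 - t) * a <= (1 - t) * 1 by rewrite ler_wpM2l// subr_ge0.
  have : t * (a + b) <= t * 1 by rewrite ler_wpM2l.
  by lra.
have inoo t : 0 < t < 1 -> 0 < a + b * t < 1.
  move=> /andP[t0 t1]; case/andP: a01 => ? ?; case/andP: ab01 => ? ?.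
  have [b1|b1|b1] := ltgtP 0 b; last by rewrite -b1 eqxx in b0.
  - have : 0 < b * t by rewrite mulr_gt0.
    have : b * t < b by rewrite gtr_pMr.
    by move=> ? ?; apply/andP; split; lra.
  - have : b * t < 0 by rewrite nmulr_rlt0.
    have : b < b * t by rewrite -[ltLHS]mulr1 ltr_nM2l.
    by move=> ? ?; apply/andP; split; lra.
split => //.
- split.
  + split => t t01; first exact: rm (in01 _ t01).
    by apply: vradon_vscale; exact: rn (inoo _ t01).
  + by move=> f cf; exact: (affine_pairing_continuous cu th0 th1 cf).
  + by move=> f i cf; exact: (affine_vint_measurable cu b0 th0 th1 i cf).
  + apply: (le_lt_trans ac); rewrite lte_mul_pinfty ?lee_fin ?divr_ge0 ?powR_ge0//.
- move=> g dg r gd gv t t01.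
  have := affine_flow p1 adm rg cu fl b0 th0 th1 gd gv t01.
  by rewrite /mu' mulr0.
Qed.
End UnitReparametrization.

(** * Concatenation of countably many curves *)

Section Concatenation.
Context (R : realType) (d : nat) (p : R) (phi : R -> Rd R d -> R) (gamma : Meas R d).
Hypotheses (p1 : 1 < p) (adm : admissible p phi) (rg : radon gamma).
(** [l k] is the time allotted to the [k]-th curve and [T n] the [n]-th junction time. The junctions
    accumulate at time 1 only, where the limit measure [m1] is attached. *)
Variables (mk : nat -> R -> Meas R d) (nk : nat -> R -> vmeasure R d) (l A : nat -> R) (Z : R)
  (m1 : Meas R d).
Let T (n : nat) : R := \sum_(k < n) l k.
Hypotheses (ck : forall k, curve phi gamma (mk k) (nk k)) (fk : forall k, flows (mk k) (nk k))
  (jn : forall k, meq (mk k 1) (mk k.+1 0)) (l0 : forall k, 0 < l k)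
  (T1 : T n @[n --> \oo] --> (1 : R))
  (aA : forall k, (action phi gamma (mk k) (nk k) <= (A k)%:E)%E)
  (A0 : A n @[n --> \oo] --> (0 : R))
  (sA : forall n, \sum_(k < n) (powR (l k)^-1 p / (l k)^-1 * A k) <= Z)
  (rm1 : radon m1)
  (lim1 : forall f, Cc f -> pairing (mk n 0) f @[n --> \oo] --> pairing m1 f).
Notation leb := (@lebesgue_measure R).

Let TS k : T k.+1 = T k + l k. Proof. by rewrite /T big_ord_recr. Qed.
Let T0 : T 0 = 0. Proof. by rewrite /T big_ord0. Qed.
Let ltTS k : T k < T k.+1. Proof. by rewrite TS ltrDl. Qed.

Let leT j k : (j <= k)%N -> T j <= T k.
Proof.
move=> jk; rewrite -(subnKC jk); elim: (k - j)%N => [|n ih]; first by rewrite addn0.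
by rewrite addnS (le_trans ih)// ltW.
Qed.

Let T_ge0 k : 0 <= T k. Proof. by rewrite -T0 leT. Qed.

Let T_lt1 k : T k < 1.
Proof.
apply: (lt_le_trans (ltTS k)).
have nd : nondecreasing_seq T by move=> i j; exact: leT.
have cT : cvgn T by apply/cvg_ex; exists 1.
by have := nondecreasing_cvgn_le nd cT k.+1; rewrite (cvg_lim _ T1).
Qed.

(** The default 0 is taken only outside [[0, 1[], since the pieces exhaust that interval. *)
Let K (t : R) : nat := xget 0%N [set k | T k <= t < T k.+1].

Let K_eq k t : T k <= t < T k.+1 -> K t = k.
Proof.
move=> tk; rewrite /K; apply: xget_unique => // j /andP[h1 h2] /=.
case/andP: tk => h3 h4; apply/eqP; rewrite eqn_leq; apply/andP; split; rewrite leqNgt.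
  by apply/negP => /leT h; have := lt_le_trans h4 (le_trans h h1); rewrite ltxx.
by apply/negP => /leT h; have := lt_le_trans h2 (le_trans h h3); rewrite ltxx.
Qed.

Let exK t : 0 <= t -> t < 1 -> exists k, T k <= t < T k.+1.
Proof.
move=> t0 t1.
have ex : exists n, t < T n.
  have := T1 => /cvgr_gt/(_ _ t1) [N _ H]; exists N; exact: (H N (leqnn N)).
case: (ex_minnP ex) => -[|k] h1 h2; first by move: h1; rewrite T0 ltNge t0.
exists k; rewrite h1 andbT leNgt; apply/negP => /h2.
by rewrite ltnn.
Qed.

Let a k : R := - (T k / l k).
Let b k : R := (l k)^-1.
Let th k t : R := a k + b k * t.

Let b_neq k : b k != 0. Proof. by rewrite /b invr_neq0// gt_eqF. Qed.
Let b_gt0 k : 0 < b k. Proof. by rewrite /b invr_gt0. Qed.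
Let thT k : th k (T k) = 0. Proof. by rewrite /th /a /b mulrC addNr. Qed.
Let thTS k : th k (T k.+1) = 1.
Proof. by rewrite /th /a /b TS; field; rewrite gt_eqF. Qed.
Let th0 k : 0 <= a k + b k * T k <= 1.
Proof. by rewrite -[_ + _]/(th k (T k)) thT lexx ler01. Qed.
Let th1 k : 0 <= a k + b k * T k.+1 <= 1.
Proof. by rewrite -[_ + _]/(th k (T k.+1)) thTS lexx ler01. Qed.
Let th_cc k t : T k <= t <= T k.+1 -> 0 <= th k t <= 1.
Proof.
move=> /andP[h1 h2]; have := thT k; have := thTS k; rewrite /th => e1 e0.
have : b k * T k <= b k * t by rewrite ler_pM2l.
have : b k * t <= b k * T k.+1 by rewrite ler_pM2l.
by move=> ? ?; apply/andP; split; lra.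
Qed.
Let th_oo k t : T k < t < T k.+1 -> 0 < th k t < 1.
Proof.
move=> /andP[h1 h2]; have := thT k; have := thTS k; rewrite /th => e1 e0.
have : b k * T k < b k * t by rewrite ltr_pM2l.
have : b k * t < b k * T k.+1 by rewrite ltr_pM2l.
by move=> ? ?; apply/andP; split; lra.
Qed.

Let mu (t : R) : Meas R d := if t < 1 then mk (K t) (th (K t) t) else m1.
(** At a junction time the flux is set to zero, because [curve] gives Radon fluxes at interior times
    only. *)
Let nu (t : R) : vmeasure R d :=
  if t == T (K t) then vzero R d else vscale (b (K t)) (nk (K t) (th (K t) t)).

Let muE k t : T k <= t <= T k.+1 -> meq (mu t) (mk k (th k t)).
Proof.
move=> /andP[h1]; rewrite le_eqVlt => /predU1P[->|h2].
  (* The right end of a piece belongs to the next one, whose initial measure agrees with the final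
     one by [jn]. *)
  rewrite /mu T_lt1 (@K_eq k.+1) ?lexx ?ltTS// thT thTS.
  exact/meq_sym/jn.
by rewrite /mu (lt_trans h2 (T_lt1 _)) (@K_eq k) ?h1.
Qed.

Let nuE k t : T k < t < T k.+1 -> nu t = vscale (b k) (nk k (th k t)).
Proof.
move=> /andP[h1 h2]; rewrite /nu (@K_eq k) ?(ltW h1)//.
by rewrite gt_eqF.
Qed.

Let mu0 : mu 0 = mk 0 0.
Proof. by rewrite /mu ltr01 (@K_eq 0) -?T0 ?lexx ?ltTS// thT T0. Qed.

Let mu1 : mu 1 = m1. Proof. by rewrite /mu ltxx. Qed.

Let radon_mu t : 0 <= t <= 1 -> radon (mu t).
Proof.
move=> /andP[h0]; rewrite le_eqVlt => /predU1P[->|h1]; first by rewrite mu1.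
have [k /andP[h2 h3]] := exK h0 h1.
have h4 : T k <= t <= T k.+1 by rewrite h2 ltW.
apply: (meq_radon (meq_sym (muE h4))); have [[rm _] _ _ _] := ck k.
exact: rm (th_cc h4).
Qed.

Let vradon_nu t : 0 < t < 1 -> vradon (nu t).
Proof.
move=> /andP[h0 h1]; have [k /andP[h2 h3]] := exK (ltW h0) h1.
rewrite /nu (@K_eq k) ?h2//; case: eqP => [_|/eqP tk]; first exact: vradon_vzero.
apply: vradon_vscale; have [[_ rn] _ _ _] := ck k.
by apply: rn; apply: th_oo; rewrite h3 lt_neqAle h2 eq_sym tk.
Qed.

Let pairing_piece k t f : T k <= t <= T k.+1 -> pairing (mu t) f = pairing (mk k (th k t)) f.
Proof. by move=> h; rewrite /pairing (meq_integral _ (muE h)). Qed.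

Let continuous_piece k f : Cc f ->
  {within `[T k, T k.+1], continuous (fun t => pairing (mu t) f)}.
Proof.
move=> cf.
have := affine_pairing_continuous (ck k) (th0 k) (th1 k) cf.
apply: subspace_eq_continuous => t; rewrite inE/= in_itv/= => ht.
exact: (esym (pairing_piece _ ht)).
Qed.

Let continuous_initial n f : Cc f ->
  {within `[0, T n], continuous (fun t => pairing (mu t) f)}.
Proof.
move=> cf; elim: n => [|n ih]; first by rewrite T0 set_itv1; exact: continuous_subspace1.
rewrite (_ : `[0, T n.+1]%classic = `[0, T n] `|` `[T n, T n.+1]).
  by apply: withinU_continuous => //; [exact: interval_closed|exact: interval_closed|
    exact: continuous_piece].
apply/seteqP; split => t /=; rewrite !in_itv/=.
  by move=> /andP[-> h]; have [tn|/ltW tn] := leP t (T n); [left|right; rewrite tn h].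
case=> /andP[h1 h2].
  by rewrite h1 (le_trans h2)// ltW.
by rewrite (le_trans (T_ge0 n) h1).
Qed.

Let tail f (e : R) : Cc f -> 0 < e -> exists N, forall t, T N <= t <= 1 ->
  `|pairing (mu t) f - pairing m1 f| <= e.
Proof.
move=> cf e0; have e2 : 0 < e / 2 by rewrite divr_gt0.
have [r r0 osc] := pairing_oscillation p1 adm rg cf.
have [c c0 H] := osc (mass p r m1 + 1) _ e2.
(* [lim1] applied to the cutoff power bounds the initial masses of all late curves, so that one
   threshold on the action serves for all of them. *)
have lm : \forall k \near \oo, mass p r (mk k 0) <= mass p r m1 + 1.
  have := lim1 (@Cc_mass R d p r r0) => /cvgr_le; apply.
  by rewrite ltrDl.
have lA : \forall k \near \oo, A k <= c by move/cvgr_le: A0; apply.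
have lf : \forall k \near \oo, `|pairing m1 f - pairing (mk k 0) f| <= e / 2.
  by have /cvgrPdist_le := lim1 cf; apply.
have [N _ HN] : \forall k \near \oo, forall s, 0 <= s <= 1 ->
    `|pairing (mk k s) f - pairing m1 f| <= e.
  near=> k; move=> s s01.
  have h1 : `|pairing (mk k s) f - pairing (mk k 0) f| <= e / 2.
    apply: (H _ _ (ck k) (fk k)) => //.
      by apply: (le_trans (aA k)); rewrite lee_fin; near: k.
    by near: k.
  have h2 : `|pairing m1 f - pairing (mk k 0) f| <= e / 2 by near: k.
  move: h1 h2; rewrite !ler_norml => /andP[? ?] /andP[? ?].
  by apply/andP; split; lra.
exists N => t /andP[h0]; rewrite le_eqVlt => /predU1P[->|h1].
  by rewrite mu1 subrr normr0 ltW.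
have [k /andP[h2 h3]] := exK (le_trans (T_ge0 N) h0) h1.
have h4 : T k <= t <= T k.+1 by rewrite h2 ltW.
rewrite (pairing_piece _ h4); apply: HN; last exact: th_cc.
rewrite /= leqNgt; apply/negP => /leT h.
by have := lt_le_trans h3 (le_trans h h0); rewrite ltxx.
Unshelve. all: by end_near. Qed.

Let continuous_mu f : Cc f -> {within `[0 : R, 1 : R], continuous (fun t => pairing (mu t) f)}.
Proof.
move=> cf; apply/subspace_continuousP => t /=; rewrite in_itv/= => /andP[t0].
rewrite le_eqVlt => /predU1P[->|t1].
  apply/cvgrPdist_le => e e0; have [N HN] := tail cf e0.
  have : nbhs (1 : R) [set x : R | T N < x] by apply: lt_nbhsr; exact: T_lt1.
  apply: (@filterS _ (nbhs (1 : R)) (nbhs_filter _)) => x /= Nx.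
  rewrite in_itv/= => /andP[_ x1]; rewrite /from_subspace mu1 distrC; apply: HN.
  by rewrite (ltW Nx).
have [k /andP[h2 h3]] := exK t0 t1.
have := (subspace_continuousP _ _).1 (@continuous_initial k.+1 f cf) t.
rewrite /= in_itv/= t0 (ltW h3) => /(_ isT) H P hP; have := H P hP.
have : nbhs t [set x : R | x < T k.+1] by exact: lt_nbhsl.
rewrite /fmap /= /within /=; apply: (@filterS2 _ (nbhs t) (nbhs_filter _)).
move=> x /= xk hx; rewrite in_itv/= => /andP[x0 _]; apply: hx.
by rewrite in_itv/= x0 ltW.
Qed.

Let trivIset_pieces : trivIset setT (fun k => `]T k, T k.+1[%classic : set R).
Proof.
apply/trivIsetP => i j _ _ ij; apply/seteqP; split => // t /= []; rewrite !in_itv/=.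
move=> /andP[h1 h2] /andP[h3 h4].
have Ki := @K_eq i t; have Kj := @K_eq j t.
by move: ij; rewrite -Ki ?(ltW h1)// -Kj ?(ltW h3)// eqxx.
Qed.

Let cover_pieces : `]0 : R, 1 : R[ `<=` \bigcup_k (`[T k, T k.+1[%classic : set R).
Proof.
move=> t /=; rewrite in_itv/= => /andP[t0 t1]; have [k h] := exK (ltW t0) t1.
by exists k => //=; rewrite in_itv.
Qed.

Let measurable_nu f i : Cc f -> measurable_fun `]0 : R, 1 : R[ (fun t => vint (nu t) i f).
Proof.
move=> cf; apply: (@measurable_funS _ _ _ _ (\bigcup_k (`[T k, T k.+1[%classic : set R))) => //.
  by apply: bigcup_measurable => k _; exact: measurable_itv.
apply/measurable_fun_bigcup => k; first exact: measurable_itv.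
apply/measurable_fun_itv_obnd_cbndP.
apply: (eq_measurable_fun (fun t => vint (vscale (b k) (nk k (th k t))) i f)).
  by move=> t; rewrite inE/= in_itv/= => h; rewrite (nuE h).
exact: (affine_vint_measurable (ck k) (b_neq k) (th0 k) (th1 k) i cf).
Qed.

Let action_glue : (action phi gamma mu nu <= Z%:E)%E.
Proof.
have P0 m n : (0 <= Phi phi gamma m n)%E by exact: (Phi_ge0 p1 adm).
have mP (k : nat) : measurable (`]T k, T k.+1[%classic : set R) by exact: measurable_itv.
apply: (le_trans (@lower_integral_bigcup_le _ _ R leb `]0 : R, 1 : R[%classic
  (fun k => `]T k, T k.+1[%classic) (fun t => Phi phi gamma (mu t) (nu t))
  (measurable_itv _) mP trivIset_pieces _ _ _)) => //.
- move=> k t /=; rewrite !in_itv/= => /andP[h1 h2].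
  by rewrite (le_lt_trans (T_ge0 k) h1) (lt_trans h2 (T_lt1 _)).
- apply/eqP; rewrite -measure_le0.
  have cT : leb (\bigcup_k [set T k]) = 0%E.
    by apply: countable_lebesgue_measure0; apply: bigcup_countable.
  rewrite -cT; apply: le_measure; rewrite ?inE.
  + by apply: measurableD => //; apply: bigcup_measurable.
  + by apply: bigcup_measurable.
  + move=> t [/cover_pieces[k _ /=]]; rewrite in_itv/= => /andP[h1 h2] h3.
    exists k => //=; apply/eqP; rewrite eq_le h1 andbT leNgt; apply/negP => h4.
    by apply: h3; exists k => //=; rewrite in_itv/= h4.
have piece k : (\int[leb]_(t in `]T k, T k.+1[) Phi phi gamma (mu t) (nu t) <=
    (powR (l k)^-1 p / (l k)^-1 * A k)%:E)%E.
  have E := affine_action_le gamma p1 adm (mk k) (nk k) (b_neq k) (th0 k) (th1 k).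
  apply: (@le_trans _ _ ((powR (l k)^-1 p / (l k)^-1)%:E * action phi gamma (mk k) (nk k))%E).
    rewrite (gtr0_norm (b_gt0 k)) in E; apply: le_trans E.
    apply: le_lower_integral => t //=; rewrite in_itv/= => ht.
    have /andP[h1 h2] := ht.
    by rewrite (nuE ht) /mu (lt_trans h2 (T_lt1 _)) (@K_eq k) ?(ltW h1).
  by rewrite [leRHS]EFinM lee_wpmul2l// lee_fin divr_ge0 ?powR_ge0// ltW// b_gt0.
apply: lime_le; first by apply: is_cvg_nneseries => k _ _; exact: integral_ge0.
apply: nearW => n; apply: (@le_trans _ _ (\sum_(k < n) (powR (l k)^-1 p / (l k)^-1 * A k))%:E).
  by rewrite -sumEFin big_mkord; apply: lee_sum => k _; exact: piece.
by rewrite lee_fin.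
Qed.

Let curve_glue : curve phi gamma mu nu.
Proof.
split; [split; [exact: radon_mu|exact: vradon_nu]|exact: continuous_mu|exact: measurable_nu|].
by apply: (le_lt_trans action_glue); rewrite ltry.
Qed.

(** Up to any [t < 1] only finitely many pieces are added up; at 1 the identity holds because both
    sides are continuous. *)
Let flows_glue : flows mu nu.
Proof.
move=> g dg r gd gv.
have Cg : Cc g by case: (gd) => cg _ _; exact: vanish_Cc gv.
have iF := integrable_flux p1 adm rg curve_glue gd gv.
have mF (x y : R) : 0 <= x -> y <= 1 -> measurable_fun `]x, y[ (fun t => (flux (nu t) dg)%:E).
  have /integrableP[+ _] := iF => + x0 y1; apply: measurable_funS => // t /=.
  rewrite !in_itv/= => /andP[h1 h2].
  by rewrite (le_lt_trans x0 h1) (lt_le_trans h2 y1).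
pose I (t : R) := (\int[leb]_(s in `]0%R, t[) (flux (nu s) dg)%:E)%E.
have step k t : T k <= t <= T k.+1 -> (\int[leb]_(s in `]T k, t[) (flux (nu s) dg)%:E)%E =
    (pairing (mu t) g - pairing (mu (T k)) g)%:E.
  move=> ht; have h0 : T k <= T k <= T k.+1 by rewrite lexx ltW.
  rewrite (pairing_piece _ ht) (pairing_piece _ h0).
  rewrite -(affine_flow p1 adm rg (ck k) (fk k) (b_neq k) (th0 k) (th1 k) gd gv ht).
  apply: eq_integral => s; rewrite inE/= in_itv/= => /andP[h1 h2].
  by rewrite (@nuE k)// h1; case/andP: ht => _; exact: lt_le_trans.
have full n : I (T n) = (pairing (mu (T n)) g - pairing (mu 0) g)%:E.
  elim: n => [|n ih]; first by rewrite T0 /I set_itvoo0 integral_set0 subrr.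
  rewrite /I (integral_itv_split (T_ge0 n) (ltW (ltTS n))); last first.
    by apply: mF => //; exact/ltW/T_lt1.
  rewrite -/(I (T n)) ih step ?lexx ?andbT ?(ltW (ltTS n))// -EFinD.
  by congr EFin; ring.
have lt1 t : 0 <= t -> t < 1 -> I t = (pairing (mu t) g - pairing (mu 0) g)%:E.
  move=> t0 t1; have [k /andP[h1 h2]] := exK t0 t1.
  rewrite /I (integral_itv_split (T_ge0 k) h1); last by apply: mF => //; exact: ltW.
  by rewrite -/(I (T k)) full step ?h1 ?(ltW h2)// -EFinD; congr EFin; ring.
have cI := continuous_primitive iF.
have := @const_itv_extend R (fun t => pairing (mu t) g - fine (I t)) (pairing (mu 0) g)
  (@continuous_sub _ (subspace `[0 : R, 1 : R]) _ _ (continuous_mu Cg) cI).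
move=> H t t01.
have {}H := H _ t t01.
have E : pairing (mu t) g - fine (I t) = pairing (mu 0) g.
  apply: H => s /andP[s0 s1]; rewrite lt1 ?(ltW s0)//=; ring.
rewrite -[LHS]/(I t) -E opprB addrCA subrr addr0 fineK//.
apply: integrable_fin_num => //; apply: integrableS iF => // s /=; rewrite !in_itv/=.
by move=> /andP[-> h]; case/andP: t01 => _; exact: lt_le_trans.
Qed.

Lemma concatenation : exists mu nu, [/\ curve phi gamma mu nu, flows mu nu,
  mu 0 = mk 0 0, mu 1 = m1 & (action phi gamma mu nu <= Z%:E)%E].
Proof.
by exists mu, nu; split; [exact: curve_glue|exact: flows_glue|exact: mu0|exact: mu1|
  exact: action_glue].
Qed.
End Concatenation.

(** * The distance *)

Section RadonUniqueness.
Context (R : realType) (d : nat).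
Implicit Types (m : Meas R d) (f : Rd R d -> R).

Lemma exists_open_approximation (U : set (Rd R d)) : open U -> exists h : nat -> Rd R d -> R,
  [/\ (forall k, Cc (h k)), (forall k x, 0 <= h k x),
      (forall x, {homo h ^~ x : k n / (k <= n)%N >-> k <= n}) &
      (forall x, h k x @[k --> \oo] --> (\1_U x : R))].
Proof.
move=> oU.
have [D [cD D0 Dn Dp]] : exists D : Rd R d -> R,
    [/\ continuous D, (forall x, 0 <= D x), (forall x, ~ U x -> D x = 0) &
        (forall x, U x -> 0 < D x)].
  have [nU|nU] := pselect (exists y, ~ U y); first exact: exists_distance_to_complement.
  exists (fun=> 1); split => // [x|x Ux]; first exact: cst_continuous.
  by exfalso; apply: nU; exists x.
(* The factor [bump k] gives compact support; being at least 1 on the ball of radius [k], it does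
   not spoil the convergence to the indicator. *)
exists (fun k x => Num.min 1 (k%:R * D x * bump k%:R x)); split.
- move=> k; have /Cc_vanish[r _ bv] := @bump_Cc R d k%:R.
  apply: (@vanish_Cc _ _ r) => [|x rx]; last by rewrite bv// mulr0 min_r.
  have cg : continuous (fun x => k%:R * D x * bump k%:R x).
    apply: continuous_mul; last by case: (@bump_Cc R d k%:R).
    by apply: continuous_mul => //; exact: continuous_const.
  move=> x; apply: (@continuous_min _ _ (fun=> 1) (fun x => k%:R * D x * bump k%:R x)).
    exact: cst_continuous.
  exact: cg.
- by move=> k x; rewrite le_min ler01 !mulr_ge0 ?bump_ge0.
- move=> x j k jk; rewrite le_min !ge_min lexx/=; apply/orP; right.
  have jkR : (j%:R <= k%:R :> R) by rewrite ler_nat.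
  apply: ler_pM; rewrite ?mulr_ge0 ?bump_ge0//; first by rewrite ler_wpM2r.
  rewrite /bump ge_max !le_max lexx/=; apply/orP; right.
  by rewrite lerD2r lerD2r ler_pXn2r// nnegrE.
- move=> x; rewrite indicE; have [xU|xU] := boolP (x \in U); last first.
    have Ux : ~ U x by move=> Ux; move/negP: xU; apply; rewrite inE.
    apply: cvg_near_cst; apply: nearW => k; rewrite (Dn x Ux) mulr0 mul0r.
    by rewrite min_r.
  have Ux : U x by rewrite inE in xU.
  have Dx := Dp x Ux.
  apply: cvg_near_cst; near=> k.
  rewrite min_l//; apply: (@le_trans _ _ (k%:R * D x)).
    rewrite -ler_pdivrMr//; near: k.
    exists (Num.truncn (1 / D x)).+1 => // n /= hn.
    by apply: ltW; apply: (lt_le_trans (truncnS_gt _)); rewrite ler_nat.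
  rewrite ler_peMr ?mulr_ge0 ?(ltW Dx)// bump_ge1//; near: k.
  exists (Num.truncn (enorm x)).+1 => // n /= hn.
  by apply: ltW; apply: (lt_le_trans (truncnS_gt _)); rewrite ler_nat.
Unshelve. all: by end_near. Qed.

Lemma measure_open_lim m (U : set (Rd R d)) (h : nat -> Rd R d -> R) : open U ->
  (forall k, Cc (h k)) -> (forall k x, 0 <= h k x) ->
  (forall x, {homo h ^~ x : k n / (k <= n)%N >-> k <= n}) ->
  (forall x, h k x @[k --> \oo] --> (\1_U x : R)) ->
  (\int[m]_x (h k x)%:E @[k --> \oo] --> m (U : set (RdB R d)))%E.
Proof.
move=> oU ch h0 hn hl.
have mU : measurable (U : set (RdB R d)) by exact: open_measurable_RdB.
have := @cvg_monotone_convergence _ (RdB R d) R m setT measurableT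
  (fun k x => (h k x)%:E) _ _ _.
rewrite (_ : (fun x => limn _) = (fun x => (\1_U x)%:E)); last first.
  apply/funext => x; apply: cvg_lim => //; apply: cvg_EFin; first exact: nearW.
  exact: hl.
rewrite integral_indic// setIT; apply.
- by move=> k; apply/measurable_EFinP; exact: Cc_measurable.
- by move=> k x _; rewrite lee_fin.
- by move=> x _ k n kn; rewrite lee_fin; exact: hn.
Qed.

(** Open sets are stable under intersection and generate the Borel sets, and the balls [Eball n]
    exhaust the space with finite measure. On an open set a measure is a monotone limit of pairings
    with test functions. *)
Lemma meq_of_pairing m1 m2 : radon m1 -> radon m2 ->
  (forall f, Cc f -> pairing m1 f = pairing m2 f) -> meq m1 m2.
Proof.
move=> r1 r2 H A mA.
apply: (@measure_unique _ R (RdB R d) (@open (Rd R d)) (fun n => Eball n%:R)) => //.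
- by move=> U V; exact: openI.
- by move=> n; exact: open_Eball_at.
- apply/seteqP; split => // x _; exists (Num.truncn (enorm x)).+1 => //.
  by rewrite EballE /=; exact: truncnS_gt.
- move=> U oU; have [h [ch h0 hn hl]] := exists_open_approximation oU.
  have c1 := measure_open_lim (m := m1) oU ch h0 hn hl.
  have c2 := measure_open_lim (m := m2) oU ch h0 hn hl.
  rewrite (_ : (fun k => _) = (fun k => \int[m2]_x (h k x)%:E)%E) in c1.
    exact: (@cvg_unique _ (@ereal_hausdorff R) _ _ _ _ c1 c2).
  by apply/funext => k; rewrite !pairingE// H.
Qed.
End RadonUniqueness.

(** * Metric axioms and completeness *)

Section DistanceAndCurves.
Context (R : realType) (d : nat) (p : R) (phi : R -> Rd R d -> R) (gamma : Meas R d).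
Hypotheses (p1 : 1 < p) (adm : admissible p phi) (rg : radon gamma).
Implicit Types (mu : R -> Meas R d) (nu : R -> vmeasure R d) (a b c m : Meas R d).
Local Notation W := (Wdist p phi gamma).
Local Notation curve := (curve phi gamma).
Local Notation action := (action phi gamma).

Let p0 : 0 < p. Proof. exact: lt_trans p1. Qed.
Let pV0 : 0 <= p^-1. Proof. by rewrite invr_ge0 ltW. Qed.
Let pn0 : p != 0. Proof. by rewrite gt_eqF. Qed.

Let S (a b : Meas R d) := [set v | exists (mu : R -> Meas R d) (nu : R -> vmeasure R d),
     [/\ CE 1 mu nu, meq (mu 0) a, meq (mu 1) b & v = action mu nu]].

Let WE a b : W a b = poweR (ereal_inf (S a b)) p^-1. Proof. by []. Qed.

Let inf_ge0 a b : (0 <= ereal_inf (S a b))%E.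
Proof. by apply: le_ereal_inf_tmp => _ [mu [nu [_ _ _ ->]]]; exact: (action_ge0 _ p1 adm). Qed.

Lemma Wdist_ge0 a b : (0 <= W a b)%E. Proof. exact: poweR_ge0. Qed.

Let poweR_mono (x y : \bar R) : (0 <= x -> x <= y -> poweR x p^-1 <= poweR y p^-1)%E.
Proof.
move=> x0 xy; apply: gt0_ler_poweR => //; rewrite in_itv/= ?x0 ?leey//.
by rewrite (le_trans x0 xy).
Qed.

Let powR_div (e : R) : 0 < e -> powR e p / e = powR e (p - 1).
Proof. by move=> e0; rewrite powRB ?powRr1 ?(ltW e0)// gt_eqF// implybT. Qed.

Let powRK (e : R) : 0 <= e -> powR (powR e p) p^-1 = e.
Proof. by move=> e0; rewrite -powRrM divff// powRr1. Qed.

Lemma Wdist_le mu nu a b (e : R) : curve mu nu -> flows mu nu -> meq (mu 0) a -> meq (mu 1) b ->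
  0 <= e -> (action mu nu <= (powR e p)%:E)%E -> (W a b <= e%:E)%E.
Proof.
move=> cu fl ma mb e0 ae; rewrite WE.
have : (ereal_inf (S a b) <= (powR e p)%:E)%E.
  apply: ge_ereal_inf; exists (action mu nu) => //; exists mu, nu; split => //.
  exact: (flows_CE p1 adm rg cu fl).
by move=> /(poweR_mono (inf_ge0 a b)); rewrite poweR_EFin powRK.
Qed.

(** Strict on both sides because the infimum is not known to be attained. *)
Lemma Wdist_lt a b (e : R) : 0 < e -> (W a b < e%:E)%E -> exists mu nu,
  [/\ curve mu nu, flows mu nu, meq (mu 0) a, meq (mu 1) b & (action mu nu < (powR e p)%:E)%E].
Proof.
move=> e0 We; have : (ereal_inf (S a b) < (powR e p)%:E)%E.
  rewrite ltNge; apply: contraTN We => /poweR_mono; rewrite lee_fin powR_ge0 => /(_ isT).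
  by rewrite poweR_EFin (powRK (ltW e0)) -leNgt.
move=> /ereal_inf_lt[_ [mu [nu [ce ma mb ->]]] ae].
have [cu fl] := CE_curve p1 adm rg ce (lt_trans ae (ltry _)).
by exists mu, nu.
Qed.

Lemma Wdist_finite a b : (W a b < +oo)%E -> exists2 e : R, 0 < e & (W a b < e%:E)%E.
Proof.
move=> Woo; have f : W a b \is a fin_num by rewrite ge0_fin_numE// Wdist_ge0.
exists (fine (W a b) + 1); first by rewrite ltr_pwDr// fine_ge0// Wdist_ge0.
by rewrite EFinD fineK// lteDl// lte_fin.
Qed.

Lemma Wdist_finite_radon a b : (W a b < +oo)%E -> radon a /\ radon b.
Proof.
move=> /Wdist_finite[e e0 /(Wdist_lt e0)[mu [nu [[[rm _] _ _ _] _ ma mb _]]]].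
split; [apply: (meq_radon ma)|apply: (meq_radon mb)]; apply: rm; rewrite ?lexx ?ler01//.
Qed.

Lemma Wdist_sym a b : W a b = W b a.
Proof.
have le u v : (W u v <= W v u)%E.
  rewrite !WE; apply: poweR_mono => //; apply: le_ereal_inf_tmp => _ [mu [nu [ce ma mb ->]]].
  have [aoo|] := ltP (action mu nu) +oo%E; last by rewrite leye_eq => /eqP ->; rewrite leey.
  have [cu fl] := CE_curve p1 adm rg ce aoo.
  (* The curve is run backwards through [t -> 1 - t], which changes the sign of the flux and does
     not increase the action. *)
  have b0 : -1 != 0 :> R by rewrite oppr_eq0 oner_eq0.
  have a01 : 0 <= (1 : R) <= 1 by rewrite lexx ler01.
  have ab01 : 0 <= (1 : R) + (-1) <= 1 by rewrite subrr lexx ler01.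
  have [cu' fl' ac] := curve_affine p1 adm rg cu fl b0 a01 ab01.
  apply: ge_ereal_inf; exists (action (fun t => mu (1 + -1 * t))
    (fun t => vscale (-1) (nu (1 + -1 * t)))).
    exists (fun t => mu (1 + -1 * t)), (fun t => vscale (-1) (nu (1 + -1 * t))).
    split => //; first exact: (flows_CE p1 adm rg cu' fl').
      by rewrite mulr0 addr0.
    by rewrite mulr1 subrr.
  by apply: (le_trans ac); rewrite normrN1 powR1 divr1 mul1e.
by apply/le_anti; rewrite !le.
Qed.

(* Short pieces, run through in times proportional to their lengths, concatenate to one curve. *)
Lemma Wdist_chain (v : nat -> Meas R d) (e : nat -> R) (s : R) m :
  (forall k, 0 < e k) -> (forall k, (W (v k) (v k.+1) < (e k)%:E)%E) ->
  \sum_(k < n) e k @[n --> \oo] --> s -> radon m ->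
  (forall f, Cc f -> pairing (v n) f @[n --> \oo] --> pairing m f) ->
  (W (v 0%N) m <= s%:E)%E.
Proof.
move=> e0 We es rm vm.
have nd : nondecreasing_seq (fun n => \sum_(k < n) e k).
  apply/nondecreasing_seqP => n.
  by rewrite big_ord_recr/= lerDl ltW.
have le_s n : \sum_(k < n) e k <= s.
  have cs : cvgn (fun n => \sum_(k < n) e k) by apply/cvg_ex; exists s.
  by have := nondecreasing_cvgn_le nd cs n; rewrite (cvg_lim _ es).
have s0 : 0 < s by apply: lt_le_trans (le_s 1%N); rewrite big_ord1.
have /choice[mk /choice[nk H]] k : exists mu nu, [/\ curve mu nu, flows mu nu,
    meq (mu 0) (v k), meq (mu 1) (v k.+1) & (action mu nu < (powR (e k) p)%:E)%E].
  exact: Wdist_lt (We k).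
(* Running through a curve of action at most [e^p] in time [e / s] costs at most
   [(e / s)^(1-p) e^p = s^(p-1) e], and these costs sum to at most [s^p]. *)
pose l k := e k / s.
have l0 k : 0 < l k by rewrite divr_gt0.
have T1 : \sum_(k < n) l k @[n --> \oo] --> (1 : R).
  under eq_fun do rewrite -mulr_suml.
  by rewrite -(divff (lt0r_neq0 s0)); apply: cvgMl.
have e_to0 : e n @[n --> \oo] --> (0 : R).
  have es1 : (fun n => \sum_(k < n.+1) e k) @ \oo --> s by rewrite -cvg_shiftS in es.
  have := cvgB es1 es; rewrite subrr => h.
  rewrite (_ : e = (fun n => \sum_(k < n.+1) e k) - (fun n => \sum_(k < n) e k)).
    exact: h.
  have E n : e n = \sum_(k < n.+1) e k - \sum_(k < n) e k.
    by rewrite big_ord_recr/= addrAC subrr add0r.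
  by apply/funext => n; exact: E.
have A0 : powR (e n) p @[n --> \oo] --> (0 : R).
  apply: (@squeeze_cvgr _ _ _ _ (fun=> 0) e); [|exact: cvg_cst|exact: e_to0].
  near=> n; rewrite powR_ge0/=.
  have e1 : e n <= 1 by near: n; move/cvgr_le: e_to0; apply.
  by apply: ge1r_powR; rewrite ?(ltW p1)// e0.
have sA n : \sum_(k < n) (powR (l k)^-1 p / (l k)^-1 * powR (e k) p) <= powR s p.
  have E k : powR (l k)^-1 p / (l k)^-1 * powR (e k) p = powR s p / s * e k.
    have ek := e0 k.
    rewrite mulrAC -powRM ?invr_ge0 ?(ltW (l0 k)) ?(ltW ek)// invrK.
    rewrite (_ : (l k)^-1 * e k = s) /l; first by rewrite mulrAC mulrA.
    by field; rewrite !gt_eqF.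
  under eq_bigr do rewrite E.
  rewrite -mulr_sumr -mulrA ler_piMr ?powR_ge0// mulrC ler_pdivrMr// mul1r.
  exact: le_s.
have ck k : curve (mk k) (nk k) by case: (H k).
have fk k : flows (mk k) (nk k) by case: (H k).
have jn k : meq (mk k 1) (mk k.+1 0).
  by case: (H k) (H k.+1) => _ _ _ h _ [_ _ h' _ _]; exact: meq_trans h (meq_sym h').
have aA k : (action (mk k) (nk k) <= (powR (e k) p)%:E)%E by case: (H k) => _ _ _ _ /ltW.
have lim1 f : Cc f -> pairing (mk n 0) f @[n --> \oo] --> pairing m f.
  move=> cf; rewrite (_ : (fun n => _) = (fun n => pairing (v n) f)); first exact: vm.
  by apply/funext => n; congr fine; apply: meq_integral; case: (H n).
have [mu [nu [cu fl mu0 mu1 ac]]] := concatenation p1 adm rg ck fk jn l0 T1 aA A0 sA rm lim1.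
apply: (Wdist_le cu fl _ _ (ltW s0) ac); last by rewrite mu1.
by rewrite mu0; case: (H 0%N).
Unshelve. all: by end_near. Qed.

(** The arc over [[0, t]] stretched to unit time has action at most [t^(p-1)] times the total one,
    and this tends to 0 with [t] since [p > 1]. *)
Lemma curve_short_start mu nu (e : R) : curve mu nu -> flows mu nu -> 0 < e ->
  exists2 x, 0 < x & forall t : R, 0 < t -> t < x -> t <= 1 -> (W (mu 0%R) (mu t) < e%:E)%E.
Proof.
move=> cu fl e0; have [_ _ _ aoo] := cu.
have fa : action mu nu \is a fin_num by rewrite ge0_fin_numE// (action_ge0 _ p1 adm).
pose E := fine (action mu nu) + 1.
have E0 : 0 < E by rewrite ltr_pwDr// fine_ge0// (action_ge0 _ p1 adm).
have aE : (action mu nu <= E%:E)%E by rewrite /E EFinD fineK// leeDl.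
have e2 : 0 < e / 2 by rewrite divr_gt0.
have c0 : 0 < powR (e / 2) p / E by rewrite divr_gt0// powR_gt0.
have p10 : 0 < p - 1 by rewrite subr_gt0.
have := powR_cvg0 p10 => /cvgr_lt/(_ _ c0) -[x /= x0 Hx].
exists x => // t t0 tx t1.
have b0 : t != 0 by rewrite gt_eqF.
have a01 : 0 <= (0 : R) <= 1 by rewrite lexx ler01.
have ab01 : 0 <= 0 + t <= 1 by rewrite add0r (ltW t0).
have [cu' fl' ac] := curve_affine p1 adm rg cu fl b0 a01 ab01.
apply: (@le_lt_trans _ _ (e / 2)%:E); last by rewrite lte_fin ltr_pdivrMr// ltr_pMr// ltr1n.
apply: (Wdist_le cu' fl' _ _ (ltW e2)).
- by rewrite mulr0 addr0.
- by rewrite mulr1 add0r.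
apply: (le_trans ac); rewrite gtr0_norm// powR_div//.
apply: (@le_trans _ _ ((powR t (p - 1))%:E * E%:E)%E).
  by rewrite lee_wpmul2l// lee_fin powR_ge0.
rewrite -EFinM lee_fin -ler_pdivlMr//; apply: ltW; apply: Hx => //=.
by rewrite sub0r normrN gtr0_norm.
Qed.

Let geom (s : R) : \sum_(k < n) s / 2 ^+ k.+1 @[n --> \oo] --> s.
Proof.
have E n : \sum_(k < n) s / 2 ^+ k.+1 = s - s / 2 ^+ n.
  elim: n => [|n ih]; first by rewrite big_ord0 expr0 divr1 subrr.
  by rewrite big_ord_recr/= ih exprS; field; rewrite expf_neq0.
under eq_fun do rewrite E.
have h : s / 2 ^+ n @[n --> \oo] --> (0 : R).
  rewrite -(mulr0 s); apply: cvgMr; under eq_fun do rewrite -exprVn.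
  by apply: cvg_expr; rewrite ger0_norm ?invr_ge0// invf_lt1// ltr1n.
have h1 : (fun _ : nat => s) @ \oo --> s by exact: cvg_cst.
have h2 : (fun n : nat => s - s / 2 ^+ n) @ \oo --> s - 0 by exact: (cvgB h1 h).
by rewrite subr0 in h2.
Qed.

Let geom_gt0 (s : R) k : 0 < s -> 0 < s / 2 ^+ k.+1.
Proof. by move=> s0; rewrite divr_gt0// exprn_gt0. Qed.

Let geom_lt (s : R) k : 0 < s -> s / 2 ^+ k.+2 < s / 2 ^+ k.+1.
Proof.
by move=> s0; rewrite ltr_pM2l// ltf_pV2 ?posrE ?exprn_gt0// ltr_eXn2l// ltr1n.
Qed.

(* Idling at c costs nothing: go out and back along ever shorter arcs of a curve issued from c. *)
Lemma Wdist_self c b : (W c b < +oo)%E -> W c c = 0%E.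
Proof.
move=> Wcb; have [rc _] := Wdist_finite_radon Wcb.
have [e0 e00 /(Wdist_lt e00)[mu [nu [cu fl m0 _ _]]]] := Wdist_finite Wcb.
apply/eqP; rewrite eq_le Wdist_ge0 andbT; apply/lee_addgt0Pr => s s0; rewrite add0e.
pose e k := s / 2 ^+ k.+1.
have ek k : 0 < e k by exact: geom_gt0.
(* Small enough for the cost [e k], and at most [1 / (k + 1)] so that [mu (t k)] converges to
   [c]. *)
have /choice[t Ht] k : exists t : R, [/\ 0 < t, t <= k.+1%:R^-1 & (W (mu 0%R) (mu t) < (e k)%:E)%E].
  have [x x0 Hx] := curve_short_start cu fl (ek k).
  have k0 : 0 < k.+1%:R^-1 :> R by rewrite invr_gt0.
  exists (Num.min (x / 2) k.+1%:R^-1); split.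
  - by rewrite lt_min k0 divr_gt0.
  - by rewrite ge_min lexx orbT.
  - apply: Hx.
    + by rewrite lt_min k0 divr_gt0.
    + by rewrite gt_min ltr_pdivrMr// ltr_pMr// ltr1n.
    + by rewrite ge_min invf_le1 ?ler1n// orbT.
have W_meq a a' b' : meq a a' -> W a b' = W a' b'.
  move=> h; rewrite !WE; congr poweR; congr ereal_inf; apply/seteqP.
  split => _ [m [n [h1 h2 h3 ->]]]; exists m, n; split => //.
    exact: meq_trans h2 h.
  exact: meq_trans h2 (meq_sym h).
(* From an even [k] the chain goes out to [mu (t k.+1)] at a cost below [e k.+1 < e k]; from an odd
   [k] it returns to [c], by symmetry. *)
pose v k := if odd k then mu (t k) else c.
have Wv k : (W (v k) (v k.+1) < (e k)%:E)%E.
  rewrite /v /=; case: (odd k) => /=.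
    by rewrite Wdist_sym -(W_meq _ _ _ m0); case: (Ht k).
  rewrite -(W_meq _ _ _ m0); apply: (@lt_trans _ _ (e k.+1)%:E); first by case: (Ht k.+1).
  by rewrite lte_fin geom_lt.
have c01 : `[0 : R, 1 : R]%classic 0 by rewrite /= in_itv/= lexx ler01.
have vc f : Cc f -> pairing (v n) f @[n --> \oo] --> pairing c f.
  move=> cf; apply/cvgrPdist_lt => x x0; have [_ cm _ _] := cu.
  have := (subspace_continuousP _ _).1 (cm f cf) 0 c01.
  move=> /cvgrPdist_lt/(_ _ x0); rewrite -filter_from_ballE => -[y y0 Hy].
  have := near_scale 1 y0; apply: filterS => n hn; rewrite mul1r in hn.
  have m0E : pairing (mu 0) f = pairing c f by rewrite /pairing (meq_integral _ m0).
  rewrite /v; case: (odd n); last by rewrite subrr normr0.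
  have [t0 t1 _] := Ht n; rewrite -m0E; apply: Hy.
    have : `|0 - t n| < y by rewrite sub0r normrN gtr0_norm// (le_lt_trans t1).
    exact.
  rewrite /= in_itv/= (ltW t0)/= (le_trans t1)// invf_le1 ?ler1n//.
have es : \sum_(k < n) e k @[n --> \oo] --> s by exact: geom.
exact: (@Wdist_chain v e s c ek Wv es rc vc).
Qed.

Lemma Wdist_triangle a b c : (W a c <= W a b + W b c)%E.
Proof.
have [Wab|] := ltP (W a b) +oo%E; last first.
  by rewrite leye_eq => /eqP ->; rewrite addye ?leey// -ltNye (lt_le_trans _ (Wdist_ge0 b c)).
have [Wbc|] := ltP (W b c) +oo%E; last first.
  by rewrite leye_eq => /eqP ->; rewrite addey ?leey// -ltNye (lt_le_trans _ (Wdist_ge0 a b)).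
have [_ rc] := Wdist_finite_radon Wbc.
have Wcc : W c c = 0%E by apply: (@Wdist_self c b); rewrite Wdist_sym.
have fab : W a b \is a fin_num by rewrite ge0_fin_numE// Wdist_ge0.
have fbc : W b c \is a fin_num by rewrite ge0_fin_numE// Wdist_ge0.
set x := fine (W a b); set y := fine (W b c).
have x0 : 0 <= x by rewrite fine_ge0// Wdist_ge0.
have y0 : 0 <= y by rewrite fine_ge0// Wdist_ge0.
apply/lee_addgt0Pr => s s0.
pose d0 k : R := if k == 0%N then x else if k == 1%N then y else 0.
(* After two steps the chain idles at [c] at length 0. The margins [s / 2^(k+1)] make the bounds
   strict and the durations positive, and sum to [s]. *)
pose e k := d0 k + s / 2 ^+ k.+1.
have ek k : 0 < e k.
  by rewrite ltr_wpDl ?geom_gt0// /d0; case: ifP => // _; case: ifP.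
pose v k := if k == 0%N then a else if k == 1%N then b else c.
have Wv k : (W (v k) (v k.+1) < (e k)%:E)%E.
  case: k => [|[|k]]; rewrite /v /e /d0/=.
  - by rewrite -(fineK fab) lte_fin ltrDl geom_gt0.
  - by rewrite -(fineK fbc) lte_fin ltrDl geom_gt0.
  - by rewrite Wcc lte_fin add0r geom_gt0.
have es : \sum_(k < n) e k @[n --> \oo] --> (x + y) + s.
  rewrite (_ : (fun n => _) = (fun n => \sum_(k < n) d0 k + \sum_(k < n) s / 2 ^+ k.+1)).
    apply: cvgD; last exact: geom.
    apply: cvg_near_cst; exists 2%N => // -[|[|n]]//= _.
    by rewrite !big_ord_recl big1 ?addr0.
  by apply/funext => n; rewrite -big_split.
have vc f : Cc f -> pairing (v n) f @[n --> \oo] --> pairing c f.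
  by move=> cf; apply: cvg_near_cst; exists 2%N => // -[|[|n]].
have := @Wdist_chain v e _ c ek Wv es rc vc.
by rewrite /v/= !EFinD /x /y !fineK.
Qed.

Lemma Wdist_pairing f : Cc f -> exists2 r : R, 0 < r & forall B e : R, 0 < e ->
  exists2 x : R, 0 < x & forall a b, mass p r a <= B -> (W a b < x%:E)%E ->
  `|pairing b f - pairing a f| <= e.
Proof.
move=> cf; have [r r0 H] := pairing_oscillation p1 adm rg cf.
exists r => // B e e0; have [x x0 Hx] := H B e e0.
have y0 : 0 < powR x p^-1 by rewrite powR_gt0.
exists (powR x p^-1) => // a b aB /(Wdist_lt y0)[mu [nu [cu fl ma mb]]].
rewrite -powRrM mulVf// powRr1 ?(ltW x0)// => ac.
have h01 : 0 <= (1 : R) <= 1 by rewrite ler01 lexx.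
have maE : mass p r (mu 0) = mass p r a by rewrite /mass /pairing (meq_integral _ ma).
have := Hx mu nu cu fl (ltW ac); rewrite maE => /(_ aB 1 h01).
by rewrite /pairing (meq_integral _ ma) (meq_integral _ mb).
Qed.

Lemma Wdist_mass r : 0 < r -> exists2 M : R, 0 < M & forall a b, (W a b < 1%:E)%E ->
  mass p r b <= 2 * mass p r a + M + mass p r gamma.
Proof.
move=> r0; have [M M0 H] := mass_control p1 adm rg r0; exists M => // a b.
move=> /(Wdist_lt ltr01)[mu [nu [cu fl ma mb]]]; rewrite powR1 => ac.
have h01 : 0 <= (1 : R) <= 1 by rewrite ler01 lexx.
have := H mu nu 1 cu fl (ltW ac) 1 h01; rewrite mulr1.
by rewrite /mass /pairing (meq_integral _ ma) (meq_integral _ mb).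
Qed.

Lemma Wdist_eq0 a b : W a b = 0%E -> meq a b.
Proof.
move=> W0; have [ra rb] : radon a /\ radon b by apply: Wdist_finite_radon; rewrite W0.
apply: meq_of_pairing => // f cf; apply/esym/eqP; rewrite -subr_eq0 -normr_le0.
apply/ler_addgt0Pr => e e0; rewrite add0r.
have [r r0 H] := Wdist_pairing cf; have [x x0 Hx] := H (mass p r a) e e0.
by apply: Hx => //; rewrite W0 lte_fin.
Qed.

Lemma Wdist_complete (u : nat -> Meas R d) : (forall n, radon (u n)) ->
  (forall e : R, 0 < e -> exists N, forall i j, (N <= i)%N -> (N <= j)%N ->
     (W (u i) (u j) < e%:E)%E) ->
  exists2 m, radon m & forall e : R, 0 < e ->
    exists N, forall n, (N <= n)%N -> (W (u n) m <= e%:E)%E.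
Proof.
move=> ru cauchy.
have cvu f : Cc f -> cvgn (fun n => pairing (u n) f).
  move=> cf; apply/cauchy_cvgP/cauchy_exP => e e0.
  have [r r0 H] := Wdist_pairing cf.
  have [M M0 HM] := Wdist_mass r0; have [N0 HN0] := cauchy 1 ltr01.
  (* Bounds the mass of every [u n] with [n >= N0], as [Wdist_pairing] requires of its first
     argument. *)
  pose B := 2 * mass p r (u N0) + M + mass p r gamma.
  have e2 : 0 < e / 2 by rewrite divr_gt0.
  have [x x0 Hx] := H B _ e2; have [N1 HN1] := cauchy x x0.
  pose N := maxn N0 N1.
  exists (pairing (u N) f); exists N => // n /= Nn.
  rewrite /ball/= distrC; apply: (@le_lt_trans _ _ (e / 2)).
    apply: Hx; first by apply: HM; apply: HN0 => //; exact: leq_maxl.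
    by apply: HN1; [exact: leq_maxr|exact: leq_trans (leq_maxr _ _) Nn].
  by rewrite ltr_pdivrMr// ltr_pMr// ltr1n.
pose L f := limn (fun n => pairing (u n) f).
have uL f : Cc f -> pairing (u n) f @[n --> \oo] --> L f by move=> /cvu.
have [f g cf cg|c f cf|f cf f0|m rm mL] := @riesz_markov R d L.
- have h1 : (fun n => pairing (u n) (fun x => f x + g x)) @ \oo --> L f + L g.
    rewrite (_ : (fun n => _) = (fun n => pairing (u n) f + pairing (u n) g)).
      by apply: cvgD; exact: uL.
    by apply/funext => n; rewrite pairingD.
  by apply/cvg_lim.
- have h1 : (fun n => pairing (u n) (fun x => c * f x)) @ \oo --> c * L f.
    rewrite (_ : (fun n => _) = (fun n => c * pairing (u n) f)).
      by apply: cvgMr; exact: uL.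
    by apply/funext => n; rewrite pairingZ.
  by apply/cvg_lim.
- by apply: limr_ge; [exact: cvu|apply: nearW => n; exact: pairing_ge0].
have um f : Cc f -> pairing (u n) f @[n --> \oo] --> pairing m f.
  by move=> cf; rewrite /pairing mL//; exact: uL.
exists m => // s s0; pose e k := s / 2 ^+ k.+1.
have ek k : 0 < e k by exact: geom_gt0.
(* The accuracy is shifted by one because step 0 of the chain is spent on the passage from [u n] to
   the subsequence. *)
have /choice[N HN] k := cauchy (e k.+1) (ek k.+1).
exists (N 0%N) => n n0.
(* The sum exceeds all thresholds [N j] with [j <= k], and the added [k] makes the index tend to
   infinity. *)
pose idx k := (\sum_(j < k.+1) N j + k)%N.
have idxN j k : (j <= k)%N -> (N j <= idx k)%N.
  move=> jk; rewrite /idx (bigD1 (Ordinal (jk : (j < k.+1)%N)))//= -addnA leq_addr//.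
(* The chain starts afresh at each [u n] with [n >= N 0], so the whole sequence converges and not
   only the subsequence. *)
pose v k := if k is k'.+1 then u (idx k') else u n.
have Wv k : (W (v k) (v k.+1) < (e k)%:E)%E.
  case: k => [|k] /=.
    apply: (@lt_trans _ _ (e 1%N)%:E); last by rewrite lte_fin geom_lt.
    by apply: HN => //; exact: idxN.
  by apply: HN; exact: idxN.
have vm f : Cc f -> pairing (v n) f @[n --> \oo] --> pairing m f.
  move=> cf; have h := um f cf.
  rewrite -cvg_shiftS /=; apply: cvg_comp h.
  move=> A [K _ KA]; exists K => // k /= Kk; apply: KA => /=.
  by rewrite (leq_trans Kk)// leq_addl.
have es : \sum_(k < n) e k @[n --> \oo] --> s by exact: geom.
exact: (@Wdist_chain v e s m ek Wv es rm vm).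
Qed.
End DistanceAndCurves.

Theorem mainTheorem8 (R : realType) (d : nat) (p : R) (phi : R -> Rd R d -> R)
    (gamma sigma : Meas R d) :
  1 < p -> admissible p phi -> radon gamma -> radon sigma ->
  let W := Wdist p phi gamma in
  let M := Mspace p phi gamma sigma in
  [/\ ((forall mu eta, M mu -> M eta -> (W mu eta < +oo)%E) /\
       (forall mu, M mu -> W mu mu = 0%E)),
      (forall mu eta, M mu -> M eta -> W mu eta = 0%E -> meq mu eta),
      (forall mu eta, M mu -> M eta -> W mu eta = W eta mu),
      (forall mu eta xi, M mu -> M eta -> M xi -> (W mu xi <= W mu eta + W eta xi)%E) &
      (forall u : nat -> Meas R d, (forall n, M (u n)) ->
         (forall e : R, 0 < e -> exists N : nat, forall m n, (N <= m)%N -> (N <= n)%N ->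
              (W (u m) (u n) < e%:E)%E) ->
         exists mu, M mu /\ (fun n => W (u n) mu) @ \oo --> 0%E)].
Proof.
move=> p1 adm rg rs W M.
(* The finite distance to [sigma] provides the curve issued from [mu] on which [Wdist_self]
   relies. *)
have self mu : M mu -> W mu mu = 0%E.
  by move=> [_ h]; exact: (Wdist_self p1 adm rg h).
have fin mu eta : M mu -> M eta -> (W mu eta < +oo)%E.
  move=> [_ h1] [_ h2]; apply: (le_lt_trans (Wdist_triangle p1 adm rg mu sigma eta)).
  by rewrite lte_add_pinfty// (Wdist_sym p1 adm rg).
split.
- by split.
- by move=> mu eta _ _; exact: (Wdist_eq0 p1 adm rg).
- by move=> mu eta _ _; exact: (Wdist_sym p1 adm rg).
- by move=> mu eta xi _ _ _; exact: (Wdist_triangle p1 adm rg).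
- move=> u Mu cauchy.
  have ru n : radon (u n) by case: (Mu n).
  have [m rm Hm] := Wdist_complete p1 adm rg ru cauchy.
  exists m; split.
    split => //; have [N HN] := Hm 1 ltr01.
    apply: (le_lt_trans (Wdist_triangle p1 adm rg m (u N) sigma)).
    rewrite lte_add_pinfty//; last by case: (Mu N).
    rewrite (Wdist_sym p1 adm rg); apply: le_lt_trans (HN N (leqnn N)) _.
    by rewrite ltry.
  have fn e n : (W (u n) m <= e%:E)%E -> W (u n) m \is a fin_num.
    by move=> h; rewrite ge0_fin_numE ?Wdist_ge0// (le_lt_trans h)// ltry.
  apply/fine_cvgP; split.
    by have [N HN] := Hm 1 ltr01; exists N => // n /= Nn; exact: fn (HN n Nn).
  apply/cvgrPdist_le => e e0; have [N HN] := Hm e e0; exists N => // n /= Nn.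
  have h := HN n Nn; rewrite sub0r normrN ger0_norm ?fine_ge0 ?Wdist_ge0//.
  by rewrite -lee_fin fineK// (fn e).
Qed.
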